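(* Let $\alpha\in(0,1)$ and consider a $\mathcal{CM}$-preserving scheme of order $\alpha$ with numerical stability region $\mathcal S_h\subset\mathbb C$. Then: (1) the complement $\mathcal S_h^c=\mathbb C\setminus\mathcal S_h$ is a bounded set contained in the (closed) right half complex plane; (2) there exists $\theta_0\in(0,\frac\pi2)$ such that $\mathcal S_h\supset S(\pi-\theta_0)$, where $S(\beta)=\{z\in\mathbb C: z\ne0,\ |\arg(-z)|<\beta\}$; (3) there exist $\delta_0>0$ and a continuous function $\beta:[0,\delta_0]\to[0,\pi]$ with $\beta(\delta)\to\frac{\alpha\pi}2$ as $\delta\to0^+$ such that $\mathcal S_h$ contains $$\bigcup_{0<\delta\le\delta_0}\{\zeta\in\mathbb C:\ \zeta\neq 0,\ |\zeta|\le\delta,\ |\arg(\zeta)|\ge\beta(\delta)\}.$$ In particular, $\mathcal S_h\supset\{\zeta\in\mathbb C:\mathrm{Re}(\zeta)\le0\}\setminus\{0\}$.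
   Context: A real sequence $v=(v_0,v_1,\dots)$ is completely monotone if $((I-E)^jv)_k\ge 0$ for all $j,k\ge 0$, where $(Ev)_k=v_{k+1}$. Convolution: $(u*v)_n=\sum_{j=0}^n u_jv_{n-j}$, with identity $\delta_d=(1,0,0,\dots)$; $\omega^{(-1)}$ is the sequence with $\omega*\omega^{(-1)}=\delta_d$. For $\alpha\in(0,1)$ and step size $h>0$, a real sequence $\omega$ with $\omega_0\ne0$ (independent of $h$) defines the scheme $h^{-\alpha}\sum_{j=0}^n\omega_j(u_{n-j}-u_0)=f(t_n,u_n)$, $n\ge1$, $t_n=nh$, for the Caputo fractional ODE $\mathcal D_c^\alpha u=f(t,u)$, $u(0)=u_0$; equivalently, with $a=\omega^{(-1)}$, $u_n=u_0+h^\alpha\sum_{j=0}^{n-1}a_jf(t_{n-j},u_{n-j})$, $n\ge1$. With $F_a(z)=\sum_{n\ge0}a_nz^n$, the scheme is consistent if $h^\alpha F_a(e^{-h})=1+o(1)$ as $h\to0^+$. A scheme is $\mathcal{CM}$-preserving if it is consistent and $a=\omega^{(-1)}$ is completely monotone. Numerical stability region: apply the scheme to the test equation $\mathcal D_c^\alpha u=\lambda u$, $\lambda\in\mathbb C$, with $u_0\ne0$, i.e. $u_n=u_0+\lambda h^\alpha\sum_{j=0}^{n-1}a_ju_{n-j}$ for $n\ge1$. Then $\mathcal S_h$ is the set of $\zeta=\lambda h^\alpha\in\mathbb C$ for which the numerical solution (is well defined and) satisfies $u_n\to0$ as $n\to\infty$. The function $\arg$ has branch cut along the negative real axis and range $(-\pi,\pi]$.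 *)

(* Defs.v *)
From Stdlib Require Import Reals Lra.
From Coquelicot Require Import Coquelicot.
Open Scope R_scope.

(* (I - E) v, where (E v)_k = v_{k+1}. *)
Definition backdiff (v : nat -> R) : nat -> R := fun k => v k - v (S k).

Definition completely_monotone (v : nat -> R) : Prop :=
  forall j k : nat, 0 <= Nat.iter j backdiff v k.

Definition conv (u v : nat -> R) : nat -> R :=
  fun n => sum_n (fun j => u j * v (n - j)%nat) n.

Definition delta_d : nat -> R := fun n => match n with O => 1 | S _ => 0 end.

Definition is_conv_inverse (omega a : nat -> R) : Prop :=
  forall n : nat, conv omega a n = delta_d n.

(* Below, a = omega^(-1) represents the scheme with coefficients omega. *)

(* PSeries is total, so the convergence of F_a(e^{-h}) for small h is
   recorded separately. *)
Definition consistent (alpha : R) (a : nat -> R) : Prop :=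
  at_right 0 (fun h => ex_pseries a (exp (- h))) /\
  filterlim (fun h => Rpower h alpha * PSeries a (exp (- h)))
            (at_right 0) (locally 1).

Definition CM_preserving (alpha : R) (a : nat -> R) : Prop :=
  consistent alpha a /\ completely_monotone a.

(* The scheme for the test equation with parameter lambda.  The index is
   shifted: u_{n+1} = u_0 + lambda h^alpha sum_{j=0}^{n} a_j u_{n+1-j}, n >= 0
   (sum_n f n has the n+1 terms f 0, ..., f n).  The unknown u_{n+1} also
   occurs on the right-hand side. *)
Definition test_solution (alpha h : R) (a : nat -> R) (lambda : C)
    (u : nat -> C) : Prop :=
  forall n : nat,
    u (S n) =
      (u O + lambda * RtoC (Rpower h alpha) *
               sum_n (fun j => RtoC (a j) * u (S n - j)%nat) n)%C.

Definition stability_region (alpha h : R) (a : nat -> R) (zeta : C) : Prop :=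
  exists lambda : C,
    zeta = (lambda * RtoC (Rpower h alpha))%C /\
    forall u0 : C, u0 <> RtoC 0 ->
      exists u : nat -> C,
        (u O = u0 /\ test_solution alpha h a lambda u) /\
        (forall v : nat -> C,
            v O = u0 -> test_solution alpha h a lambda v ->
            forall n : nat, v n = u n) /\
        filterlim u eventually (locally (RtoC 0)).

(* Principal value in (-PI, PI]; the value at 0 is irrelevant. *)
Definition Carg (z : C) : R :=
  if Rle_dec 0 (Im z) then acos (Re z / Cmod z) else - acos (Re z / Cmod z).

Lemma Carg_spec (z : C) : z <> RtoC 0 ->
  - PI < Carg z <= PI /\
  Re z = Cmod z * cos (Carg z) /\ Im z = Cmod z * sin (Carg z).
Proof.
intros Hz.
assert (Hm : 0 < Cmod z) by now apply Cmod_gt_0.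
assert (Hsq : Cmod z * Cmod z = Re z * Re z + Im z * Im z).
{ unfold Cmod. rewrite sqrt_sqrt; unfold Re, Im; nra. }
set (c := Re z / Cmod z).
assert (Hc : Re z = Cmod z * c) by (unfold c; field; lra).
assert (Hc1 : -1 <= c <= 1).
{ assert (c * c <= 1).
  { apply Rmult_le_reg_l with (Cmod z * Cmod z); nra. }
  split; nra. }
assert (Hs : Cmod z * sin (acos c) = Rabs (Im z)).
{ rewrite sin_acos by exact Hc1.
  rewrite <- (Rabs_pos_eq (Cmod z)) by lra.
  rewrite <- (sqrt_Rsqr_abs (Cmod z)), <- (sqrt_Rsqr_abs (Im z)).
  rewrite <- sqrt_mult.
  - f_equal. unfold Rsqr. nra.
  - apply Rle_0_sqr.
  - unfold Rsqr; nra. }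
pose proof (acos_bound c) as Hb.
pose proof PI_RGT_0 as HPI.
unfold Carg; fold c; destruct (Rle_dec 0 (Im z)) as [Hi|Hi].
- rewrite Rabs_pos_eq in Hs by exact Hi.
  rewrite cos_acos by exact Hc1. repeat split; lra.
- rewrite Rabs_left in Hs by lra.
  rewrite cos_neg, sin_neg, cos_acos by exact Hc1.
  assert (acos c <> PI).
  { intros E. rewrite E, sin_PI in Hs. lra. }
  repeat split; lra.
Qed.

Definition sector (b : R) (z : C) : Prop :=
  z <> RtoC 0 /\ Rabs (Carg (Copp z)) < b.

(* Main.v *)
Require Import Defs.
From Stdlib Require Import Reals Lra Lia List Arith.
From Coquelicot Require Import Coquelicot.
Open Scope R_scope.

(** Let [F] be the generating function of [a] and [W = 1 / F] that of [omega].
    For the test equation the generating function of [u_1, u_2, ...] is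
    [u_0 W(z) / ((1 - z) (W(z) - zeta))], that is, [u_(n+1) = u_0 (c * r)_n] with
    [c_n = omega_0 + ... + omega_n] and [r] the coefficients of [1 / (W - zeta)].

    Everything rests on one criterion ([stable_criterion]): a nonzero [zeta] is
    stable as soon as [W - zeta] is bounded away from 0 on the open unit disc.
    Complete monotonicity makes [a] log-convex, hence [omega_j <= 0] for [j >= 1]
    ([kaluza]); since the sum of [a] diverges, [c] decreases to 0.  The
    coefficients [r] tend to 0 ([reciprocal_null]): Parseval's inequality bounds
    their l2 norm on every circle inside which the series is known to converge,
    and this bound is strong enough to enlarge the circle by a fixed factor.
    Finally the partial sums of [r] are [((c * r)_n - 1) / zeta], and summation by
    parts turns this feedback into [c * r -> 0] ([conv_null]).

    As [W] maps the disc into the closed disc of centre and radius [omega_0], all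
    [zeta] outside the latter are stable.  This gives the boundedness statement
    and the left half plane, but the excluded disc is tangent to the imaginary
    axis at 0, so for the sectors one must know [W] near 0, that is, [F] near its
    singularity 1.  There [s^alpha F(1 - s e^(i phi))] tends to
    [e^(- i alpha phi)] as [s -> 0], uniformly for directions pointing into the
    disc ([scaled_genfun_uniform]); hence small values of [W] lie in a sector of
    half-angle barely above [alpha PI / 2] ([stable_near_zero]).

    Consistency gives this asymptotic only for [phi = 0].  It is carried over to
    complex directions by positivity: [F] is a limit of nonnegative combinations
    of kernels [1 / (1 - t z)], [0 <= t <= 1], so inequalities between kernels pass
    to [F] ([positivity_principle]).  Three such inequalities suffice.  Complex
    kernels are uniformly close to combinations of real ones, so a limit exists
    in every direction ([scaled_genfun_limit]).  The limit is homogeneous of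
    degree [- alpha] along rays and obeys the Cauchy-Riemann equation up to
    second order, so rotating by [eta] multiplies it by [e^(- i alpha eta)] up to
    [O(eta^2)] ([rotation_step]), and many small rotations leave no error.  A
    Lipschitz bound in [phi] gives uniformity.

    The last step, [continuous_gauge], turns a radius for each opening of the
    sector into a continuous opening [beta]. *)

(** * Finite sums *)

(** Unlike [sum_n f n], which has [n + 1] terms, this one allows the empty sum;
    likewise [rsum]. *)
Fixpoint csum (f : nat -> C) (n : nat) : C :=
  match n with O => RtoC 0 | S m => (csum f m + f m)%C end.

Fixpoint rsum (f : nat -> R) (n : nat) : R :=
  match n with O => 0 | S m => rsum f m + f m end.

Lemma csum_sum_n (f : nat -> C) n : sum_n f n = csum f (S n).
Proof.
induction n as [|n IH].
- rewrite sum_O. simpl. ring.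
- rewrite sum_Sn, IH. reflexivity.
Qed.

Lemma rsum_sum_n (f : nat -> R) n : sum_n f n = rsum f (S n).
Proof.
induction n as [|n IH].
- rewrite sum_O. simpl. ring.
- rewrite sum_Sn, IH. reflexivity.
Qed.

Lemma csum_ext f g n : (forall k, (k < n)%nat -> f k = g k) -> csum f n = csum g n.
Proof.
induction n as [|n IH]; intros H; simpl; [reflexivity|].
rewrite IH by (intros; apply H; lia). rewrite H by lia. reflexivity.
Qed.

Lemma rsum_ext f g n : (forall k, (k < n)%nat -> f k = g k) -> rsum f n = rsum g n.
Proof.
induction n as [|n IH]; intros H; simpl; [reflexivity|].
rewrite IH by (intros; apply H; lia). rewrite H by lia. reflexivity.
Qed.

Lemma csum_plus f g n : csum (fun k => f k + g k)%C n = (csum f n + csum g n)%C.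
Proof. induction n as [|n IH]; simpl; [ring|rewrite IH; ring]. Qed.

Lemma csum_minus f g n : csum (fun k => f k - g k)%C n = (csum f n - csum g n)%C.
Proof. induction n as [|n IH]; simpl; [ring|rewrite IH; ring]. Qed.

Lemma rsum_plus f g n : rsum (fun k => f k + g k) n = rsum f n + rsum g n.
Proof. induction n as [|n IH]; simpl; [ring|rewrite IH; ring]. Qed.

Lemma csum_scal c f n : csum (fun k => c * f k)%C n = (c * csum f n)%C.
Proof. induction n as [|n IH]; simpl; [ring|rewrite IH; ring]. Qed.

Lemma rsum_scal c f n : rsum (fun k => c * f k) n = c * rsum f n.
Proof. induction n as [|n IH]; simpl; [ring|rewrite IH; ring]. Qed.

Lemma csum_zero f n : (forall k, (k < n)%nat -> f k = RtoC 0) -> csum f n = RtoC 0.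
Proof.
induction n as [|n IH]; intros H; simpl; [reflexivity|].
rewrite IH, H by (try (intros; apply H); lia). ring.
Qed.

Lemma csum_head f n : csum f (S n) = (f O + csum (fun k => f (S k)) n)%C.
Proof.
induction n as [|n IH]; [simpl; ring|].
change (csum f (S (S n))) with (csum f (S n) + f (S n))%C.
rewrite IH. simpl. ring.
Qed.

Lemma rsum_head f n : rsum f (S n) = f O + rsum (fun k => f (S k)) n.
Proof.
induction n as [|n IH]; [simpl; ring|].
change (rsum f (S (S n))) with (rsum f (S n) + f (S n)).
rewrite IH. simpl. ring.
Qed.

Lemma csum_split f p q :
  csum f (p + q) = (csum f p + csum (fun k => f (p + k)%nat) q)%C.
Proof.
induction q as [|q IH].
- rewrite Nat.add_0_r. simpl. ring.
- rewrite Nat.add_succ_r. simpl. rewrite IH. ring.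
Qed.

Lemma rsum_split f p q :
  rsum f (p + q) = rsum f p + rsum (fun k => f (p + k)%nat) q.
Proof.
induction q as [|q IH].
- rewrite Nat.add_0_r. simpl. ring.
- rewrite Nat.add_succ_r. simpl. rewrite IH. ring.
Qed.

Lemma rsum_le f g n : (forall k, (k < n)%nat -> f k <= g k) -> rsum f n <= rsum g n.
Proof.
induction n as [|n IH]; intros H; simpl; [lra|].
apply Rplus_le_compat; [apply IH; intros; apply H|apply H]; lia.
Qed.

Lemma rsum_nonneg f n : (forall k, (k < n)%nat -> 0 <= f k) -> 0 <= rsum f n.
Proof.
induction n as [|n IH]; intros H; simpl; [lra|].
apply Rplus_le_le_0_compat; [apply IH; intros; apply H|apply H]; lia.
Qed.

Lemma rsum_const c n : rsum (fun _ => c) n = INR n * c.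
Proof. induction n as [|n IH]; [simpl; ring|]. rewrite S_INR. simpl. rewrite IH. ring. Qed.

Lemma rsum_mono f p q : (forall k, 0 <= f k) -> (p <= q)%nat -> rsum f p <= rsum f q.
Proof.
intros H Hpq. replace q with (p + (q - p))%nat by lia. rewrite rsum_split.
assert (0 <= rsum (fun k => f (p + k)%nat) (q - p)); [|lra].
apply rsum_nonneg; intros; apply H.
Qed.

Lemma rsum_term_le f k n : (forall k, 0 <= f k) -> (k < n)%nat -> f k <= rsum f n.
Proof.
intros H Hk. apply Rle_trans with (rsum f (S k)); [|apply rsum_mono; [apply H|lia]].
simpl. pose proof (rsum_nonneg f k (fun i _ => H i)). lra.
Qed.

Lemma Cmod_csum f n : Cmod (csum f n) <= rsum (fun k => Cmod (f k)) n.
Proof.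
induction n as [|n IH]; simpl; [rewrite Cmod_0; lra|].
eapply Rle_trans; [apply Cmod_triangle|lra].
Qed.

Lemma RtoC_rsum f n : RtoC (rsum f n) = csum (fun k => RtoC (f k)) n.
Proof. induction n as [|n IH]; simpl; [reflexivity|]. rewrite RtoC_plus, IH. reflexivity. Qed.

Lemma csum_exchange (f : nat -> nat -> C) n m :
  csum (fun i => csum (fun j => f i j) m) n = csum (fun j => csum (fun i => f i j) n) m.
Proof.
induction n as [|n IH]; simpl.
- symmetry; apply csum_zero; reflexivity.
- rewrite IH, <- csum_plus. reflexivity.
Qed.

(** * Convolution of complex sequences *)

Definition cconv (u v : nat -> C) (n : nat) : C :=
  csum (fun j => u j * v (n - j)%nat)%C (S n).

Definition cdelta (n : nat) : C := match n with O => RtoC 1 | S _ => RtoC 0 end.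

Lemma cconv_ext u u' v v' n :
  (forall k, (k <= n)%nat -> u k = u' k) -> (forall k, (k <= n)%nat -> v k = v' k) ->
  cconv u v n = cconv u' v' n.
Proof.
intros Hu Hv. apply csum_ext. intros k Hk. rewrite Hu, Hv by lia. reflexivity.
Qed.

Lemma cconv_S_l u v n :
  cconv u v (S n) = (u O * v (S n) + cconv (fun k => u (S k)) v n)%C.
Proof. unfold cconv. rewrite csum_head. reflexivity. Qed.

Lemma cconv_S_r u v n :
  cconv u v (S n) = (cconv u (fun k => v (S k)) n + u (S n) * v O)%C.
Proof.
unfold cconv. change (csum ?f (S (S n))) with (csum f (S n) + f (S n))%C.
cbv beta. rewrite Nat.sub_diag. f_equal. apply csum_ext. intros k Hk.
replace (S n - k)%nat with (S (n - k)) by lia. reflexivity.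
Qed.

Lemma cconv_comm u v n : cconv u v n = cconv v u n.
Proof.
revert u v. induction n as [|n IH]; intros u v.
- unfold cconv; simpl; ring.
- rewrite cconv_S_l, cconv_S_r, IH. ring.
Qed.

Lemma cconv_plus_l u u' v n :
  cconv (fun k => u k + u' k)%C v n = (cconv u v n + cconv u' v n)%C.
Proof.
unfold cconv. rewrite <- csum_plus. apply csum_ext. intros; ring.
Qed.

Lemma cconv_scal_l c u v n :
  cconv (fun k => c * u k)%C v n = (c * cconv u v n)%C.
Proof.
unfold cconv. rewrite <- csum_scal. apply csum_ext. intros; ring.
Qed.

Lemma cconv_assoc u v w n : cconv (cconv u v) w n = cconv u (cconv v w) n.
Proof.
revert u. induction n as [|n IH]; intros u.
- unfold cconv; simpl; ring.
- rewrite (cconv_S_l (cconv u v)), (cconv_S_l u).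
  rewrite (cconv_ext (fun k => cconv u v (S k))
    (fun k => u O * v (S k) + cconv (fun k => u (S k)) v k)%C w w);
    [|intros; apply cconv_S_l|reflexivity].
  rewrite (cconv_plus_l (fun k => u O * v (S k))%C (cconv (fun k => u (S k)) v)).
  rewrite cconv_scal_l, IH, (cconv_S_l v).
  unfold cconv at 1; simpl. ring.
Qed.

Lemma cconv_delta_l v n : cconv cdelta v n = v n.
Proof.
destruct n as [|n]; [unfold cconv; simpl; ring|].
rewrite cconv_S_l. simpl.
unfold cconv. rewrite csum_zero by (intros; ring). ring.
Qed.

(** Term [n] of the fixed-point iteration [it] depends only on the terms before
    [n] of its predecessor, so it is stationary from step [n + 1] on. *)
Lemma cconv_inverse_exists (b : nat -> C) :
  b O <> RtoC 0 -> exists r : nat -> C, forall n, cconv b r n = cdelta n.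
Proof.
intros Hb.
set (T := fun (f : nat -> C) (n : nat) => match n with
  | O => (/ b O)%C
  | S m => (- cconv (fun k => b (S k)) f m / b O)%C end).
set (it := fun k => Nat.iter k T (fun _ => RtoC 0)).
assert (Hst : forall n k k', (n < k)%nat -> (n < k')%nat -> it k n = it k' n).
{ intros n; induction n as [n IH] using (well_founded_induction lt_wf).
  intros [|k] [|k'] H H'; try lia.
  change (T (it k) n = T (it k') n).
  destruct n as [|n]; [reflexivity|].
  unfold T. rewrite (cconv_ext _ (fun k => b (S k)) (it k) (it k') n); [reflexivity|reflexivity|].
  intros j Hj. apply IH; lia. }
exists (fun n => it (S n) n). intros [|n].
- unfold cconv, it; simpl. field. exact Hb.
- rewrite cconv_S_l.
  change (it (S (S n)) (S n)) with (- cconv (fun k => b (S k)) (it (S n)) n / b O)%C.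
  rewrite (cconv_ext _ (fun k => b (S k)) (fun n => it (S n) n) (it (S n)));
   [|reflexivity|intros k Hk; apply Hst; lia].
  simpl. field. exact Hb.
Qed.

Definition ones (n : nat) : C := RtoC 1.

Lemma cconv_one_r u n : cconv u ones n = csum u (S n).
Proof. apply csum_ext. intros; unfold ones; ring. Qed.

(** * Null sequences and a convolution lemma *)

Definition cnull (u : nat -> C) : Prop :=
  forall eps, 0 < eps -> exists N, forall n, (N <= n)%nat -> Cmod (u n) < eps.

Lemma cnull_filterlim u : cnull u -> filterlim u eventually (locally (RtoC 0)).
Proof.
intros H. apply filterlim_locally. intros eps.
destruct (H eps (cond_pos eps)) as [N HN]. exists N. intros n Hn.
apply C_NormedModule_mixin_compat1.
replace (minus (u n) (RtoC 0)) with (u n); [auto|].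
unfold minus, plus, opp; simpl. ring.
Qed.

Lemma cnull_bounded u : cnull u -> exists K, 0 <= K /\ forall n, Cmod (u n) <= K.
Proof.
intros H. destruct (H 1 Rlt_0_1) as [N HN].
exists (rsum (fun k => Cmod (u k)) N + 1). split.
{ assert (0 <= rsum (fun k => Cmod (u k)) N); [|lra].
  apply rsum_nonneg; intros; apply Cmod_ge_0. }
intros n. destruct (le_lt_dec N n) as [Hn|Hn].
- specialize (HN n Hn). assert (0 <= rsum (fun k => Cmod (u k)) N); [|lra].
  apply rsum_nonneg; intros; apply Cmod_ge_0.
- pose proof (rsum_term_le (fun k => Cmod (u k)) n N (fun k => Cmod_ge_0 _) Hn).
  simpl in H0. lra.
Qed.

(** Summation by parts; as the weights are nondecreasing, their increments add
    up to [d m - d 0]. *)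
Lemma abel_bound (d : nat -> R) (r : nat -> C) B m :
  (forall i, d i <= d (S i)) ->
  (forall k, (k < m)%nat -> Cmod (csum r (S k)) <= B) ->
  Cmod (csum (fun i => r i * RtoC (d i)) (S m) - RtoC (d m) * csum r (S m))%C
    <= B * (d m - d O).
Proof.
intros Hd. induction m as [|m IH]; intros HB.
- simpl. replace (_ - _)%C with (RtoC 0) by ring. rewrite Cmod_0. lra.
- assert (IH' := IH (fun k Hk => HB k ltac:(lia))).
  replace (csum (fun i => r i * d i) (S (S m)) - d (S m) * csum r (S (S m)))%C
   with ((csum (fun i => r i * d i) (S m) - d m * csum r (S m))
      + (- RtoC (d (S m) - d m) * csum r (S m)))%C.
  2:{ change (csum ?f (S (S m))) with (csum f (S m) + f (S m))%C.
      rewrite RtoC_minus. cbv beta. ring. }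
  eapply Rle_trans; [apply Cmod_triangle|].
  rewrite Cmod_mult, Cmod_opp, Cmod_R.
  specialize (Hd m). rewrite Rabs_pos_eq by lra.
  specialize (HB m ltac:(lia)).
  assert ((d (S m) - d m) * Cmod (csum r (S m)) <= (d (S m) - d m) * B)
    by (apply Rmult_le_compat_l; lra).
  lra.
Qed.

Section AbelConvolution.
Variables (c : nat -> R) (r : nat -> C) (zeta : C).
Hypothesis c_decr : forall n, c (S n) <= c n.
Hypothesis c_pos : forall n, 0 <= c n.
Hypothesis c_lim : forall eps, 0 < eps -> exists N, c N < eps.
Hypothesis r_null : cnull r.
Hypothesis zeta_nz : zeta <> RtoC 0.
Let g := cconv (fun n => RtoC (c n)) r.
Hypothesis g_eq : forall n, (zeta * csum r (S n) = g n - 1)%C.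

Lemma c_antitone p q : (p <= q)%nat -> c q <= c p.
Proof. induction 1; [lra|]. specialize (c_decr m). lra. Qed.

Lemma partial_sum_bound G k : Cmod (g k) <= G -> Cmod (csum r (S k)) <= (1 + G) / Cmod zeta.
Proof.
intros H. assert (Hz : 0 < Cmod zeta) by now apply Cmod_gt_0.
apply Rmult_le_reg_l with (Cmod zeta); [lra|].
rewrite <- Cmod_mult, g_eq.
replace (Cmod zeta * ((1 + G) / Cmod zeta)) with (G + 1) by (field; lra).
unfold Cminus. eapply Rle_trans; [apply Cmod_triangle|].
rewrite Cmod_opp, Cmod_1. lra.
Qed.

Lemma tail_block_bound rho m N :
  (forall k, (m < k)%nat -> Cmod (r k) <= rho) ->
  Cmod (csum (fun k => r (S m + k)%nat * RtoC (c (m + N - (S m + k))%nat))%C N)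
    <= INR N * (rho * c O).
Proof.
intros H. eapply Rle_trans; [apply Cmod_csum|].
rewrite <- rsum_const. apply rsum_le. intros k Hk.
rewrite Cmod_mult, Cmod_R, Rabs_pos_eq by apply c_pos.
apply Rmult_le_compat; [apply Cmod_ge_0|apply c_pos|apply H; lia|apply c_antitone; lia].
Qed.

(** In [g (m + N)] the terms with weight [c N] or less are summed by parts and
    meet only the partial sums of [r] up to [m], which [g_eq] expresses through
    earlier values of [g]; the other [N] terms involve only [r k] with [k > m]. *)
Lemma conv_block_bound rho m N G :
  (0 < N)%nat ->
  (forall k, (m < k)%nat -> Cmod (r k) <= rho) ->
  (forall k, (k <= m)%nat -> Cmod (g k) <= G) ->
  Cmod (g (m + N)) <= 2 * c N * ((1 + G) / Cmod zeta) + INR N * (rho * c O).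
Proof.
intros HN Hr HG. set (B := (1 + G) / Cmod zeta).
assert (HR : forall k, (k <= m)%nat -> Cmod (csum r (S k)) <= B)
  by (intros; apply partial_sum_bound; auto).
assert (HB : 0 <= B) by (apply Rle_trans with (2 := HR O ltac:(lia)); apply Cmod_ge_0).
unfold g. rewrite cconv_comm. unfold cconv.
change (S (m + N)) with (S m + N)%nat. rewrite csum_split.
eapply Rle_trans; [apply Cmod_triangle|].
apply Rplus_le_compat; [|apply tail_block_bound; auto].
pose proof (abel_bound (fun i => c (m + N - i)%nat) r B m) as HA.
assert (Hmono : forall i, c (m + N - i)%nat <= c (m + N - S i)%nat)
  by (intros i; apply c_antitone; lia).
specialize (HA Hmono (fun k Hk => HR k (Nat.lt_le_incl _ _ Hk))).
cbv beta in HA. replace (m + N - m)%nat with N in HA by lia.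
set (X := csum (fun i => r i * c (m + N - i)%nat)%C (S m)) in *.
replace X with ((X - c N * csum r (S m)) + c N * csum r (S m))%C by ring.
eapply Rle_trans; [apply Cmod_triangle|].
rewrite Cmod_mult, Cmod_R, Rabs_pos_eq by apply c_pos.
assert (c N * Cmod (csum r (S m)) <= c N * B)
  by (apply Rmult_le_compat_l; [apply c_pos|apply HR; lia]).
pose proof (c_pos (m + N - 0)).
assert (0 <= B * c (m + N - 0)%nat) by (apply Rmult_le_pos; auto).
nra.
Qed.

Lemma c_small_index eps : 0 < eps -> exists N, (0 < N)%nat /\ c N < eps.
Proof.
intros H. destruct (c_lim eps H) as [N HN]. exists (S N). split; [lia|].
specialize (c_decr N). lra.
Qed.

(** When [c N] is small against [zeta], the block bound turns a bound [G] on the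
    earlier values into [(1 + G) / 4 + K], and [G = 1 + 2 * K] reproduces
    itself. *)
Lemma conv_bounded : exists G, 0 <= G /\ forall n, Cmod (g n) <= G.
Proof.
assert (Hz : 0 < Cmod zeta) by now apply Cmod_gt_0.
destruct (cnull_bounded r r_null) as [rho [Hrho Hr]].
destruct (c_small_index (Cmod zeta / 8)) as [N [HN HcN]]; [lra|].
set (K := INR N * (rho * c O)).
assert (HK : 0 <= K).
{ apply Rmult_le_pos; [apply pos_INR|apply Rmult_le_pos; auto]. }
exists (1 + 2 * K). split; [lra|].
intros n; induction n as [n IH] using (well_founded_induction lt_wf).
destruct (le_lt_dec N n) as [Hn|Hn].
- replace n with ((n - N) + N)%nat by lia.
  eapply Rle_trans; [apply (conv_block_bound rho (n - N) N (1 + 2 * K)); auto|].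
  + intros k Hk; apply IH; lia.
  + fold K. apply Rle_trans with (2 * (Cmod zeta / 8) * ((1 + (1 + 2 * K)) / Cmod zeta) + K).
    * apply Rplus_le_compat_r, Rmult_le_compat_r; [|lra].
      apply Rmult_le_pos; [lra|]. apply Rlt_le, Rinv_0_lt_compat; lra.
    * replace (2 * (Cmod zeta / 8) * ((1 + (1 + 2 * K)) / Cmod zeta))
        with ((2 + 2 * K) / 4) by (field; lra). lra.
- apply Rle_trans with K; [|lra].
  unfold g, cconv. eapply Rle_trans; [apply Cmod_csum|].
  apply Rle_trans with (rsum (fun _ => rho * c O) (S n)).
  + apply rsum_le. intros k Hk.
    rewrite Cmod_mult, Cmod_R, Rabs_pos_eq, Rmult_comm by apply c_pos.
    apply Rmult_le_compat; [apply Cmod_ge_0|apply c_pos|apply Hr|apply c_antitone; lia].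
  + rewrite rsum_const. apply Rmult_le_compat_r; [apply Rmult_le_pos; auto|].
    apply le_INR; lia.
Qed.

(** Convolution with a monotone null sequence [c] need not preserve null
    sequences.  It does here because [r] has bounded partial sums, by
    [conv_bounded] and [g_eq]. *)
Lemma conv_null : cnull g.
Proof.
assert (Hz : 0 < Cmod zeta) by now apply Cmod_gt_0.
destruct conv_bounded as [G [HG Hg]]. intros eps Heps.
assert (HX : 0 < (1 + G) / Cmod zeta) by (apply Rdiv_lt_0_compat; lra).
destruct (c_small_index (eps / 4 / ((1 + G) / Cmod zeta))) as [N [HN HcN]].
{ apply Rdiv_lt_0_compat; lra. }
set (Y := INR N * c O + 1).
assert (HY : 0 < Y).
{ assert (0 <= INR N * c O); [|unfold Y; lra]. apply Rmult_le_pos; [apply pos_INR|auto]. }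
destruct (r_null (eps / 4 / Y)) as [M HM]; [apply Rdiv_lt_0_compat; lra|].
exists (M + N)%nat. intros n Hn.
replace n with ((n - N) + N)%nat by lia.
eapply Rle_lt_trans;
 [apply (conv_block_bound (eps / 4 / Y) (n - N) N G); auto|].
- intros k Hk. apply Rlt_le, HM. lia.
- assert (c N * ((1 + G) / Cmod zeta) < eps / 4).
  { replace (eps / 4) with (eps / 4 / ((1 + G) / Cmod zeta) * ((1 + G) / Cmod zeta)) at 1
      by (field; lra).
    apply Rmult_lt_compat_r; auto. }
  assert (INR N * (eps / 4 / Y * c O) <= eps / 4).
  { replace (INR N * (eps / 4 / Y * c O)) with (eps / 4 / Y * (INR N * c O)) by ring.
    replace (eps / 4) with (eps / 4 / Y * Y) at 2 by (field; lra).
    apply Rmult_le_compat_l; [apply Rlt_le, Rdiv_lt_0_compat; lra|unfold Y; lra]. }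
  lra.
Qed.

End AbelConvolution.

(** * Reciprocals of log-convex sequences *)

(** The ratios [a (k + 1) / a k] increase; cross-multiplying avoids division. *)
Lemma log_convex_ratio (a : nat -> R) k n :
  (forall n, 0 < a n) -> (forall n, a (S n) * a (S n) <= a n * a (S (S n))) ->
  (k <= n)%nat -> a (S k) * a n <= a (S n) * a k.
Proof.
intros Hp Hl H. induction H as [|n H IH]; [lra|].
apply Rmult_le_reg_r with (a n); [apply Hp|].
specialize (Hl n). pose proof (Hp n). pose proof (Hp (S n)). pose proof (Hp k).
assert (a (S k) * a n * a (S n) <= a (S n) * a k * a (S n)) by (apply Rmult_le_compat_r; lra).
assert (a k * (a (S n) * a (S n)) <= a k * (a n * a (S (S n)))) by (apply Rmult_le_compat_l; lra).
nra.
Qed.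

(** Kaluza's theorem.  Eliminating [omega 0] between the identities for
    [omega * a] at [n + 1] and [n + 2] writes [omega (n + 2)] as a combination of
    the earlier [omega j], [j >= 1], whose coefficients are nonnegative because
    the ratios of [a] increase. *)
Lemma kaluza (omega a : nat -> R) :
  (forall n, 0 < a n) -> (forall n, a (S n) * a (S n) <= a n * a (S (S n))) ->
  (forall n, rsum (fun j => omega j * a (n - j)%nat) (S n) = match n with O => 1 | _ => 0 end) ->
  forall n, omega (S n) <= 0.
Proof.
intros Hp Hl Hw.
assert (H0 : 0 < omega O).
{ specialize (Hw O). simpl in Hw. pose proof (Hp O). nra. }
intros n; induction n as [n IH] using (well_founded_induction lt_wf).
destruct n as [|n].
- pose proof (Hw 1%nat) as H. simpl in H. pose proof (Hp O). pose proof (Hp 1%nat).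
  assert (0 < omega O * a 1%nat) by (apply Rmult_lt_0_compat; auto). nra.
- pose proof (Hw (S n)) as H1. pose proof (Hw (S (S n))) as H2.
  rewrite rsum_head in H1.
  change (rsum ?f (S (S (S n)))) with (rsum f (S (S n)) + f (S (S n))) in H2.
  rewrite rsum_head in H2. cbv beta in H1, H2.
  rewrite Nat.sub_diag in H2. rewrite !Nat.sub_0_r in H1, H2.
  assert (HS : a (S (S n)) * rsum (fun k => omega (S k) * a (S n - S k)%nat) (S n)
            <= a (S n) * rsum (fun k => omega (S k) * a (S (S n) - S k)%nat) (S n)).
  { rewrite <- !rsum_scal. apply rsum_le. intros k Hk.
    replace (S (S n) - S k)%nat with (S (S n - S k)) by lia.
    pose proof (log_convex_ratio a (S n - S k) (S n) Hp Hl ltac:(lia)).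
    pose proof (IH k Hk).
    assert (0 <= - omega (S k) * (a (S (S n)) * a (S n - S k)%nat - a (S (S n - S k)) * a (S n)))
      by (apply Rmult_le_pos; lra).
    nra. }
  pose proof (Hp (S n)). pose proof (Hp O).
  assert (0 <= - omega (S (S n)) * (a (S n) * a O)); [nra|].
  assert (0 < a (S n) * a O) by (apply Rmult_lt_0_compat; auto).
  nra.
Qed.

(** * Power series on the unit disc *)

Lemma rsum_geom q n : q <> 1 -> rsum (fun k => q ^ k) n = (1 - q ^ n) / (1 - q).
Proof.
intros H. induction n as [|n IH]; simpl; [field; lra|]. rewrite IH. field. lra.
Qed.

Lemma rsum_geom_le q n : 0 <= q < 1 -> rsum (fun k => q ^ k) n <= 1 / (1 - q).
Proof.
intros H. rewrite rsum_geom by lra. apply Rmult_le_compat_r.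
- apply Rlt_le, Rinv_0_lt_compat; lra.
- pose proof (pow_le q n). lra.
Qed.

Lemma Cmod_le_Re_Im z : Cmod z <= Rabs (Re z) + Rabs (Im z).
Proof.
replace z with (RtoC (Re z) + Ci * RtoC (Im z))%C at 1
  by (destruct z; unfold RtoC, Ci, Cplus, Cmult, Re, Im; simpl; f_equal; ring).
eapply Rle_trans; [apply Cmod_triangle|].
rewrite Cmod_mult, Cmod_Ci, !Cmod_R. lra.
Qed.

Lemma Re_csum f n : Re (csum f n) = rsum (fun k => Re (f k)) n.
Proof. induction n as [|n IH]; [reflexivity|]. simpl. rewrite <- IH. reflexivity. Qed.

Lemma Im_csum f n : Im (csum f n) = rsum (fun k => Im (f k)) n.
Proof. induction n as [|n IH]; [reflexivity|]. simpl. rewrite <- IH. reflexivity. Qed.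

Definition cpartial (b : nat -> C) (z : C) (n : nat) : C := csum (fun k => b k * z ^ k)%C n.

(** Summed through real and imaginary parts, which makes the sum a total
    function of [z]. *)
Definition cpseries (b : nat -> C) (z : C) : C :=
  (Series (fun n => Re (b n * z ^ n)%C), Series (fun n => Im (b n * z ^ n)%C)).

Lemma cpartial_geom_bound b K z m n :
  (forall k, Cmod (b k) <= K) -> Cmod z < 1 ->
  Cmod (cpartial b z (n + m) - cpartial b z n) <= K * Cmod z ^ n / (1 - Cmod z).
Proof.
intros HK Hz. unfold cpartial. rewrite csum_split.
replace (_ - _)%C with (csum (fun k => b (n + k)%nat * z ^ (n + k))%C m) by ring.
eapply Rle_trans; [apply Cmod_csum|].
apply Rle_trans with (rsum (fun k => (K * Cmod z ^ n) * Cmod z ^ k) m).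
- apply rsum_le. intros k _. rewrite Cmod_mult, Cmod_pow, pow_add, Rmult_assoc, <- pow_add.
  apply Rmult_le_compat_r; [apply pow_le, Cmod_ge_0|apply HK].
- rewrite rsum_scal. unfold Rdiv. apply Rmult_le_compat_l.
  + apply Rmult_le_pos; [|apply pow_le, Cmod_ge_0].
    apply Rle_trans with (2 := HK O), Cmod_ge_0.
  + rewrite <- (Rmult_1_l (/ _)). apply rsum_geom_le. split; [apply Cmod_ge_0|auto].
Qed.

Lemma series_partial f : ex_series f -> is_lim_seq (fun n => rsum f n) (Series f).
Proof.
intros H. apply Series_correct in H.
apply is_lim_seq_incr_1. eapply is_lim_seq_ext; [|exact H].
intros n. simpl. rewrite rsum_sum_n. reflexivity.
Qed.

Lemma ex_series_dominated (f : nat -> R) b K z :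
  (forall k, Cmod (b k) <= K) -> Cmod z < 1 ->
  (forall k, Rabs (f k) <= Cmod (b k * z ^ k)%C) -> ex_series f.
Proof.
intros HK Hz Hf. apply (ex_series_le f (fun n => K * Cmod z ^ n)).
- intros n. eapply Rle_trans; [apply Hf|]. rewrite Cmod_mult, Cmod_pow.
  apply Rmult_le_compat_r; [apply pow_le, Cmod_ge_0|apply HK].
- apply (ex_series_scal K (fun n => Cmod z ^ n)).
  apply ex_series_geom. rewrite Rabs_pos_eq; [auto|apply Cmod_ge_0].
Qed.

Lemma im_le_Cmod z : Rabs (Im z) <= Cmod z.
Proof. pose proof (Rmax_Cmod z). pose proof (Rmax_r (Rabs (fst z)) (Rabs (snd z))). unfold Im; lra. Qed.

Lemma cpartial_cpseries b K z :
  (forall k, Cmod (b k) <= K) -> Cmod z < 1 -> cnull (fun n => cpartial b z n - cpseries b z)%C.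
Proof.
intros HK Hz eps Heps.
assert (H1 := series_partial _ (ex_series_dominated (fun n => Re (b n * z ^ n)%C) b K z HK Hz
  (fun k => re_le_Cmod _))).
assert (H2 := series_partial _ (ex_series_dominated (fun n => Im (b n * z ^ n)%C) b K z HK Hz
  (fun k => im_le_Cmod _))).
apply is_lim_seq_spec in H1. apply is_lim_seq_spec in H2.
assert (He : 0 < eps / 2) by lra.
destruct (H1 (mkposreal _ He)) as [N1 HN1]. destruct (H2 (mkposreal _ He)) as [N2 HN2].
exists (max N1 N2). intros n Hn.
specialize (HN1 n ltac:(lia)). specialize (HN2 n ltac:(lia)). simpl in HN1, HN2.
eapply Rle_lt_trans; [apply Cmod_le_Re_Im|].
replace (Re (cpartial b z n - cpseries b z)) with (Re (cpartial b z n) - Re (cpseries b z)) by reflexivity.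
replace (Im (cpartial b z n - cpseries b z)) with (Im (cpartial b z n) - Im (cpseries b z)) by reflexivity.
unfold cpartial at 1 2. rewrite Re_csum, Im_csum. unfold cpseries. simpl. lra.
Qed.

Lemma cpseries_tail b K z n :
  (forall k, Cmod (b k) <= K) -> Cmod z < 1 ->
  Cmod (cpseries b z - cpartial b z n) <= K * Cmod z ^ n / (1 - Cmod z).
Proof.
intros HK Hz. apply le_epsilon. intros eps Heps.
destruct (cpartial_cpseries b K z HK Hz eps Heps) as [N HN].
specialize (HN (n + N)%nat ltac:(lia)).
pose proof (cpartial_geom_bound b K z N n HK Hz).
replace (cpseries b z - cpartial b z n)%C
 with (- (cpartial b z (n + N) - cpseries b z) + (cpartial b z (n + N) - cpartial b z n))%C by ring.
eapply Rle_trans; [apply Cmod_triangle|]. rewrite Cmod_opp. lra.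
Qed.

Lemma cnull_const_eq u v : cnull (fun _ => u - v)%C -> u = v.
Proof.
intros H. assert (Cmod (u - v) = 0).
{ apply Rle_antisym; [|apply Cmod_ge_0]. apply Rnot_lt_le. intros Hlt.
  destruct (H _ Hlt) as [N HN]. specialize (HN N ltac:(lia)). lra. }
apply Cmod_eq_0 in H0. replace u with (u - v + v)%C by ring. rewrite H0. ring.
Qed.

Lemma cnull_plus u v : cnull u -> cnull v -> cnull (fun n => u n + v n)%C.
Proof.
intros Hu Hv eps He. destruct (Hu (eps / 2)) as [N HN]; [lra|].
destruct (Hv (eps / 2)) as [M HM]; [lra|]. exists (max N M). intros n Hn.
specialize (HN n ltac:(lia)). specialize (HM n ltac:(lia)).
eapply Rle_lt_trans; [apply Cmod_triangle|lra].
Qed.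

Lemma cnull_ext u v : (forall n, u n = v n) -> cnull u -> cnull v.
Proof. intros H Hu eps He. destruct (Hu eps He) as [N HN]. exists N. intros. rewrite <- H. auto. Qed.

Lemma cnull_mult u v K : (forall n, Cmod (u n) <= K) -> cnull v -> cnull (fun n => u n * v n)%C.
Proof.
intros HK Hv eps He.
assert (0 <= K) by (apply Rle_trans with (2 := HK O), Cmod_ge_0).
destruct (Hv (eps / (K + 1))) as [N HN]; [apply Rdiv_lt_0_compat; lra|].
exists N. intros n Hn. rewrite Cmod_mult. specialize (HN n Hn).
apply Rle_lt_trans with (K * (eps / (K + 1))).
- apply Rmult_le_compat; try apply Cmod_ge_0; [apply HK|lra].
- replace (K * (eps / (K + 1))) with (eps * (K / (K + 1))) by (field; lra).
  assert (K / (K + 1) < 1) by (apply Rmult_lt_reg_r with (K + 1); [lra|]; unfold Rdiv;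
    rewrite Rmult_assoc, Rinv_l; lra). nra.
Qed.

Lemma cpseries_unique b K z l :
  (forall k, Cmod (b k) <= K) -> Cmod z < 1 -> cnull (fun n => cpartial b z n - l)%C -> l = cpseries b z.
Proof.
intros HK Hz Hl. apply cnull_const_eq.
assert (H1 : forall n : nat, Cmod ((fun _ => - (1))%C n) <= 1)
  by (intros _; rewrite Cmod_opp, Cmod_1; lra).
eapply cnull_ext; [|apply (cnull_plus _ _ (cpartial_cpseries b K z HK Hz) (cnull_mult _ _ 1 H1 Hl))].
intros n. cbv beta. ring.
Qed.

Lemma pow_null q : 0 <= q < 1 -> cnull (fun n => RtoC (q ^ n)).
Proof.
intros Hq eps He. destruct (pow_lt_1_zero q ltac:(rewrite Rabs_pos_eq; lra) eps He) as [N HN].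
exists N. intros n Hn. rewrite Cmod_R. apply HN. lia.
Qed.

(** Taking partial sums is convolution with the constant sequence 1, so this is
    associativity. *)
Lemma csum_cconv u v n :
  csum (cconv u v) (S n) = cconv u (fun k => csum v (S k)) n.
Proof.
rewrite <- cconv_one_r, cconv_assoc. apply cconv_ext; [reflexivity|].
intros; apply cconv_one_r.
Qed.

Definition weight (q : C) (u : nat -> C) (n : nat) : C := (u n * q ^ n)%C.

Lemma weight_cconv q u v n : weight q (cconv u v) n = cconv (weight q u) (weight q v) n.
Proof.
unfold weight, cconv. rewrite Cmult_comm, <- csum_scal. apply csum_ext. intros k Hk.
replace n with (k + (n - k))%nat at 1 by lia. rewrite Cpow_add_r. ring.
Qed.

Lemma weight_delta q n : weight q cdelta n = cdelta n.
Proof. destruct n; unfold weight; simpl; ring. Qed.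

(** The partial sums of [b * r], weighted by [z ^ n], are all 1; grouped by the
    index of [r] they are partial sums of [r] against partial sums of [b]. *)
Lemma reciprocal_remainder b r z n :
  (forall k, cconv b r k = cdelta k) ->
  (cpartial r z (S n) * cpseries b z - 1
   = csum (fun j => weight z r j * (cpseries b z - cpartial b z (S (n - j)))) (S n))%C.
Proof.
intros H.
assert (E : cconv (weight z r) (fun k => cpartial b z (S k)) n = RtoC 1).
{ transitivity (csum (cconv (weight z r) (weight z b)) (S n)).
  - rewrite csum_cconv. reflexivity.
  - rewrite (csum_ext _ cdelta).
    + rewrite csum_head. simpl. rewrite csum_zero by reflexivity. ring.
    + intros k _. rewrite <- weight_cconv, <- weight_delta with (q := z).
      unfold weight. rewrite cconv_comm, H. reflexivity. }
rewrite <- E. unfold cconv, cpartial at 1.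
rewrite (Cmult_comm _ (cpseries b z)), <- csum_scal.
rewrite <- csum_minus. apply csum_ext.
intros k _. unfold weight. ring.
Qed.

(** The tail of [b] beyond index [n - j] meets [r j * z ^ j], so each term
    carries the full power [z ^ (n + 1)]; trading [Cmod (r j)] for
    [Cmod (r j) * rho ^ j] costs at most [rho ^ - (n + 1)]. *)
Lemma reciprocal_remainder_bound b r z n K X rho :
  (forall k, cconv b r k = cdelta k) ->
  (forall k, Cmod (b k) <= K) -> Cmod z < rho -> rho < 1 ->
  (forall m, rsum (fun k => Cmod (r k) * rho ^ k) m <= X) ->
  Cmod (cpartial r z (S n) * cpseries b z - 1)
   <= (K / (1 - Cmod z) * X) * (Cmod z / rho) ^ S n.
Proof.
intros H HK Hz Hrho HX.
assert (H0z := Cmod_ge_0 z).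
assert (HK0 : 0 <= K) by (apply Rle_trans with (2 := HK O), Cmod_ge_0).
rewrite (reciprocal_remainder b r z n H).
eapply Rle_trans; [apply Cmod_csum|].
apply Rle_trans with
 (rsum (fun k => (K / (1 - Cmod z) * (Cmod z / rho) ^ S n) * (Cmod (r k) * rho ^ k)) (S n)).
- apply rsum_le. intros k Hk. unfold weight. rewrite !Cmod_mult, Cmod_pow.
  eapply Rle_trans;
   [apply Rmult_le_compat_l; [|apply cpseries_tail with (K := K); [auto|lra]]|].
  { apply Rmult_le_pos; [apply Cmod_ge_0|apply pow_le; lra]. }
  unfold Rdiv. rewrite Rpow_mult_distr, pow_inv.
  replace (S (n - k)) with (S n - k)%nat by lia.
  replace (Cmod (r k) * Cmod z ^ k * (K * Cmod z ^ (S n - k) * / (1 - Cmod z)))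
   with (K * / (1 - Cmod z) * Cmod (r k) * (Cmod z ^ k * Cmod z ^ (S n - k))) by ring.
  rewrite <- pow_add. replace (k + (S n - k))%nat with (S n) by lia.
  replace (K * / (1 - Cmod z) * (Cmod z ^ S n * / rho ^ S n) * (Cmod (r k) * rho ^ k))
   with (K * / (1 - Cmod z) * Cmod (r k) * Cmod z ^ S n * (/ rho ^ S n * rho ^ k)) by ring.
  rewrite <- (Rmult_1_r (K * / (1 - Cmod z) * Cmod (r k) * Cmod z ^ S n)) at 1.
  apply Rmult_le_compat_l.
  + repeat apply Rmult_le_pos; try apply Cmod_ge_0; try apply pow_le; try lra.
    apply Rlt_le, Rinv_0_lt_compat; lra.
  + assert (Hp : 0 < rho ^ S n) by (apply pow_lt; lra).
    apply Rmult_le_reg_l with (rho ^ S n); [auto|].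
    rewrite <- Rmult_assoc, Rinv_r, Rmult_1_r, Rmult_1_l by lra.
    replace (S n) with (k + (S n - k))%nat by lia. rewrite pow_add.
    rewrite <- (Rmult_1_r (rho ^ k)) at 2.
    apply Rmult_le_compat_l; [apply pow_le; lra|].
    rewrite <- (pow1 (S n - k)). apply pow_incr; lra.
- rewrite rsum_scal.
  replace (K / (1 - Cmod z) * X * (Cmod z / rho) ^ S n)
   with (K / (1 - Cmod z) * (Cmod z / rho) ^ S n * X) by ring.
  apply Rmult_le_compat_l; [|apply HX].
  apply Rmult_le_pos; [|apply pow_le, Rdiv_le_0_compat; lra].
  apply Rdiv_le_0_compat; lra.
Qed.

Lemma cpseries_product (u v : nat -> C) K X z :
  (forall n, cconv u v n = cdelta n) ->
  (forall k, Cmod (u k) <= K) -> (forall k, Cmod (v k) <= X) -> Cmod z < 1 ->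
  (cpseries u z * cpseries v z = 1)%C.
Proof.
intros Huv Hu Hv Hz. pose proof (Cmod_ge_0 z) as Hz0.
set (rho := (1 + Cmod z) / 2).
assert (Hrho : Cmod z < rho < 1) by (unfold rho; lra).
assert (HXs : forall m, rsum (fun k => Cmod (v k) * rho ^ k) m <= X * (1 / (1 - rho))).
{ intros m. apply Rle_trans with (rsum (fun k => X * rho ^ k) m).
  - apply rsum_le. intros k _. apply Rmult_le_compat_r; [apply pow_le; lra|auto].
  - rewrite rsum_scal. apply Rmult_le_compat_l; [apply Rle_trans with (2 := Hv O), Cmod_ge_0|].
    apply rsum_geom_le; lra. }
apply cnull_const_eq.
set (q := Cmod z / rho).
assert (Hq : 0 <= q < 1).
{ split; [apply Rdiv_le_0_compat; lra|].
  apply Rmult_lt_reg_r with rho; [lra|]. unfold q, Rdiv. rewrite Rmult_assoc, Rinv_l; lra. }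
assert (H1 : cnull (fun n => cpartial v z (S n) * cpseries u z - 1)%C).
{ set (L := K / (1 - Cmod z) * (X * (1 / (1 - rho)))).
  assert (HL : cnull (fun n => RtoC L * RtoC (q ^ S n))%C).
  { apply cnull_mult with (K := Cmod L); [intros; lra|].
    intros eps He. destruct (pow_null q Hq eps He) as [N HN]. exists N. intros; apply HN; lia. }
  intros eps He. destruct (HL eps He) as [N HN]. exists N. intros n Hn.
  eapply Rle_lt_trans;
   [apply (reciprocal_remainder_bound u v z n K (X * (1 / (1 - rho))) rho); auto; lra|].
  fold L q. apply Rle_lt_trans with (2 := HN n Hn).
  rewrite <- RtoC_mult, Cmod_R. apply Rle_abs. }
assert (H2 : cnull (fun n => (- cpseries u z) * (cpartial v z (S n) - cpseries v z))%C).
{ apply cnull_mult with (K := Cmod (- cpseries u z)); [intros; lra|].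
  intros eps He. destruct (cpartial_cpseries v X z Hv Hz eps He) as [N HN]. exists N. intros; apply HN; lia. }
eapply cnull_ext; [|apply (cnull_plus _ _ H1 H2)]. intros n. cbv beta. ring.
Qed.

(** * Parseval's inequality *)

Definition cis (t : R) : C := (cos t, sin t).

Lemma cis_plus s t : cis (s + t) = (cis s * cis t)%C.
Proof. unfold cis, Cmult; simpl. rewrite cos_plus, sin_plus. f_equal; ring. Qed.

Lemma cis_0 : cis 0 = RtoC 1.
Proof. unfold cis. rewrite cos_0, sin_0. reflexivity. Qed.

Lemma cis_pow t n : (cis t ^ n)%C = cis (INR n * t).
Proof.
induction n as [|n IH].
- rewrite Rmult_0_l, cis_0. reflexivity.
- rewrite Cpow_S, IH, S_INR, Rmult_plus_distr_r, Rmult_1_l, Rplus_comm, cis_plus. reflexivity.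
Qed.

Lemma Cmod_cis t : Cmod (cis t) = 1.
Proof.
unfold Cmod, cis; simpl.
replace (cos t * (cos t * 1) + sin t * (sin t * 1)) with 1; [apply sqrt_1|].
pose proof (sin2_cos2 t). unfold Rsqr in H. lra.
Qed.

Lemma cis_conj t : Cconj (cis t) = cis (- t).
Proof. unfold cis, Cconj; simpl. rewrite cos_neg, sin_neg. reflexivity. Qed.

Lemma Cconj_RtoC x : Cconj (RtoC x) = RtoC x.
Proof. unfold Cconj, RtoC; simpl. rewrite Ropp_0. reflexivity. Qed.

Lemma cis_2PI : cis (2 * PI) = RtoC 1.
Proof. unfold cis. rewrite cos_2PI, sin_2PI. reflexivity. Qed.

Lemma csum_geom_root (v : C) n : v <> RtoC 1 -> (v ^ n)%C = RtoC 1 -> csum (fun j => v ^ j)%C n = RtoC 0.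
Proof.
intros Hv Hn.
assert (E : ((v - 1) * csum (fun j => v ^ j) n = v ^ n - 1)%C).
{ clear. induction n as [|n IH]; simpl; [ring|]. rewrite Cmult_plus_distr_l, IH. ring. }
assert (Hv' : (v - 1 <> 0)%C).
{ intros E'. apply Hv. replace v with (v - 1 + 1)%C by ring. rewrite E'. ring. }
rewrite Hn in E. replace (csum (fun j => v ^ j)%C n) with ((v - 1) * csum (fun j => v ^ j) n / (v - 1))%C
 by (field; auto).
rewrite E. field. auto.
Qed.

Lemma cos_lt_1 x : 0 < x < 2 * PI -> cos x < 1.
Proof.
intros Hx. replace x with (2 * (x / 2)) by lra. rewrite cos_2a_sin.
assert (0 < sin (x / 2)) by (apply sin_gt_0; lra). nra.
Qed.

Lemma root_orthogonality (M k m : nat) (w := cis (2 * PI / INR M)) :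
  (k < m)%nat -> (m < M)%nat ->
  csum (fun j => (w ^ j) ^ k * Cconj ((w ^ j) ^ m))%C M = RtoC 0.
Proof.
intros Hk Hm. pose proof PI_RGT_0 as HPI.
assert (HM : 0 < INR M) by (apply lt_0_INR; lia).
set (t := 2 * PI / INR M) in *.
assert (E : forall j, ((w ^ j) ^ k * Cconj ((w ^ j) ^ m))%C = (cis (- (INR (m - k) * t)) ^ j)%C).
{ intros j. unfold w. rewrite !cis_pow, cis_conj, <- cis_plus. f_equal.
  rewrite minus_INR by lia. ring. }
rewrite (csum_ext _ _ _ (fun j _ => E j)). apply csum_geom_root.
- intros E1. assert (Hc : cos (- (INR (m - k) * t)) = 1).
  { change (fst (cis (- (INR (m - k) * t))) = 1). rewrite E1. reflexivity. }
  rewrite cos_neg in Hc.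
  assert (H1 : 0 < INR (m - k)) by (apply lt_0_INR; lia).
  assert (H2 : INR (m - k) < INR M) by (apply lt_INR; lia).
  assert (Ht : 0 < t) by (apply Rdiv_lt_0_compat; lra).
  assert (HtM : INR M * t = 2 * PI) by (unfold t; field; lra).
  pose proof (cos_lt_1 (INR (m - k) * t)). 
  assert (0 < INR (m - k) * t < 2 * PI); [|lra].
  split; [apply Rmult_lt_0_compat; auto|]. rewrite <- HtM. apply Rmult_lt_compat_r; auto.
- rewrite cis_pow. replace (INR M * - (INR (m - k) * t)) with (INR (m - k) * - (2 * PI))
   by (unfold t; field; lra).
  rewrite <- cis_pow, <- cis_conj, cis_2PI. unfold Cconj, RtoC; simpl.
  rewrite Ropp_0. apply (Cpow_1_l (m - k)).
Qed.

Lemma Cconj_csum f n : Cconj (csum f n) = csum (fun k => Cconj (f k)) n.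
Proof.
induction n as [|n IH]; simpl.
- apply Cconj_RtoC.
- rewrite Cplus_conj, IH. reflexivity.
Qed.

(** Over the [M]-th roots of unity distinct monomials of degree less than [M]
    are orthogonal, so adding one monomial adds one square. *)
Lemma parseval_roots (M : nat) (p : nat -> C) (w := cis (2 * PI / INR M)) m :
  (m <= M)%nat ->
  csum (fun j => cpartial p (w ^ j) m * Cconj (cpartial p (w ^ j) m))%C M
   = (RtoC (INR M) * csum (fun k => p k * Cconj (p k)) m)%C.
Proof.
induction m as [|m IH]; intros Hm.
- unfold cpartial; simpl. rewrite csum_zero by (intros; ring). ring.
- assert (Hcross : csum (fun j => cpartial p (w ^ j) m * Cconj ((w ^ j) ^ m))%C M = RtoC 0).
  { unfold cpartial.
    rewrite (csum_ext _ (fun j => csum (fun k => p k * ((w ^ j) ^ k * Cconj ((w ^ j) ^ m))) m)%C).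
    2:{ intros j _. rewrite Cmult_comm, <- csum_scal. apply csum_ext. intros; ring. }
    rewrite csum_exchange. apply csum_zero. intros k Hk. rewrite csum_scal.
    unfold w. rewrite root_orthogonality by lia. ring. }
  assert (Hcross' : csum (fun j => Cconj (cpartial p (w ^ j) m) * (w ^ j) ^ m)%C M = RtoC 0).
  { transitivity (Cconj (RtoC 0)).
    - rewrite <- Hcross, Cconj_csum. apply csum_ext. intros j _.
      rewrite Cmult_conj, Cconj_conj. reflexivity.
    - apply Cconj_RtoC. }
  rewrite (csum_ext _ (fun j =>
     (cpartial p (w ^ j) m * Cconj (cpartial p (w ^ j) m)
      + (Cconj (p m) * (cpartial p (w ^ j) m * Cconj ((w ^ j) ^ m))
      + (p m * (Cconj (cpartial p (w ^ j) m) * (w ^ j) ^ m)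
      + p m * Cconj (p m))))%C)).
  + rewrite !csum_plus, !csum_scal, Hcross, Hcross', IH by lia.
    assert (E : csum (fun _ => Cconj (p m))%C M = (INR M * Cconj (p m))%C).
    { clear. induction M as [|M IH]; [simpl; ring|]. rewrite S_INR, RtoC_plus. simpl. rewrite IH. ring. }
    rewrite E. simpl. ring.
  + intros j _. unfold cpartial. simpl. rewrite Cplus_conj, Cmult_conj.
    set (x := (w ^ j)%C).
    assert (Hx : (x ^ m * Cconj (x ^ m) = 1)%C).
    { rewrite <- Cmod2_conj, Cmod_pow. unfold x, w.
      rewrite Cmod_pow, Cmod_cis, !pow1. reflexivity. }
    transitivity
     ((csum (fun k => p k * x ^ k) m * Cconj (csum (fun k => p k * x ^ k) m) +
     (Cconj (p m) * (csum (fun k => p k * x ^ k) m * Cconj (x ^ m)) +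
     (p m * (Cconj (csum (fun k => p k * x ^ k) m) * x ^ m)
       + p m * Cconj (p m) * (x ^ m * Cconj (x ^ m)))))%C); [ring|].
    rewrite Hx. ring.
Qed.

Lemma parseval_le (M : nat) (p : nat -> C) K :
  (forall w, Cmod w = 1 -> Cmod (cpartial p w M) <= K) ->
  rsum (fun k => Cmod (p k) ^ 2) M <= K ^ 2.
Proof.
intros HK. destruct M as [|M].
- simpl. apply Rle_trans with (2 := pow2_ge_0 K). lra.
- set (N := S M) in *. assert (HN : 0 < INR N) by (apply lt_0_INR; unfold N; lia).
  set (w := cis (2 * PI / INR N)).
  assert (E : rsum (fun j => Cmod (cpartial p (w ^ j) N) ^ 2) N
            = INR N * rsum (fun k => Cmod (p k) ^ 2) N).
  { apply RtoC_inj. rewrite RtoC_mult, !RtoC_rsum.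
    rewrite (csum_ext _ _ _ (fun j _ => Cmod2_conj (cpartial p (w ^ j) N))).
    rewrite (csum_ext _ _ _ (fun j _ => Cmod2_conj (p j))).
    apply parseval_roots. lia. }
  apply Rmult_le_reg_l with (INR N); [auto|]. rewrite <- E, <- rsum_const.
  apply rsum_le. intros k _. apply pow_incr. split; [apply Cmod_ge_0|].
  apply HK. unfold w. rewrite Cmod_pow, Cmod_cis, pow1. reflexivity.
Qed.

(** * Reciprocal power series have null coefficients *)

Definition l1part (u : nat -> C) (n : nat) : R := rsum (fun k => Cmod (u k)) n.

Lemma l1part_cconv u v n : l1part (cconv u v) n <= l1part u n * l1part v n.
Proof.
destruct n as [|n]; [unfold l1part; simpl; lra|].
assert (Hn : forall u k, 0 <= l1part u k) by (intros; apply rsum_nonneg; intros; apply Cmod_ge_0).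
set (u' := fun k => RtoC (Cmod (u k))). set (v' := fun k => RtoC (Cmod (v k))).
apply Rle_trans with (Re (csum (cconv u' v') (S n))).
- rewrite Re_csum. apply rsum_le. intros k _. unfold cconv.
  eapply Rle_trans; [apply Cmod_csum|]. rewrite Re_csum. apply Req_le, rsum_ext.
  intros j _. unfold u', v'. rewrite Cmod_mult, re_scal_l. reflexivity.
- rewrite csum_cconv. unfold cconv. rewrite Re_csum.
  unfold l1part at 1. rewrite Rmult_comm, <- rsum_scal. apply rsum_le.
  intros k Hk. unfold u'. rewrite re_scal_l, Rmult_comm.
  apply Rmult_le_compat_r; [apply Cmod_ge_0|].
  unfold v'. rewrite <- RtoC_rsum, re_RtoC.
  apply rsum_mono; [intros; apply Cmod_ge_0|lia].
Qed.

Lemma l1part_plus u v n : l1part (fun k => u k + v k)%C n <= l1part u n + l1part v n.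
Proof. unfold l1part. rewrite <- rsum_plus. apply rsum_le. intros; apply Cmod_triangle. Qed.

Lemma l1part_nonneg u n : 0 <= l1part u n.
Proof. apply rsum_nonneg; intros; apply Cmod_ge_0. Qed.

Lemma weight_mod (q : R) u n : 0 <= q -> Cmod (weight (RtoC q) u n) = Cmod (u n) * q ^ n.
Proof. intros Hq. unfold weight. rewrite Cmod_mult, Cmod_pow, Cmod_R, Rabs_pos_eq; auto. Qed.

Lemma one_minus_pow_ge e n : 0 <= e <= 1 -> 1 - INR n * e <= (1 - e) ^ n.
Proof.
intros He. induction n as [|n IH]; [simpl; lra|]. rewrite S_INR.
change ((1 - e) ^ S n) with ((1 - e) * (1 - e) ^ n). pose proof (pos_INR n).
assert ((1 - e) * (1 - INR n * e) <= (1 - e) * (1 - e) ^ n) by (apply Rmult_le_compat_l; lra).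
assert (0 <= INR n * (e * e)) by (apply Rmult_le_pos; nra). lra.
Qed.

Section Reciprocal.
Variables (b r : nat -> C) (K c : R).
Hypothesis b_r : forall n, cconv b r n = cdelta n.
Hypothesis b_bounded : forall n, Cmod (b n) <= K.
Hypothesis c_pos : 0 < c.
Hypothesis b_below : forall z, Cmod z < 1 -> c <= Cmod (cpseries b z).

Definition summable_at (rho : R) : Prop :=
  exists X, forall n, l1part (weight (RtoC rho) r) n <= X.

Lemma K_nonneg : 0 <= K.
Proof. apply Rle_trans with (2 := b_bounded O), Cmod_ge_0. Qed.

(** On the circle of radius [rho'] the partial sums of [r] tend uniformly to the
    reciprocal of [b], whose modulus is at most [1 / c]. *)
Lemma parseval_reciprocal rho rho' M :
  0 < rho' < rho -> rho < 1 -> summable_at rho ->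
  rsum (fun k => Cmod (weight (RtoC rho') r k) ^ 2) M <= / c ^ 2.
Proof.
intros H' H [X HX].
assert (HXm : forall m, rsum (fun k => Cmod (r k) * rho ^ k) m <= X).
{ intros m. apply Rle_trans with (2 := HX m). apply Req_le, rsum_ext.
  intros k _. rewrite weight_mod by lra. reflexivity. }
set (L := K / (1 - rho') * X). set (q := rho' / rho).
assert (Hq : 0 <= q < 1).
{ split; [apply Rdiv_le_0_compat; lra|].
  apply Rmult_lt_reg_r with rho; [lra|]. unfold q, Rdiv. rewrite Rmult_assoc, Rinv_l; lra. }
assert (HN : forall n, rsum (fun k => Cmod (weight (RtoC rho') r k) ^ 2) (S n)
     <= ((1 + L * q ^ S n) / c) ^ 2).
{ intros n. apply parseval_le. intros w Hw.
  set (z := (RtoC rho' * w)%C).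
  assert (Hz : Cmod z = rho').
  { unfold z. rewrite Cmod_mult, Hw, Cmod_R, Rabs_pos_eq; lra. }
  replace (cpartial (weight rho' r) w (S n)) with (cpartial r z (S n)).
  2:{ apply csum_ext. intros k _. unfold weight, z. rewrite Cpow_mult_l. ring. }
  pose proof (reciprocal_remainder_bound b r z n K X rho b_r b_bounded
    ltac:(lra) H HXm) as HR.
  rewrite Hz in HR. fold L q in HR.
  pose proof (b_below z ltac:(lra)) as Hc.
  apply Rmult_le_reg_r with c; [auto|].
  unfold Rdiv. rewrite Rmult_assoc, Rinv_l, Rmult_1_r by lra.
  apply Rle_trans with (Cmod (cpartial r z (S n)) * Cmod (cpseries b z)).
  { apply Rmult_le_compat_l; [apply Cmod_ge_0|auto]. }
  rewrite <- Cmod_mult.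
  replace (cpartial r z (S n) * cpseries b z)%C with (1 + (cpartial r z (S n) * cpseries b z - 1))%C by ring.
  eapply Rle_trans; [apply Cmod_triangle|]. rewrite Cmod_1. lra. }
replace (/ c ^ 2) with (((1 + L * 0) / c) ^ 2) by (field; lra).
assert (Hlim : is_lim_seq (fun n => ((1 + L * q ^ S n) / c) ^ 2) (((1 + L * 0) / c) ^ 2)).
{ apply (is_lim_seq_continuous (fun x => ((1 + L * x) / c) ^ 2)).
  - reg; lra.
  - apply (is_lim_seq_incr_1 (fun n => q ^ n)). apply is_lim_seq_geom. rewrite Rabs_pos_eq; lra. }
apply (is_lim_seq_le_loc (fun _ => rsum (fun k => Cmod (weight (RtoC rho') r k) ^ 2) M)
  _ (rsum (fun k => Cmod (weight (RtoC rho') r k) ^ 2) M) _) in Hlim;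
  [exact Hlim| |apply is_lim_seq_const].
exists M. intros n Hn. apply Rle_trans with (2 := HN n).
apply rsum_mono; [intros; apply pow2_ge_0|lia].
Qed.

(** Cauchy-Schwarz against a geometric weight, in the form
    [x * y <= x ^ 2 / sigma + sigma * y] for [0 <= y <= 1].  What matters is the
    rate: inside a relative gap [sigma ^ 2] the l1 norm grows only like
    [1 / sigma]. *)
Lemma l1_from_l2 rho sigma n :
  0 < rho -> 0 < sigma < 1 ->
  (forall M, rsum (fun k => Cmod (weight (RtoC rho) r k) ^ 2) M <= / c ^ 2) ->
  l1part (weight (RtoC (rho * (1 - sigma ^ 2))) r) n <= (/ c ^ 2 + 1) / sigma.
Proof.
intros Hr Hs H. set (q := 1 - sigma ^ 2).
assert (Hq : 0 < q < 1) by (unfold q; nra).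
apply Rle_trans with (rsum (fun k => / sigma * Cmod (weight (RtoC rho) r k) ^ 2 + sigma * q ^ k) n).
- apply rsum_le. intros k _. rewrite weight_mod, Rpow_mult_distr by nra.
  rewrite weight_mod by lra. rewrite <- Rmult_assoc.
  set (x := Cmod (r k) * rho ^ k).
  assert (Hx : 0 <= x) by (apply Rmult_le_pos; [apply Cmod_ge_0|apply pow_le; lra]).
  set (y := q ^ k). assert (Hy : 0 < y <= 1).
  { split; [apply pow_lt; lra|]. rewrite <- (pow1 k). apply pow_incr; lra. }
  apply Rmult_le_reg_l with sigma; [lra|].
  replace (sigma * (/ sigma * x ^ 2 + sigma * y)) with (x ^ 2 + sigma ^ 2 * y) by (field; lra).
  assert (0 <= (x - sigma * y) ^ 2) by apply pow2_ge_0.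
  assert (0 <= sigma ^ 2 * (y * (1 - y))) by (apply Rmult_le_pos; nra). nra.
- rewrite rsum_plus, !rsum_scal.
  replace ((/ c ^ 2 + 1) / sigma) with (/ sigma * (/ c ^ 2) + sigma * (1 / (1 - q)))
    by (replace (1 - q) with (sigma ^ 2) by (unfold q; ring); field; lra).
  apply Rplus_le_compat; apply Rmult_le_compat_l; try lra.
  + apply Rlt_le, Rinv_0_lt_compat; lra.
  + apply H.
  + apply rsum_geom_le; lra.
Qed.

(** If [e] is the change in the weighted [b], then
    [r_b = r_a - r_a * e * r_b]; hence the partial l1 norms [N] of [r_b] satisfy
    [N <= X + N / 2], uniformly in their length. *)
Lemma l1_perturb rho_a rho_b X :
  0 <= rho_a <= rho_b -> rho_b < 1 ->
  (forall n, l1part (weight (RtoC rho_a) r) n <= X) ->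
  X * (K * ((rho_b - rho_a) / ((1 - rho_a) * (1 - rho_b)))) <= / 2 ->
  forall n, l1part (weight (RtoC rho_b) r) n <= 2 * X.
Proof.
intros Ha Hb HX Hsmall n. pose proof K_nonneg as HK.
set (ra := weight (RtoC rho_a) r). set (rb := weight (RtoC rho_b) r).
set (e := fun k => (weight (RtoC rho_b) b k - weight (RtoC rho_a) b k)%C).
assert (E : forall k, rb k = (ra k + (- (1)) * cconv (cconv ra e) rb k)%C).
{ intros k.
  assert (H1 : forall k, cconv (weight rho_b b) rb k = cdelta k).
  { intros j. unfold rb. rewrite <- weight_cconv.
    rewrite <- weight_delta with (q := RtoC rho_b). unfold weight. rewrite b_r. reflexivity. }
  assert (H2 : forall k, cconv ra (weight rho_a b) k = cdelta k).
  { intros j. unfold ra. rewrite cconv_comm, <- weight_cconv.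
    rewrite <- weight_delta with (q := RtoC rho_a). unfold weight. rewrite b_r. reflexivity. }
  assert (H3 : forall k, cconv ra e k
     = (cconv ra (weight rho_b b) k + (- (1)) * cdelta k)%C).
  { intros j. rewrite <- H2, !(cconv_comm ra).
    rewrite <- cconv_scal_l.
    rewrite <- cconv_plus_l. apply cconv_ext; [intros; unfold e; ring|reflexivity]. }
  rewrite (cconv_ext _ _ rb rb k (fun j _ => H3 j)) by reflexivity.
  rewrite cconv_plus_l, cconv_scal_l, cconv_delta_l, cconv_assoc.
  rewrite (cconv_ext ra ra _ cdelta k) by auto.
  rewrite cconv_comm, cconv_delta_l. ring. }
assert (He : l1part e n <= K * ((rho_b - rho_a) / ((1 - rho_a) * (1 - rho_b)))).
{ apply Rle_trans with (rsum (fun k => K * (rho_b ^ k + (-1) * rho_a ^ k)) n).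
  - apply rsum_le. intros k _. unfold e, weight.
    replace (b k * rho_b ^ k - b k * rho_a ^ k)%C with (b k * RtoC (rho_b ^ k - rho_a ^ k))%C
      by (rewrite RtoC_minus, !RtoC_pow; ring).
    rewrite Cmod_mult, Cmod_R, Rabs_pos_eq.
    + replace (rho_b ^ k + -1 * rho_a ^ k) with (rho_b ^ k - rho_a ^ k) by ring.
      apply Rmult_le_compat_r; [|auto].
      pose proof (pow_incr rho_a rho_b k Ha). lra.
    + pose proof (pow_incr rho_a rho_b k Ha). lra.
  - rewrite rsum_scal. apply Rmult_le_compat_l; [auto|].
    rewrite rsum_plus, rsum_scal, !rsum_geom by lra.
    assert (Hpow := pow_incr rho_a rho_b n Ha).
    assert (H0 : 0 <= rho_a ^ n) by (apply pow_le; lra).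
    assert (Hi : / (1 - rho_a) <= / (1 - rho_b)) by (apply Rinv_le_contravar; lra).
    assert (Hi0 : 0 < / (1 - rho_a)) by (apply Rinv_0_lt_compat; lra).
    replace ((rho_b - rho_a) / ((1 - rho_a) * (1 - rho_b))) with (/ (1 - rho_b) - / (1 - rho_a))
      by (field; lra).
    unfold Rdiv.
    assert (rho_a ^ n * / (1 - rho_a) <= rho_b ^ n * / (1 - rho_b)); [|lra].
    apply Rmult_le_compat; lra. }
assert (Hmain : l1part rb n <= X + X * l1part e n * l1part rb n).
{ apply Rle_trans with (l1part (fun k => ra k + (- (1)) * cconv (cconv ra e) rb k)%C n).
  { apply Req_le, rsum_ext. intros k _. rewrite <- E. reflexivity. }
  eapply Rle_trans; [apply l1part_plus|]. apply Rplus_le_compat; [apply HX|].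
  apply Rle_trans with (l1part (cconv (cconv ra e) rb) n).
  { apply Req_le, rsum_ext. intros k _. rewrite Cmod_mult, Cmod_opp, Cmod_1. ring. }
  eapply Rle_trans; [apply l1part_cconv|]. apply Rmult_le_compat_r; [apply l1part_nonneg|].
  eapply Rle_trans; [apply l1part_cconv|]. apply Rmult_le_compat_r; [apply l1part_nonneg|].
  apply HX. }
assert (HX0 : 0 <= X) by (apply Rle_trans with (2 := HX O), l1part_nonneg).
assert (X * l1part e n <= / 2).
{ apply Rle_trans with (2 := Hsmall). apply Rmult_le_compat_l; auto. }
pose proof (l1part_nonneg rb n).
assert (X * l1part e n * l1part rb n <= / 2 * l1part rb n) by (apply Rmult_le_compat_r; auto).
lra.
Qed.

(** Perturbation from radius 0, where only [r 0] is left. *)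
Lemma summable_small : exists rho0, 0 < rho0 /\ forall rho, 0 < rho <= rho0 -> rho < 1 -> summable_at rho.
Proof.
pose proof K_nonneg as HK.
assert (H0 : forall n, l1part (weight (RtoC 0) r) n <= Cmod (r O)).
{ intros [|n]; [unfold l1part; simpl; apply Cmod_ge_0|]. unfold l1part. rewrite rsum_head.
  unfold weight at 1. simpl. rewrite Cmult_1_r.
  rewrite (rsum_ext _ (fun _ => 0)), rsum_const by
   (intros; unfold weight; rewrite Cpow_S, Cmult_0_l, Cmult_0_r, Cmod_0; reflexivity).
  lra. }
set (X := Cmod (r O)). assert (HX : 0 <= X) by apply Cmod_ge_0.
exists (/ (4 * (X * K + 1))).
assert (HXK : 0 <= X * K) by (apply Rmult_le_pos; auto).
assert (HD : 0 < 4 * (X * K + 1)) by lra.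
split; [apply Rinv_0_lt_compat; lra|].
intros rho Hrho Hrho1. exists (2 * X). apply (l1_perturb 0); auto; try lra.
assert (Hr4 : rho <= / 4).
{ apply Rle_trans with (1 := proj2 Hrho). apply Rinv_le_contravar; lra. }
assert (E : rho * (4 * (X * K + 1)) <= 1).
{ apply Rmult_le_reg_r with (/ (4 * (X * K + 1))); [apply Rinv_0_lt_compat; lra|].
  rewrite Rmult_assoc, Rinv_r by lra. lra. }
rewrite !Rminus_0_r, Rmult_1_l.
apply Rmult_le_reg_r with (1 - rho); [lra|].
replace (X * (K * (rho / (1 - rho))) * (1 - rho)) with (X * K * rho) by (field; lra).
nra.
Qed.

(** A little inside [rho], at relative distance about [sigma ^ 2], the l1 norm is
    of order [1 / sigma], and moving from there to a little outside [rho] changes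
    [b] by order [sigma ^ 2].  The product is of order [sigma], so one [sigma]
    serves all [rho] up to [rho_star]. *)
Lemma summable_step rho_star :
  0 < rho_star < 1 ->
  exists kappa, 0 < kappa /\ forall rho, 0 < rho -> rho * (1 + kappa) <= rho_star ->
     summable_at rho -> summable_at (rho * (1 + kappa)).
Proof.
intros Hs. pose proof K_nonneg as HK.
set (D := / c ^ 2 + 1).
assert (HD : 0 < D).
{ assert (0 < / c ^ 2); [|unfold D; lra]. apply Rinv_0_lt_compat, pow_lt; auto. }
set (T := (1 - rho_star) ^ 2). assert (HT : 0 < T) by (apply pow_lt; lra).
set (sigma := Rmin (/ 2) (T / (6 * (D * K + 1)))).
assert (HDK : 0 <= D * K) by (apply Rmult_le_pos; lra).
assert (Hsig : 0 < sigma <= / 2).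
{ split; [|apply Rmin_l]. apply Rmin_case; [lra|]. apply Rdiv_lt_0_compat; lra. }
assert (Hsig2 : sigma * (6 * (D * K + 1)) <= T).
{ apply Rle_trans with (T / (6 * (D * K + 1)) * (6 * (D * K + 1))).
  - apply Rmult_le_compat_r; [lra|apply Rmin_r].
  - apply Req_le. field. lra. }
exists (sigma ^ 2). split; [apply pow_lt; lra|].
intros rho Hrho Hle Hsum. set (q := 1 - sigma ^ 2).
assert (Hq : 0 < q < 1) by (unfold q; nra).
assert (Hrs : rho <= rho_star) by nra.
assert (Hl2 : forall M, rsum (fun k => Cmod (weight (RtoC (rho * q)) r k) ^ 2) M <= / c ^ 2).
{ intros M. apply (parseval_reciprocal rho); auto; [|lra].
  split; [apply Rmult_lt_0_compat; lra|nra]. }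
assert (Hl1 : forall n, l1part (weight (RtoC (rho * q * q)) r) n <= D / sigma).
{ intros n. apply l1_from_l2; auto; [|lra]. apply Rmult_lt_0_compat; lra. }
exists (2 * (D / sigma)).
assert (Hqq : 0 <= rho * q * q <= rho).
{ split; [repeat apply Rmult_le_pos; lra|].
  rewrite Rmult_assoc. rewrite <- (Rmult_1_r rho) at 2. apply Rmult_le_compat_l; nra. }
assert (Hdiff : rho * (1 + sigma ^ 2) - rho * q * q <= 3 * sigma ^ 2).
{ unfold q. replace (rho * (1 + sigma ^ 2) - rho * (1 - sigma ^ 2) * (1 - sigma ^ 2))
    with (rho * (sigma ^ 2 * (3 - sigma ^ 2))) by ring.
  assert (Hs2 : 0 < sigma ^ 2 <= 1).
  { split; [apply pow_lt; lra|]. rewrite <- (pow1 2). apply pow_incr; lra. }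
  assert (0 <= sigma ^ 2 * (3 - sigma ^ 2)) by (apply Rmult_le_pos; lra).
  assert (rho * (sigma ^ 2 * (3 - sigma ^ 2)) <= 1 * (sigma ^ 2 * (3 - sigma ^ 2)))
    by (apply Rmult_le_compat_r; lra).
  assert (0 <= sigma ^ 2 * sigma ^ 2) by (apply Rmult_le_pos; lra). lra. }
apply (l1_perturb (rho * q * q)); auto; [nra|lra|].
set (d := rho * (1 + sigma ^ 2) - rho * q * q) in *.
assert (Hd : 0 <= d) by (unfold d; nra).
assert (HTb : T <= (1 - rho * q * q) * (1 - rho * (1 + sigma ^ 2))).
{ unfold T. simpl. rewrite Rmult_1_r. apply Rmult_le_compat; lra. }
apply Rle_trans with (D / sigma * (K * (3 * sigma ^ 2 / T))).
- apply Rmult_le_compat_l; [apply Rdiv_le_0_compat; lra|].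
  apply Rmult_le_compat_l; [auto|]. unfold Rdiv. apply Rmult_le_compat; auto.
  + apply Rlt_le, Rinv_0_lt_compat; lra.
  + apply Rinv_le_contravar; lra.
- replace (D / sigma * (K * (3 * sigma ^ 2 / T))) with (D * K * (3 * sigma) / T) by (field; lra).
  apply Rle_div_l; [auto|]. nra.
Qed.

Lemma summable_inside rho_star : 0 < rho_star < 1 -> summable_at rho_star.
Proof.
intros Hs. destruct summable_small as [rho0 [H0 Hsm]].
destruct (summable_step rho_star Hs) as [kappa [Hk Hstep]].
assert (Hind : forall k rho, 0 < rho <= rho_star -> rho <= rho0 * (1 + kappa) ^ k -> summable_at rho).
{ induction k as [|k IH]; intros rho Hr Hle.
  - apply Hsm; [simpl in Hle|]; lra.
  - replace rho with (rho / (1 + kappa) * (1 + kappa)) by (field; lra).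
    assert (Hr' : 0 < rho / (1 + kappa)) by (apply Rdiv_lt_0_compat; lra).
    assert (Hr2 : rho / (1 + kappa) * (1 + kappa) = rho) by (field; lra).
    apply Hstep; [auto|lra|]. apply IH; [nra|].
    apply Rmult_le_reg_r with (1 + kappa); [lra|]. rewrite Hr2. simpl in Hle. lra. }
destruct (INR_unbounded (/ (rho0 * kappa))) as [k Hkk].
apply (Hind k); [lra|].
pose proof (poly k kappa Hk).
assert (1 < rho0 * (INR k * kappa)).
{ replace 1 with (/ (rho0 * kappa) * (rho0 * kappa)) by (field; lra).
  replace (rho0 * (INR k * kappa)) with (INR k * (rho0 * kappa)) by ring.
  apply Rmult_lt_compat_r; [apply Rmult_lt_0_compat; lra|auto]. }
nra.
Qed.

Lemma reciprocal_l2 M : rsum (fun k => Cmod (r k) ^ 2) M <= 4 * / c ^ 2.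
Proof.
assert (Hpar : forall rho', 0 < rho' < 1 ->
   rsum (fun k => Cmod (weight (RtoC rho') r k) ^ 2) M <= / c ^ 2).
{ intros rho' H'. apply (parseval_reciprocal ((1 + rho') / 2)); try lra.
  apply summable_inside; lra. }
set (eta := / (2 * (INR M + 1))).
assert (HM := pos_INR M).
assert (Heta : 0 < eta <= / 2).
{ split; [apply Rinv_0_lt_compat; lra|apply Rinv_le_contravar; lra]. }
specialize (Hpar (1 - eta) ltac:(lra)).
assert (Hb : / 2 <= (1 - eta) ^ M).
{ pose proof (one_minus_pow_ge eta M ltac:(lra)) as HB.
  apply Rle_trans with (2 := HB).
  assert (INR M * eta <= / 2); [|lra].
  unfold eta. apply Rmult_le_reg_r with (2 * (INR M + 1)); [lra|].
  rewrite Rmult_assoc, Rinv_l by lra. lra. }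
apply Rmult_le_reg_l with (/ 4); [lra|].
replace (/ 4 * (4 * / c ^ 2)) with (/ c ^ 2) by (field; lra).
apply Rle_trans with (2 := Hpar). rewrite <- rsum_scal. apply rsum_le.
intros k Hk. rewrite weight_mod by lra. rewrite Rpow_mult_distr, Rmult_comm.
apply Rmult_le_compat_l; [apply pow2_ge_0|].
assert (/ 2 <= (1 - eta) ^ k).
{ apply Rle_trans with (1 := Hb). replace M with (k + (M - k))%nat by lia.
  rewrite pow_add. rewrite <- (Rmult_1_r ((1 - eta) ^ k)) at 2.
  apply Rmult_le_compat_l; [apply pow_le; lra|].
  apply Rle_trans with (1 ^ (M - k)); [apply pow_incr; lra|rewrite pow1; lra]. }
assert (0 < (1 - eta) ^ k <= 1) by (split; [apply pow_lt; lra|];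
  apply Rle_trans with (1 ^ k); [apply pow_incr; lra|rewrite pow1; lra]).
nra.
Qed.

(** A weak form of Wiener's lemma: a power series bounded away from 0 on the open
    disc has a reciprocal whose coefficients are square summable, hence null. *)
Lemma reciprocal_null : cnull r.
Proof.
assert (Hex : ex_series (fun k => Cmod (r k) ^ 2)).
{ destruct (ex_finite_lim_seq_incr (fun n => rsum (fun k => Cmod (r k) ^ 2) n) (4 * / c ^ 2)) as [l Hl].
  - intros n. simpl. pose proof (Cmod_ge_0 (r n)). nra.
  - apply reciprocal_l2.
  - exists l. apply (is_lim_seq_incr_1 (fun n => rsum (fun k => Cmod (r k) ^ 2) n)) in Hl.
    change (is_lim_seq (sum_n (fun k => Cmod (r k) ^ 2)) l).
    eapply is_lim_seq_ext; [|exact Hl]. intros n. symmetry. apply rsum_sum_n. }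
apply ex_series_lim_0 in Hex. apply is_lim_seq_spec in Hex.
intros eps He. assert (He2 : 0 < eps ^ 2) by (apply pow_lt; auto).
destruct (Hex (mkposreal _ He2)) as [N HN]. exists N. intros n Hn.
specialize (HN n Hn). simpl in HN. pose proof (Cmod_ge_0 (r n)).
rewrite Rminus_0_r, Rabs_pos_eq in HN by nra. nra.
Qed.

End Reciprocal.

(** * Hausdorff moments *)

Definition shift (a : nat -> R) (k : nat) : R := a (S k).

Lemma cm_shift a : completely_monotone a -> completely_monotone (shift a).
Proof.
intros H j k. 
assert (E : forall k, Nat.iter j backdiff (shift a) k = Nat.iter j backdiff a (S k)).
{ clear. induction j as [|j IH]; intros k; [reflexivity|].
  simpl. unfold backdiff at 1 3. rewrite !IH. reflexivity. }
rewrite E. apply H.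
Qed.

Lemma cm_backdiff a : completely_monotone a -> completely_monotone (backdiff a).
Proof. intros H j k. rewrite <- Nat.iter_succ_r. apply H. Qed.

Lemma cm_nonneg a k : completely_monotone a -> 0 <= a k.
Proof. intros H. exact (H O k). Qed.

Lemma cm_decr a k : completely_monotone a -> a (S k) <= a k.
Proof. intros H. pose proof (H 1%nat k) as H1. simpl in H1. unfold backdiff in H1. lra. Qed.

Lemma cm_le_0 a k : completely_monotone a -> a k <= a O.
Proof. intros H. induction k; [lra|]. pose proof (cm_decr a k H). lra. Qed.

(** Integration against the [n]-th Hausdorff measure of [a], whose mass at [k] is
    [binomial n k] times entry [k] of [(I - E)^(n-k) a].  Expanding
    [(E + (I - E))^n] one factor at a time gives this recursion without
    binomial coefficients. *)
Fixpoint bern (n : nat) (a : nat -> R) (f : nat -> C) : C :=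
  match n with
  | O => (RtoC (a O) * f O)%C
  | S m => (bern m (shift a) (fun k => f (S k)) + bern m (backdiff a) f)%C
  end.

Fixpoint rbern (n : nat) (a f : nat -> R) : R :=
  match n with
  | O => a O * f O
  | S m => rbern m (shift a) (fun k => f (S k)) + rbern m (backdiff a) f
  end.

Lemma bern_ext n : forall a f g, (forall k, (k <= n)%nat -> f k = g k) -> bern n a f = bern n a g.
Proof.
induction n as [|n IH]; intros a f g H; simpl; [rewrite H by lia; reflexivity|].
rewrite (IH (shift a) _ (fun k => g (S k))) by (intros; apply H; lia).
rewrite (IH (backdiff a) _ g) by (intros; apply H; lia). reflexivity.
Qed.

Lemma rbern_ext n : forall a f g, (forall k, (k <= n)%nat -> f k = g k) -> rbern n a f = rbern n a g.
Proof.
induction n as [|n IH]; intros a f g H; simpl; [rewrite H by lia; reflexivity|].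
rewrite (IH (shift a) _ (fun k => g (S k))) by (intros; apply H; lia).
rewrite (IH (backdiff a) _ g) by (intros; apply H; lia). reflexivity.
Qed.

Lemma bern_plus n : forall a f g, bern n a (fun k => f k + g k)%C = (bern n a f + bern n a g)%C.
Proof.
induction n as [|n IH]; intros; simpl; [ring|].
rewrite (IH _ (fun k => f (S k)) (fun k => g (S k))), IH. ring.
Qed.

Lemma bern_scal n : forall a c f, bern n a (fun k => c * f k)%C = (c * bern n a f)%C.
Proof.
induction n as [|n IH]; intros; simpl; [ring|].
rewrite (IH _ c (fun k => f (S k))), IH. ring.
Qed.

Lemma rbern_plus n : forall a f g, rbern n a (fun k => f k + g k) = rbern n a f + rbern n a g.
Proof.
induction n as [|n IH]; intros; simpl; [ring|].
rewrite (IH _ (fun k => f (S k)) (fun k => g (S k))), IH. ring.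
Qed.

Lemma rbern_scal n : forall a c f, rbern n a (fun k => c * f k) = c * rbern n a f.
Proof.
induction n as [|n IH]; intros; simpl; [ring|].
rewrite (IH _ c (fun k => f (S k))), IH. ring.
Qed.

Lemma bern_RtoC n : forall a f, bern n a (fun k => RtoC (f k)) = RtoC (rbern n a f).
Proof.
induction n as [|n IH]; intros; simpl; [rewrite RtoC_mult; reflexivity|].
rewrite (IH _ (fun k => f (S k))), IH, RtoC_plus. reflexivity.
Qed.

Lemma rbern_one n : forall a, rbern n a (fun _ => 1) = a O.
Proof.
induction n as [|n IH]; intros; simpl; [ring|]. rewrite !IH. unfold shift, backdiff. ring.
Qed.

Lemma rbern_le n : forall a f g, completely_monotone a ->
  (forall k, (k <= n)%nat -> f k <= g k) -> rbern n a f <= rbern n a g.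
Proof.
induction n as [|n IH]; intros a f g Ha H; simpl.
- apply Rmult_le_compat_l; [apply cm_nonneg; auto|apply H; lia].
- apply Rplus_le_compat; apply IH; auto using cm_shift, cm_backdiff; intros; apply H; lia.
Qed.

Lemma Cmod_bern n : forall a f, completely_monotone a ->
  Cmod (bern n a f) <= rbern n a (fun k => Cmod (f k)).
Proof.
induction n as [|n IH]; intros a f Ha; simpl.
- rewrite Cmod_mult, Cmod_R, Rabs_pos_eq by (apply cm_nonneg; auto). lra.
- eapply Rle_trans; [apply Cmod_triangle|]. apply Rplus_le_compat.
  + apply (IH _ (fun k => f (S k))), cm_shift, Ha.
  + apply IH, cm_backdiff, Ha.
Qed.

(** [E] and [I - E] commute, so a factor [k] can be traded for a shift of [a] and
    a factor [n + 1]; this is [k * binomial (n+1) k = (n+1) * binomial n (k-1)]. *)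
Lemma rbern_index n : forall a f,
  rbern (S n) a (fun k => INR k * f k) = INR (S n) * rbern n (shift a) (fun k => f (S k)).
Proof.
induction n as [|n IH]; intros a f.
- simpl. unfold shift, backdiff. ring.
- change (rbern (S (S n)) a (fun k => INR k * f k))
   with (rbern (S n) (shift a) (fun k => INR (S k) * f (S k))
         + rbern (S n) (backdiff a) (fun k => INR k * f k)).
  rewrite (rbern_ext _ _ _ (fun k => INR k * f (S k) + f (S k)))
    by (intros; rewrite S_INR; ring).
  rewrite rbern_plus, (IH (shift a) (fun k => f (S k))), (IH (backdiff a) f).
  change (rbern (S n) (shift a) (fun k => f (S k)))
   with (rbern n (shift (shift a)) (fun k => f (S (S k)))
         + rbern n (backdiff (shift a)) (fun k => f (S k))).
  change (shift (backdiff a)) with (backdiff (shift a)).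
  rewrite (S_INR (S n)). ring.
Qed.

Definition node (n k : nat) : R := INR k / INR n.

Lemma node_bounds n k : (0 < n)%nat -> (k <= n)%nat -> 0 <= node n k <= 1.
Proof.
intros Hn Hk. assert (0 < INR n) by (apply lt_0_INR; auto).
pose proof (pos_INR k). pose proof (le_INR k n Hk). unfold node. split.
- apply Rdiv_le_0_compat; auto.
- apply Rmult_le_reg_r with (INR n); auto. unfold Rdiv. rewrite Rmult_assoc, Rinv_l; lra.
Qed.

Lemma pow_lipschitz x y m : 0 <= x <= 1 -> 0 <= y <= 1 -> Rabs (x ^ m - y ^ m) <= INR m * Rabs (x - y).
Proof.
intros Hx Hy. induction m as [|m IH].
- simpl. rewrite Rminus_diag, Rabs_R0. lra.
- rewrite S_INR. replace (x ^ S m - y ^ S m) with (x * (x ^ m - y ^ m) + y ^ m * (x - y)) by (simpl; ring).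
  eapply Rle_trans; [apply Rabs_triang|]. rewrite !Rabs_mult.
  rewrite (Rabs_pos_eq x) by lra. rewrite (Rabs_pos_eq (y ^ m)) by (apply pow_le; lra).
  assert (y ^ m <= 1) by (apply Rle_trans with (1 ^ m); [apply pow_incr; lra|rewrite pow1; lra]).
  pose proof (Rabs_pos (x - y)). pose proof (Rabs_pos (x ^ m - y ^ m)). nra.
Qed.

(** By [rbern_index] the moment of order [m + 1] of [a] is the moment of order [m]
    of the shifted sequence, except that the nodes [k / n] have moved to
    [(k + 1) / (n + 1)], by at most [1 / (n + 1)]. *)
Lemma rbern_moment m : forall a, completely_monotone a ->
  is_lim_seq (fun n => rbern n a (fun k => node n k ^ m)) (a m).
Proof.
induction m as [|m IH]; intros a Ha.
- eapply is_lim_seq_ext; [|apply is_lim_seq_const]. intros n. symmetry. apply rbern_one.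
- apply is_lim_seq_incr_1.
  assert (E : forall n, rbern (S n) a (fun k => node (S n) k ^ S m)
     = rbern n (shift a) (fun k => node (S n) (S k) ^ m)).
  { intros n. assert (Hn : 0 < INR (S n)) by (apply lt_0_INR; lia).
    rewrite (rbern_ext _ _ _ (fun k => INR k * (/ INR (S n) * node (S n) k ^ m))).
    - rewrite (rbern_index n a (fun k => / INR (S n) * node (S n) k ^ m)).
      rewrite (rbern_scal n (shift a) (/ INR (S n)) (fun k => node (S n) (S k) ^ m)).
      field. lra.
    - intros k _. change (node (S n) k ^ S m) with (node (S n) k * node (S n) k ^ m).
      unfold node at 1. field. lra. }
  eapply is_lim_seq_ext; [intros n; symmetry; apply E|].
  specialize (IH (shift a) (cm_shift a Ha)). change (a (S m)) with (shift a m).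
  set (d := fun n => INR m * shift a O * / INR (S n)).
  assert (Hd : is_lim_seq d 0).
  { replace (Finite 0) with (Rbar_mult (INR m * shift a O) 0) by (simpl; f_equal; ring).
    apply is_lim_seq_scal_l.
    apply (is_lim_seq_incr_1 (fun n => / INR n)).
    replace (Finite 0) with (Rbar_inv p_infty) by reflexivity.
    apply is_lim_seq_inv; [apply is_lim_seq_INR|discriminate]. }
  assert (Hb : forall n, (1 <= n)%nat -> Rabs (rbern n (shift a) (fun k => node (S n) (S k) ^ m)
     - rbern n (shift a) (fun k => node n k ^ m)) <= d n).
  { intros n Hn. assert (HN : 0 < INR n) by (apply lt_0_INR; lia).
    assert (Hin : forall k, (k <= n)%nat ->
      Rabs (node (S n) (S k) ^ m - node n k ^ m) <= INR m * / INR (S n)).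
    { intros k Hk.
      eapply Rle_trans; [apply pow_lipschitz; apply node_bounds; lia|].
      apply Rmult_le_compat_l; [apply pos_INR|].
      assert (HkR := le_INR k n Hk). pose proof (pos_INR k).
      replace (node (S n) (S k) - node n k) with ((INR n - INR k) / INR n * / INR (S n)).
      2:{ unfold node. rewrite !S_INR. field. lra. }
      rewrite Rabs_mult. rewrite S_INR. rewrite (Rabs_pos_eq (/ _))
        by (apply Rlt_le, Rinv_0_lt_compat; lra).
      rewrite <- (Rmult_1_l (/ _)) at 2. apply Rmult_le_compat_r.
      { apply Rlt_le, Rinv_0_lt_compat; lra. }
      rewrite Rabs_pos_eq by (apply Rdiv_le_0_compat; lra).
      apply Rmult_le_reg_r with (INR n); auto. unfold Rdiv. rewrite Rmult_assoc, Rinv_l; lra. }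
    assert (Hc : rbern n (shift a) (fun _ => INR m * / INR (S n)) = d n).
    { rewrite (rbern_ext n (shift a) _ (fun _ => (INR m * / INR (S n)) * 1)) by (intros; ring).
      rewrite rbern_scal, rbern_one. unfold d. ring. }
    rewrite <- Hc. apply Rabs_le.
    split.
    - apply Rle_trans with (- 1 * rbern n (shift a) (fun _ => INR m * / INR (S n))); [lra|].
      rewrite <- rbern_scal. apply Rplus_le_reg_r with (rbern n (shift a) (fun k => node n k ^ m)).
      rewrite <- rbern_plus. unfold Rminus. rewrite Rplus_assoc, Rplus_opp_l, Rplus_0_r.
      apply rbern_le; [apply cm_shift; auto|]. intros k Hk. specialize (Hin k Hk).
      apply Rabs_le_between in Hin. lra.
    - apply Rplus_le_reg_r with (rbern n (shift a) (fun k => node n k ^ m)).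
      rewrite <- rbern_plus. unfold Rminus. rewrite Rplus_assoc, Rplus_opp_l, Rplus_0_r.
      apply rbern_le; [apply cm_shift; auto|]. intros k Hk. specialize (Hin k Hk).
      apply Rabs_le_between in Hin. lra. }
  apply (is_lim_seq_le_le_loc (fun n => rbern n (shift a) (fun k => node n k ^ m) - d n)
     _ (fun n => rbern n (shift a) (fun k => node n k ^ m) + d n)).
  + exists 1%nat. intros n Hn. specialize (Hb n Hn). apply Rabs_le_between in Hb. lra.
  + replace (Finite (shift a m)) with (Finite (shift a m - 0)) by (f_equal; ring).
    apply is_lim_seq_minus'; auto.
  + replace (Finite (shift a m)) with (Finite (shift a m + 0)) by (f_equal; ring).
    apply is_lim_seq_plus'; auto.
Qed.

(** The quadratic form in [t] with moment kernel [x ^ m * (x - t) ^ 2] is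
    nonnegative; evaluate it at [t = a (m + 1) / a m]. *)
Lemma cm_log_convex a m : completely_monotone a -> 0 < a m -> a (S m) * a (S m) <= a m * a (S (S m)).
Proof.
intros Ha Hm.
assert (Hq : forall t, 0 <= a (S (S m)) + ((-2 * t) * a (S m) + t ^ 2 * a m)).
{ intros t.
  assert (HL : is_lim_seq (fun n => rbern n a (fun k => node n k ^ S (S m)
       + ((-2 * t) * node n k ^ S m + t ^ 2 * node n k ^ m)))
       (a (S (S m)) + ((-2 * t) * a (S m) + t ^ 2 * a m))).
  { eapply is_lim_seq_ext.
    { intros n. symmetry.
      rewrite (rbern_plus n a (fun k => node n k ^ S (S m))
        (fun k => (-2 * t) * node n k ^ S m + t ^ 2 * node n k ^ m)).
      rewrite (rbern_plus n a (fun k => (-2 * t) * node n k ^ S m) (fun k => t ^ 2 * node n k ^ m)).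
      rewrite (rbern_scal n a (-2 * t) (fun k => node n k ^ S m)).
      rewrite (rbern_scal n a (t ^ 2) (fun k => node n k ^ m)). reflexivity. }
    apply is_lim_seq_plus'; [apply rbern_moment; auto|].
    apply is_lim_seq_plus'.
    - apply (is_lim_seq_scal_l _ (-2 * t) (a (S m))), rbern_moment; auto.
    - apply (is_lim_seq_scal_l _ (t ^ 2) (a m)), rbern_moment; auto. }
  apply (is_lim_seq_le_loc (fun _ => 0) _ 0 _) in HL; [exact HL| |apply is_lim_seq_const].
  exists 1%nat. intros n Hn.
  replace 0 with (rbern n a (fun _ => 0 * 0)) by (rewrite rbern_scal; ring).
  apply rbern_le; auto. intros k Hk. destruct (node_bounds n k) as [H0 H1]; auto.
  set (x := node n k) in *.
  replace (x ^ S (S m) + (-2 * t * x ^ S m + t ^ 2 * x ^ m)) with (x ^ m * (x - t) ^ 2) by (simpl; ring).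
  rewrite Rmult_0_l. apply Rmult_le_pos; [apply pow_le; auto|apply pow2_ge_0]. }
specialize (Hq (a (S m) / a m)).
apply Rmult_le_compat_l with (r := a m) in Hq; [|lra].
replace (a m * (a (S (S m)) + (-2 * (a (S m) / a m) * a (S m) + (a (S m) / a m) ^ 2 * a m)))
 with (a m * a (S (S m)) - a (S m) * a (S m)) in Hq by (field; lra). lra.
Qed.

(** * Inequalities between kernels *)

Definition cseq (a : nat -> R) (n : nat) : C := RtoC (a n).

Definition kernel (t : R) (z : C) : C := (/ (1 - RtoC t * z))%C.

Definition genfun (v : nat -> R) (z : C) : C := cpseries (cseq v) z.

Lemma cseq_bound a : completely_monotone a -> forall k, Cmod (cseq a k) <= a O.
Proof.
intros Ha k. unfold cseq. rewrite Cmod_R, Rabs_pos_eq by (apply cm_nonneg; auto).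
apply cm_le_0; auto.
Qed.

Lemma cnull_RtoC u l : is_lim_seq u (Finite l) -> cnull (fun n => RtoC (u n) - RtoC l)%C.
Proof.
intros H eps He. apply is_lim_seq_spec in H. destruct (H (mkposreal eps He)) as [N HN].
exists N. intros n Hn. rewrite <- RtoC_minus, Cmod_R. apply HN; auto.
Qed.

Lemma cnull_csum (f : nat -> nat -> C) M :
  (forall m, (m < M)%nat -> cnull (fun n => f n m)) -> cnull (fun n => csum (f n) M).
Proof.
induction M as [|M IH]; intros H; simpl.
- intros eps He. exists O. intros. rewrite Cmod_0. auto.
- apply cnull_plus; [apply IH; intros; apply H|apply H]; lia.
Qed.

Lemma one_minus_nz z : Cmod z < 1 -> (1 - z <> 0)%C.
Proof.
intros Hz E. assert (E' : z = RtoC 1) by (replace z with (1 - (1 - z))%C by ring; rewrite E; ring).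
rewrite E', Cmod_1 in Hz. lra.
Qed.

Lemma one_minus_Cmod z : 1 - Cmod z <= Cmod (1 - z).
Proof.
pose proof (Cmod_triangle (1 - z) z). replace (1 - z + z)%C with (RtoC 1) in H by ring.
rewrite Cmod_1 in H. lra.
Qed.

Lemma scaled_node t z : 0 <= t <= 1 -> Cmod (RtoC t * z) <= Cmod z.
Proof.
intros Ht. rewrite Cmod_mult, Cmod_R, Rabs_pos_eq by lra. pose proof (Cmod_ge_0 z). nra.
Qed.

Lemma kernel_partial z t M : 0 <= t <= 1 -> Cmod z < 1 ->
  Cmod (/ (1 - RtoC t * z) - csum (fun m => z ^ m * RtoC (t ^ m))%C M) <= Cmod z ^ M / (1 - Cmod z).
Proof.
intros Ht Hz. pose proof (scaled_node t z Ht) as Hw. set (w := (RtoC t * z)%C) in *.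
assert (E : csum (fun m => z ^ m * RtoC (t ^ m))%C M = csum (fun m => w ^ m)%C M).
{ apply csum_ext. intros. unfold w. rewrite Cpow_mult_l, RtoC_pow. ring. }
assert (G : forall n, (/ (1 - w) - csum (fun m => w ^ m)%C n = w ^ n / (1 - w))%C).
{ assert (Hnz : (1 - w <> 0)%C) by (apply one_minus_nz; lra).
  induction n as [|n IH]; [simpl; field; auto|]. simpl.
  replace (/ (1 - w) - (csum (fun m => w ^ m)%C n + w ^ n))%C
   with ((/ (1 - w) - csum (fun m => w ^ m)%C n) - w ^ n)%C by ring.
  rewrite IH. field. auto. }
rewrite E, G. rewrite Cmod_div by (apply one_minus_nz; lra). rewrite Cmod_pow.
pose proof (one_minus_Cmod w). pose proof (Cmod_ge_0 w).
unfold Rdiv. apply Rmult_le_compat.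
- apply pow_le; auto.
- apply Rlt_le, Rinv_0_lt_compat; lra.
- apply pow_incr; lra.
- apply Rinv_le_contravar; lra.
Qed.

Lemma bern_csum n a (f : nat -> nat -> C) M :
  bern n a (fun k => csum (fun m => f m k) M) = csum (fun m => bern n a (f m)) M.
Proof.
induction M as [|M IH]; simpl.
- rewrite (bern_ext _ _ _ (fun _ => RtoC 0 * RtoC 0)%C) by (intros; ring). rewrite bern_scal. ring.
- rewrite (bern_plus n a (fun k => csum (fun m => f m k) M) (f M)), IH. reflexivity.
Qed.

Definition moment (n : nat) (a : nat -> R) (m : nat) : R := rbern n a (fun k => node n k ^ m).

(** The moments converge one at a time, and both sides are determined by their
    first [M] moments up to a geometrically small error. *)
Lemma stieltjes_discretization a z : completely_monotone a -> Cmod z < 1 ->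
  cnull (fun n => bern n a (fun k => kernel (node n k) z) - genfun a z)%C.
Proof.
unfold genfun, kernel.
intros Ha Hz eps He. pose proof (Cmod_ge_0 z) as Hz0.
assert (Ha0 := cm_nonneg a O Ha).
destruct (pow_null (Cmod z) ltac:(lra) (eps / 4 * (1 - Cmod z) / (a O + 1))) as [M HM].
{ apply Rdiv_lt_0_compat; [apply Rmult_lt_0_compat|]; lra. }
specialize (HM M ltac:(lia)). rewrite Cmod_R, Rabs_pos_eq in HM by (apply pow_le; auto).
set (T := Cmod z ^ M / (1 - Cmod z)) in *.
assert (HT : a O * T <= eps / 4).
{ unfold T. apply Rmult_lt_compat_r with (r := (a O + 1) / (1 - Cmod z)) in HM;
    [|apply Rdiv_lt_0_compat; lra].
  replace (eps / 4 * (1 - Cmod z) / (a O + 1) * ((a O + 1) / (1 - Cmod z))) with (eps / 4) in HM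
    by (field; lra).
  assert (0 <= Cmod z ^ M / (1 - Cmod z)) by (apply Rdiv_le_0_compat; [apply pow_le; auto|lra]).
  replace (Cmod z ^ M * ((a O + 1) / (1 - Cmod z))) with (a O * (Cmod z ^ M / (1 - Cmod z))
    + Cmod z ^ M / (1 - Cmod z)) in HM
    by (field; lra). lra. }
assert (Hmom : cnull (fun n => csum (fun m => z ^ m * (RtoC (moment n a m) - RtoC (a m)))%C M)).
{ apply cnull_csum. intros m _. apply cnull_mult with (K := Cmod z ^ m).
  - intros _. rewrite Cmod_pow. lra.
  - apply cnull_RtoC, rbern_moment, Ha. }
destruct (Hmom (eps / 4)) as [N HN]; [lra|].
exists (S N). intros n Hn. specialize (HN n ltac:(lia)).
set (P := fun k => csum (fun m => z ^ m * RtoC (node n k ^ m)%R)%C M).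
replace (bern n a (fun k => / (1 - node n k * z)) - cpseries (cseq a) z)%C
 with (bern n a (fun k => / (1 - node n k * z) - P k)
   + (csum (fun m => z ^ m * (RtoC (moment n a m) - RtoC (a m))) M
   + - (cpseries (cseq a) z - cpartial (cseq a) z M)))%C.
2:{ rewrite (bern_ext _ _ _ (fun k => / (1 - node n k * z) + (- (1)) * P k)%C) by (intros; ring).
    rewrite bern_plus, bern_scal. unfold P at 1. rewrite bern_csum.
    rewrite (csum_ext (fun m => bern n a (fun k => z ^ m * RtoC (node n k ^ m)%R))%C
      (fun m => z ^ m * RtoC (moment n a m))%C).
    2:{ intros m _. rewrite bern_scal, bern_RtoC. reflexivity. }
    rewrite (csum_ext (fun m => z ^ m * (RtoC (moment n a m) - RtoC (a m)))%C
      (fun m => z ^ m * RtoC (moment n a m) - cseq a m * z ^ m)%C)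
      by (intros; unfold cseq; ring).
    rewrite csum_minus. unfold cpartial. ring. }
eapply Rle_lt_trans; [apply Cmod_triangle|].
assert (H1 : Cmod (bern n a (fun k => / (1 - node n k * z) - P k)%C) <= a O * T).
{ eapply Rle_trans; [apply Cmod_bern; auto|].
  apply Rle_trans with (rbern n a (fun _ => T * 1)).
  - apply rbern_le; auto. intros k Hk. rewrite Rmult_1_r.
    apply kernel_partial; auto. apply node_bounds; lia.
  - rewrite rbern_scal, rbern_one. lra. }
pose proof (Cmod_triangle (csum (fun m => z ^ m * (RtoC (moment n a m) - RtoC (a m)))%C M)
  (- (cpseries (cseq a) z - cpartial (cseq a) z M))) as H2.
rewrite Cmod_opp in H2.
pose proof (cpseries_tail (cseq a) (a O) z M (cseq_bound a Ha) Hz) as H3.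
replace (a O * Cmod z ^ M / (1 - Cmod z)) with (a O * T) in H3 by (unfold T; field; lra).
lra.
Qed.

Fixpoint point_comb (F : C -> C) (l : list (C * C)) : C :=
  match l with nil => RtoC 0 | (c, z) :: l' => (c * F z + point_comb F l')%C end.

Definition in_disc (l : list (C * C)) : Prop := List.Forall (fun p => Cmod (snd p) < 1) l.

Lemma point_comb_discretization a l : completely_monotone a -> in_disc l ->
  cnull (fun n => bern n a (fun k => point_comb (kernel (node n k)) l) - point_comb (genfun a) l)%C.
Proof.
intros Ha. induction l as [|[c z] l IH]; intros Hl; simpl.
- apply cnull_ext with (fun _ => RtoC 0).
  + intros n. rewrite (bern_ext _ _ _ (fun _ => RtoC 0 * RtoC 0)%C) by (intros; ring).
    rewrite bern_scal. ring.
  + intros eps He. exists O. intros. rewrite Cmod_0. auto.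
- inversion Hl; subst. simpl in *.
  eapply cnull_ext; [|apply (cnull_plus _ _
    (cnull_mult (fun _ => c) _ (Cmod c) (fun _ => Rle_refl _) (stieltjes_discretization a z Ha H1))
    (IH H2))].
  intros n. cbv beta.
  rewrite (bern_plus n a (fun k => c * kernel (node n k) z)%C
    (fun k => point_comb (kernel (node n k)) l)), bern_scal.
  ring.
Qed.

Lemma Series_zero : Series (fun _ => 0) = 0.
Proof.
rewrite (Series_ext _ (fun _ => 0 * 0)) by (intros; ring).
rewrite (Series_scal_l 0 (fun _ => 0)). ring.
Qed.

Lemma genfun_real a r : genfun a (RtoC r) = RtoC (PSeries a r).
Proof.
unfold genfun, cpseries, cseq, PSeries, RtoC. f_equal.
- apply Series_ext. intros n. change (Re (RtoC (a n) * RtoC r ^ n)%C = a n * r ^ n).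
  rewrite <- RtoC_pow, <- RtoC_mult. reflexivity.
- transitivity (Series (fun _ => 0)); [|apply Series_zero]. apply Series_ext. intros n.
  change (Im (RtoC (a n) * RtoC r ^ n)%C = 0).
  rewrite <- RtoC_pow, <- RtoC_mult. reflexivity.
Qed.

Lemma cnull_le (u v : nat -> C) x y :
  cnull (fun n => u n - x)%C -> cnull (fun n => v n - y)%C ->
  (exists N, forall n, (N <= n)%nat -> Cmod (u n) <= Cmod (v n)) -> Cmod x <= Cmod y.
Proof.
intros Hu Hv [N HN]. apply le_epsilon. intros eps He.
destruct (Hu (eps / 2)) as [N1 H1]; [lra|]. destruct (Hv (eps / 2)) as [N2 H2]; [lra|].
set (n := (N + N1 + N2)%nat). specialize (HN n ltac:(lia)). specialize (H1 n ltac:(lia)).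
specialize (H2 n ltac:(lia)).
assert (Cmod x <= Cmod (u n) + Cmod (u n - x)).
{ pose proof (Cmod_triangle (u n) (- (u n - x))). rewrite Cmod_opp in H.
  replace (u n + - (u n - x))%C with x in H by ring. lra. }
assert (Cmod (v n) <= Cmod y + Cmod (v n - y)).
{ pose proof (Cmod_triangle y (v n - y)). replace (y + (v n - y))%C with (v n) in H0 by ring. lra. }
lra.
Qed.

Lemma PSeries_cm_nonneg a r : completely_monotone a -> 0 <= r < 1 -> 0 <= PSeries a r.
Proof.
intros Ha Hr. unfold PSeries. rewrite <- Series_zero.
apply Series_le.
- intros n. split; [lra|]. apply Rmult_le_pos; [apply cm_nonneg; auto|apply pow_le; lra].
- apply (ex_series_dominated _ (cseq a) (a O) (RtoC r)).
  + apply cseq_bound; auto.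
  + rewrite Cmod_R, Rabs_pos_eq; lra.
  + intros k. unfold cseq. rewrite <- RtoC_pow, <- RtoC_mult, Cmod_R. lra.
Qed.

(** The generating function of a completely monotone sequence is a superposition
    of the kernels [1 / (1 - t z)], [0 <= t <= 1], with nonnegative weights; so an
    inequality between kernels that is uniform in [t] passes to [genfun a].  For
    the finite superpositions [bern n a] this is the triangle inequality. *)
Lemma positivity_principle a l r eps :
  completely_monotone a -> in_disc l -> 0 <= r < 1 -> 0 <= eps ->
  (forall t, 0 <= t <= 1 -> Cmod (point_comb (kernel t) l) <= eps / (1 - t * r)) ->
  Cmod (point_comb (genfun a) l) <= eps * PSeries a r.
Proof.
intros Ha Hl Hr He H.
assert (Hrm : Cmod (RtoC r) < 1) by (rewrite Cmod_R, Rabs_pos_eq; lra).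
assert (Hps := PSeries_cm_nonneg a r Ha Hr).
replace (eps * PSeries a r) with (Cmod (RtoC eps * genfun a (RtoC r))).
2:{ rewrite genfun_real, <- RtoC_mult, Cmod_R, Rabs_pos_eq; [reflexivity|].
    apply Rmult_le_pos; auto. }
apply (cnull_le _ (fun n => RtoC eps * bern n a (fun k => kernel (node n k) (RtoC r)))%C _ _
  (point_comb_discretization a l Ha Hl)).
- eapply cnull_ext; [|apply (cnull_mult (fun _ => RtoC eps) _ (Cmod eps) (fun _ => Rle_refl _)
     (stieltjes_discretization a (RtoC r) Ha Hrm))].
  intros n. cbv beta. ring.
- exists 1%nat. intros n Hn. rewrite <- bern_scal.
  rewrite (bern_ext n a (fun k => eps * kernel (node n k) (RtoC r))%C
     (fun k => RtoC (eps / (1 - node n k * r)))).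
  2:{ intros k Hk. destruct (node_bounds n k Hn Hk).
      assert (node n k * r <= 1 * r) by (apply Rmult_le_compat_r; lra).
      unfold kernel. rewrite RtoC_div, RtoC_minus, RtoC_mult by lra. reflexivity. }
  rewrite bern_RtoC, Cmod_R, Rabs_pos_eq.
  + eapply Rle_trans; [apply Cmod_bern; auto|]. apply rbern_le; auto.
    intros k Hk. apply H, node_bounds; auto.
  + replace 0 with (rbern n a (fun _ => 0 * 0)) by (rewrite rbern_scal; ring).
    apply rbern_le; auto. intros k Hk. destruct (node_bounds n k Hn Hk).
    assert (node n k * r <= 1 * r) by (apply Rmult_le_compat_r; lra).
    rewrite Rmult_0_l. apply Rdiv_le_0_compat; lra.
Qed.

(** * Consistency on the real axis *)

Lemma Rpower_pos x y : 0 < Rpower x y.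
Proof. apply exp_pos. Qed.

Lemma Rpower_small alpha eps : 0 < alpha -> 0 < eps ->
  exists s0, 0 < s0 /\ forall s, 0 < s < s0 -> Rpower s alpha < eps.
Proof.
intros Ha He. exists (Rpower eps (/ alpha)). split; [apply Rpower_pos|].
intros s [H0 H1]. apply Rlt_le_trans with (Rpower (Rpower eps (/ alpha)) alpha).
- apply Rlt_Rpower_l; lra.
- rewrite Rpower_mult, Rinv_l, Rpower_1; lra.
Qed.

Lemma exp_le_compat x y : x <= y -> exp x <= exp y.
Proof. intros [H|H]; [left; apply exp_increasing; auto|rewrite H; lra]. Qed.

Lemma ln_one_minus_bounds s : 0 < s < 1 -> s <= - ln (1 - s) <= s / (1 - s).
Proof.
intros Hs. split.
- assert (1 - s <= exp (- s)) by (pose proof (exp_ineq1_le (- s)); lra).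
  apply ln_le in H; [|lra]. rewrite ln_exp in H. lra.
- assert (exp (- (s / (1 - s))) <= 1 - s).
  { rewrite exp_Ropp. assert (1 + s / (1 - s) <= exp (s / (1 - s))) by apply exp_ineq1_le.
    replace (1 + s / (1 - s)) with (/ (1 - s)) in H by (field; lra).
    apply Rle_trans with (/ / (1 - s)); [|rewrite Rinv_inv; lra].
    apply Rinv_le_contravar; [apply Rinv_0_lt_compat; lra|auto]. }
  apply ln_le in H; [|apply exp_pos]. rewrite ln_exp in H. lra.
Qed.

Definition lim0 (g : R -> R) (l : R) : Prop :=
  forall eps, 0 < eps -> exists s0, 0 < s0 /\ forall s, 0 < s < s0 -> Rabs (g s - l) < eps.

(** Consistency in the variable [s = 1 - exp (- h)], which equals [h] to first
    order. *)
Lemma consistent_real_asymptotics alpha a : 0 < alpha < 1 -> consistent alpha a ->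
  lim0 (fun s => Rpower s alpha * PSeries a (1 - s)) 1.
Proof.
intros Ha [_ Hc] eps He.
set (e := Rmin (eps / 2) 1).
assert (He' : 0 < e) by (unfold e; apply Rmin_case; lra).
assert (Hee : e <= eps / 2 /\ e <= 1) by (split; [apply Rmin_l|apply Rmin_r]).
destruct (proj1 (filterlim_locally (F := at_right 0) _ _) Hc (mkposreal e He')) as [d Hd].
pose proof (cond_pos d) as Hd0.
exists (Rmin (/ 2) (Rmin (d / 2) (eps / 4))).
split; [repeat apply Rmin_case; lra|]. intros s [Hs0 Hs1].
assert (Hs : s < / 2 /\ s < d / 2 /\ s < eps / 4).
{ pose proof (Rmin_l (/ 2) (Rmin (d / 2) (eps / 4))). pose proof (Rmin_r (/ 2) (Rmin (d / 2) (eps / 4))).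
  pose proof (Rmin_l (d / 2) (eps / 4)). pose proof (Rmin_r (d / 2) (eps / 4)). lra. }
set (h := - ln (1 - s)).
destruct (ln_one_minus_bounds s ltac:(lra)) as [L1 L2]. fold h in L1, L2.
assert (Hh2 : h <= 2 * s).
{ apply Rle_trans with (1 := L2). apply Rle_div_l; [lra|]. nra. }
assert (Hball : ball 1 e (Rpower h alpha * PSeries a (exp (- h)))).
{ apply Hd; [|lra]. change (Rabs (h - 0) < d). rewrite Rminus_0_r, Rabs_pos_eq; lra. }
change (Rabs (Rpower h alpha * PSeries a (exp (- h)) - 1) < e) in Hball.
unfold h in Hball at 2. rewrite Ropp_involutive, exp_ln in Hball by lra.
set (A := PSeries a (1 - s)) in *.
assert (Hq : Rpower s alpha = Rpower (s / h) alpha * Rpower h alpha).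
{ rewrite Rpower_mult_distr by (try apply Rdiv_lt_0_compat; lra). f_equal. field. lra. }
assert (Hsh : 1 - s <= s / h <= 1).
{ split.
  - apply Rmult_le_reg_r with h; [lra|]. unfold Rdiv. rewrite Rmult_assoc, Rinv_l, Rmult_1_r by lra.
    replace s with (s / (1 - s) * (1 - s)) at 2 by (field; lra). rewrite Rmult_comm.
    apply Rmult_le_compat_r; lra.
  - apply Rle_div_l; [lra|]. lra. }
assert (Hr : 1 - s <= Rpower (s / h) alpha <= 1).
{ split.
  - apply Rle_trans with (s / h); [lra|].
    rewrite <- (Rpower_1 (s / h)) at 1 by lra.
    unfold Rpower. apply exp_le_compat.
    assert (ln (s / h) <= 0) by (rewrite <- ln_1; apply ln_le; lra). nra.
  - rewrite <- (Rpower_O (s / h)) by lra. unfold Rpower. apply exp_le_compat.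
    assert (ln (s / h) <= 0) by (rewrite <- ln_1; apply ln_le; lra). nra. }
rewrite Hq, Rmult_assoc. set (x := Rpower h alpha * A) in *.
set (q := Rpower (s / h) alpha) in *.
apply Rabs_lt_between in Hball. apply Rabs_lt_between.
split; nra.
Qed.

Lemma rsum_le_PSeries_bound a S : completely_monotone a ->
  (forall n, rsum a n <= S) -> forall r, 0 <= r < 1 -> PSeries a r <= S.
Proof.
intros Ha HS r Hr.
assert (Hex : ex_series (fun n => a n * r ^ n)).
{ apply (ex_series_dominated _ (cseq a) (a O) (RtoC r)).
  - apply cseq_bound; auto.
  - rewrite Cmod_R, Rabs_pos_eq; lra.
  - intros k. unfold cseq. rewrite <- RtoC_pow, <- RtoC_mult, Cmod_R. lra. }
apply series_partial in Hex.
apply (is_lim_seq_le _ (fun _ => S) (PSeries a r) S) in Hex; [exact Hex| |apply is_lim_seq_const].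
intros n. apply Rle_trans with (2 := HS n). apply rsum_le. intros k _.
rewrite <- (Rmult_1_r (a k)) at 2. apply Rmult_le_compat_l; [apply cm_nonneg; auto|].
apply Rle_trans with (1 ^ k); [apply pow_incr; lra|rewrite pow1; lra].
Qed.

(** Otherwise [PSeries a] would be bounded on [0, 1), and its product with
    [h ^ alpha] would tend to 0. *)
Lemma consistent_sum_unbounded alpha a : 0 < alpha < 1 -> CM_preserving alpha a ->
  forall S, exists n, S < rsum a n.
Proof.
intros Halpha [Hc Ha] S.
destruct (Classical_Prop.classic (exists n, S < rsum a n)) as [H|H]; [auto|exfalso].
assert (HS : forall n, rsum a n <= S).
{ intros n. apply Rnot_lt_le. intros Hn. apply H. exists n; auto. }
assert (HS0 : 0 <= S) by (specialize (HS O); simpl in HS; lra).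
destruct (consistent_real_asymptotics alpha a Halpha Hc (/ 2)) as [s1 [H1 K1]]; [lra|].
destruct (Rpower_small alpha (/ (2 * (S + 1)))) as [s2 [H2 K2]]; [lra|apply Rinv_0_lt_compat; lra|].
set (s := Rmin (/ 2) (Rmin (s1 / 2) (s2 / 2))).
assert (Hs : 0 < s /\ s <= / 2 /\ s < s1 /\ s < s2).
{ unfold s. pose proof (Rmin_l (/ 2) (Rmin (s1 / 2) (s2 / 2))). pose proof (Rmin_r (/ 2) (Rmin (s1 / 2) (s2 / 2))).
  pose proof (Rmin_l (s1 / 2) (s2 / 2)). pose proof (Rmin_r (s1 / 2) (s2 / 2)).
  repeat split; try lra. repeat apply Rmin_case; lra. }
specialize (K1 s ltac:(lra)). specialize (K2 s ltac:(lra)).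
pose proof (rsum_le_PSeries_bound a S Ha HS (1 - s) ltac:(lra)) as HP.
pose proof (Rpower_pos s alpha) as Hp.
assert (Rpower s alpha * PSeries a (1 - s) <= / 2).
{ apply Rle_trans with (Rpower s alpha * (S + 1)); [apply Rmult_le_compat_l; lra|].
  apply Rle_trans with (/ (2 * (S + 1)) * (S + 1)); [apply Rmult_le_compat_r; lra|].
  apply Req_le. field. lra. }
apply Rabs_lt_between in K1. lra.
Qed.

(** * The sequence inverse to a *)

Section Scheme.
Variables (alpha : R) (omega a : nat -> R).
Hypothesis alpha_range : 0 < alpha < 1.
Hypothesis omega_a : is_conv_inverse omega a.
Hypothesis a_cm : CM_preserving alpha a.

Lemma scheme_cm : completely_monotone a.
Proof. apply a_cm. Qed.

Lemma inverse_rsum n :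
  rsum (fun j => omega j * a (n - j)%nat) (S n) = match n with O => 1 | _ => 0 end.
Proof.
specialize (omega_a n). unfold conv in omega_a. rewrite rsum_sum_n in omega_a.
rewrite omega_a. destruct n; reflexivity.
Qed.

Lemma inverse_cconv n : cconv (cseq omega) (cseq a) n = cdelta n.
Proof.
unfold cconv, cseq. rewrite (csum_ext _ (fun j => RtoC (omega j * a (n - j)%nat)))
  by (intros; rewrite RtoC_mult; reflexivity).
rewrite <- RtoC_rsum, inverse_rsum. destruct n; reflexivity.
Qed.

Lemma omega0_a0 : omega O * a O = 1.
Proof. pose proof (inverse_rsum O). simpl in H. lra. Qed.

Lemma a0_pos : 0 < a O.
Proof.
pose proof omega0_a0. pose proof (cm_nonneg a O scheme_cm).
destruct (Req_dec (a O) 0) as [E|E]; [rewrite E in H|]; lra.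
Qed.

Lemma omega0_pos : 0 < omega O.
Proof. pose proof omega0_a0. pose proof a0_pos. nra. Qed.

Lemma a_pos n : 0 < a n.
Proof.
assert (H1 : 0 < a 1%nat).
{ destruct (Rle_lt_dec (a 1%nat) 0) as [H|H]; [exfalso|auto].
  destruct (consistent_sum_unbounded alpha a alpha_range a_cm (a O)) as [N Hn].
  assert (Hz : forall k, a (S k) <= 0).
  { induction k as [|k IH]; [auto|]. pose proof (cm_decr a (S k) scheme_cm). lra. }
  destruct N as [|N]; [simpl in Hn; pose proof a0_pos; lra|].
  rewrite rsum_head in Hn.
  pose proof (rsum_le (fun k => a (S k)) (fun _ => 0) N (fun k _ => Hz k)).
  rewrite rsum_const in H0. lra. }
assert (H : 0 < a n /\ 0 < a (S n)).
{ induction n as [|n [IH1 IH2]]; [split; [apply a0_pos|auto]|]. split; [auto|].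
  pose proof (cm_log_convex a n scheme_cm IH1).
  assert (0 < a (S n) * a (S n)) by (apply Rmult_lt_0_compat; auto). nra. }
apply H.
Qed.

Lemma omega_nonpos n : omega (S n) <= 0.
Proof.
apply (kaluza omega a); [apply a_pos| |intros m; rewrite inverse_rsum; destruct m; reflexivity].
intros m. apply cm_log_convex; [apply scheme_cm|apply a_pos].
Qed.

Definition partial_omega (n : nat) : R := rsum omega (S n).

Lemma partial_omega_decr n : partial_omega (S n) <= partial_omega n.
Proof. unfold partial_omega. simpl. pose proof (omega_nonpos n). lra. Qed.

Lemma partial_omega_conv n : rsum (fun j => partial_omega j * a (n - j)%nat) (S n) = 1.
Proof.
apply RtoC_inj. rewrite RtoC_rsum.
transitivity (cconv (fun k => csum (cseq omega) (S k)) (cseq a) n).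
{ apply csum_ext. intros k _. unfold partial_omega, cseq. rewrite RtoC_mult, RtoC_rsum. reflexivity. }
rewrite cconv_comm, <- csum_cconv.
rewrite (csum_ext _ cdelta) by (intros; rewrite cconv_comm; apply inverse_cconv).
rewrite csum_head. simpl. rewrite csum_zero by reflexivity. ring.
Qed.

(** [partial_omega * a] is constantly 1.  Passing from [n] to [n + 1] replaces the
    weights [a (n - j)] of the earlier terms by smaller ones, which leaves room
    for a nonnegative new term. *)
Lemma partial_omega_nonneg n : 0 <= partial_omega n.
Proof.
induction n as [n IH] using (well_founded_induction lt_wf).
destruct n as [|n]; [unfold partial_omega; simpl; pose proof omega0_pos; lra|].
pose proof (partial_omega_conv n) as H1. pose proof (partial_omega_conv (S n)) as H2.
change (rsum ?f (S (S n))) with (rsum f (S n) + f (S n)) in H2. cbv beta in H2.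
rewrite Nat.sub_diag in H2.
assert (rsum (fun j => partial_omega j * a (S n - j)%nat) (S n)
  <= rsum (fun j => partial_omega j * a (n - j)%nat) (S n)).
{ apply rsum_le. intros k Hk. apply Rmult_le_compat_l; [apply IH; auto|].
  replace (S n - k)%nat with (S (n - k)) by lia. apply cm_decr, scheme_cm. }
assert (0 <= partial_omega (S n) * a O) by lra. pose proof a0_pos. nra.
Qed.

(** In [1 = partial_omega * a] at [n], each factor [partial_omega j] is at least
    [partial_omega n], and the sum of [a] is unbounded. *)
Lemma partial_omega_lim eps : 0 < eps -> exists N, partial_omega N < eps.
Proof.
intros He. destruct (consistent_sum_unbounded alpha a alpha_range a_cm (/ eps)) as [n Hn].
exists n. apply Rnot_le_lt. intros Hle.
pose proof (partial_omega_conv n) as H1.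
assert (Hmono : forall p q, (p <= q)%nat -> partial_omega q <= partial_omega p).
{ intros p q Hpq. induction Hpq; [lra|]. pose proof (partial_omega_decr m). lra. }
assert (H2 : rsum (fun j => eps * a (n - j)%nat) (S n) <= 1).
{ rewrite <- H1. apply rsum_le. intros k Hk. apply Rmult_le_compat_r; [apply cm_nonneg, scheme_cm|].
  apply Rle_trans with (1 := Hle). apply Hmono; lia. }
rewrite rsum_scal in H2.
assert (E : rsum (fun j => a (n - j)%nat) (S n) = rsum a (S n)).
{ clear. apply RtoC_inj. rewrite !RtoC_rsum.
  transitivity (cconv ones (cseq a) n).
  - apply csum_ext. intros. unfold ones, cseq. ring.
  - rewrite cconv_comm, cconv_one_r. reflexivity. }
rewrite E in H2. simpl in H2. pose proof (cm_nonneg a n scheme_cm).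
assert (/ eps * eps < 1).
{ apply Rlt_le_trans with (rsum a n * eps); [apply Rmult_lt_compat_r; auto|]. nra. }
rewrite Rinv_l in H0 by lra. lra.
Qed.

Lemma omega_l1 n : rsum (fun k => Rabs (omega (S k))) n <= omega O.
Proof.
pose proof (partial_omega_nonneg n) as H. unfold partial_omega in H. rewrite rsum_head in H.
rewrite (rsum_ext _ (fun k => (-1) * omega (S k))), rsum_scal; [lra|].
intros k _. rewrite Rabs_left1 by apply omega_nonpos. ring.
Qed.

Lemma omega_bound k : Cmod (cseq omega k) <= omega O.
Proof.
unfold cseq. rewrite Cmod_R. destruct k as [|k].
- rewrite Rabs_pos_eq; [lra|]. pose proof omega0_pos; lra.
- apply Rle_trans with (2 := omega_l1 (S k)).
  apply (rsum_term_le (fun k => Rabs (omega (S k)))); [intros; apply Rabs_pos|lia].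
Qed.

(** The coefficients of positive index have absolute sum at most [omega 0]. *)
Lemma omega_disc z : Cmod z < 1 -> Cmod (genfun omega z - RtoC (omega O)) <= omega O.
Proof.
intros Hz. apply le_epsilon. intros eps He.
destruct (cpartial_cpseries (cseq omega) (omega O) z omega_bound Hz eps He) as [N HN].
specialize (HN (S N) ltac:(lia)). unfold genfun.
replace (cpseries (cseq omega) z - omega O)%C
 with ((cpartial (cseq omega) z (S N) - omega O)
   + - (cpartial (cseq omega) z (S N) - cpseries (cseq omega) z))%C by ring.
eapply Rle_trans; [apply Cmod_triangle|]. rewrite Cmod_opp.
apply Rplus_le_compat; [|lra].
unfold cpartial. rewrite csum_head. simpl.
replace (cseq omega 0 * 1 + csum (fun k => cseq omega (S k) * (z * z ^ k)) N - omega O)%C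
 with (csum (fun k => cseq omega (S k) * (z * z ^ k)) N)%C by (unfold cseq; ring).
eapply Rle_trans; [apply Cmod_csum|]. apply Rle_trans with (2 := omega_l1 N).
apply rsum_le. intros k _. rewrite <- Cpow_S, Cmod_mult, Cmod_pow. unfold cseq. rewrite Cmod_R.
rewrite <- (Rmult_1_r (Rabs _)) at 2. apply Rmult_le_compat_l; [apply Rabs_pos|].
apply Rle_trans with (1 ^ S k); [apply pow_incr; split; [apply Cmod_ge_0|lra]|rewrite pow1; lra].
Qed.

Lemma omega_genfun_inverse z : Cmod z < 1 -> (genfun omega z * genfun a z = 1)%C.
Proof.
intros Hz. apply (cpseries_product _ _ (omega O) (a O)); auto.
- apply inverse_cconv.
- apply omega_bound.
- apply cseq_bound, scheme_cm.
Qed.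

(** * The stability criterion *)

(** Put [b = omega - zeta * delta] with inverse [r].  Since
    [delta - zeta * a = a * b] has inverse [omega * r], the test equation has the
    single solution [u (n + 1) = u0 * (1 * omega * r) n], and [1 * omega] is
    [partial_omega], which decreases to 0.  Boundedness of [1 / (genfun omega -
    zeta)] gives [r -> 0], and [conv_null] concludes. *)
Lemma stable_criterion h zeta c : 0 < h -> zeta <> RtoC 0 -> 0 < c ->
  (forall z, Cmod z < 1 -> c <= Cmod (genfun omega z - zeta)) ->
  stability_region alpha h a zeta.
Proof.
intros Hh Hz Hc Hlow.
set (b := fun n => (cseq omega n - zeta * cdelta n)%C).
set (K := omega O + Cmod zeta).
assert (Hb : forall n, Cmod (b n) <= K).
{ intros n. unfold b, Cminus. eapply Rle_trans; [apply Cmod_triangle|].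
  rewrite Cmod_opp. apply Rplus_le_compat; [apply omega_bound|].
  rewrite Cmod_mult. rewrite <- (Rmult_1_r (Cmod zeta)) at 2.
  apply Rmult_le_compat_l; [apply Cmod_ge_0|].
  destruct n; simpl; [rewrite Cmod_1|rewrite Cmod_0]; lra. }
assert (Hpart : forall z n, cpartial b z (S n) = (cpartial (cseq omega) z (S n) - zeta)%C).
{ intros z n. unfold cpartial. rewrite !csum_head. 
  rewrite (csum_ext (fun k => b (S k) * z ^ S k)%C (fun k => cseq omega (S k) * z ^ S k)%C)
    by (intros; unfold b; simpl; ring).
  unfold b. simpl. ring. }
assert (HCS : forall z, Cmod z < 1 -> cpseries b z = (genfun omega z - zeta)%C).
{ intros z Hz1. symmetry. apply (cpseries_unique b K); auto.
  intros eps He. destruct (cpartial_cpseries (cseq omega) (omega O) z omega_bound Hz1 eps He) as [N HN].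
  exists (S N). intros [|n] Hn; [lia|]. rewrite Hpart.
  replace (cpartial (cseq omega) z (S n) - zeta - (genfun omega z - zeta))%C
   with (cpartial (cseq omega) z (S n) - cpseries (cseq omega) z)%C by (unfold genfun; ring).
  apply HN. lia. }
assert (Hbelow : forall z, Cmod z < 1 -> c <= Cmod (cpseries b z)).
{ intros z Hz1. rewrite HCS; auto. }
assert (Hb0 : b O <> RtoC 0).
{ intros E. specialize (Hbelow (RtoC 0)). rewrite Cmod_0 in Hbelow. specialize (Hbelow Rlt_0_1).
  replace (cpseries b 0) with (RtoC 0) in Hbelow; [rewrite Cmod_0 in Hbelow; lra|].
  apply (cpseries_unique b K); [auto|rewrite Cmod_0; lra|].
  intros eps He. exists 1%nat. intros [|n] Hn; [lia|].
  unfold cpartial. rewrite csum_head, E, csum_zero by (intros; rewrite Cpow_S; ring).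
  replace (0 * 0 ^ 0 + 0 - 0)%C with (RtoC 0) by ring. rewrite Cmod_0; auto. }
destruct (cconv_inverse_exists b Hb0) as [r Hr].
assert (Hrnull : cnull r) by (apply (reciprocal_null b r K c); auto).
set (cw := fun n => RtoC (partial_omega n)).
set (g := cconv cw r).
assert (Hcw : forall n, cw n = cconv ones (cseq omega) n).
{ intros n. rewrite cconv_comm, cconv_one_r. unfold cw, partial_omega. rewrite RtoC_rsum. reflexivity. }
assert (Hwr : forall n, cconv (cseq omega) r n = (cdelta n + zeta * r n)%C).
{ intros n. rewrite <- (Hr n). unfold b.
  rewrite (cconv_ext (fun n => cseq omega n - zeta * cdelta n)%C
     (fun n => cseq omega n + (- zeta) * cdelta n)%C r r) by (intros; ring).
  rewrite cconv_plus_l, cconv_scal_l, cconv_delta_l. ring. }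
assert (Hg : forall n, (zeta * csum r (S n) = g n - 1)%C).
{ intros n. unfold g. rewrite (cconv_ext _ _ r r n (fun k _ => Hcw k)) by reflexivity.
  rewrite cconv_assoc, (cconv_ext ones ones _ _ n ltac:(reflexivity) (fun k _ => Hwr k)).
  rewrite cconv_comm, cconv_plus_l, cconv_delta_l, cconv_scal_l, cconv_one_r. unfold ones. ring. }
assert (Hgnull : cnull g).
{ apply (conv_null partial_omega r zeta); auto using partial_omega_decr, partial_omega_nonneg, partial_omega_lim. }
assert (Har : forall n, cconv (fun k => cdelta k - zeta * cseq a k)%C (cconv (cseq omega) r) n = cdelta n).
{ intros n. rewrite <- cconv_assoc, <- (Hr n). apply cconv_ext; [|reflexivity].
  intros k _.
  rewrite (cconv_ext (fun n => cdelta n - zeta * cseq a n)%C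
     (fun n => cdelta n + (- zeta) * cseq a n)%C (cseq omega) (cseq omega)) by (intros; ring).
  rewrite cconv_plus_l, cconv_scal_l, cconv_delta_l, cconv_comm, inverse_cconv.
  unfold b. ring. }
pose proof (Rpower_pos h alpha) as Hhp.
assert (Hhp' : RtoC (Rpower h alpha) <> RtoC 0) by (intros E; apply RtoC_inj in E; lra).
exists (zeta / RtoC (Rpower h alpha))%C. split; [field; auto|].
intros u0 Hu0.
assert (Htest : forall u, test_solution alpha h a (zeta / RtoC (Rpower h alpha)) u <->
   (forall n, cconv (fun k => cdelta k - zeta * cseq a k)%C (fun k => u (S k)) n = u O)).
{ intros u. 
  assert (E : forall n, sum_n (fun j => (RtoC (a j) * u (S n - j)%nat)%C) n
     = cconv (cseq a) (fun k => u (S k)) n).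
  { intros n. rewrite csum_sum_n. apply csum_ext. intros k Hk.
    replace (S n - k)%nat with (S (n - k)) by lia. reflexivity. }
  assert (F : forall n, cconv (fun k => cdelta k - zeta * cseq a k)%C (fun k => u (S k)) n
     = (u (S n) - zeta * cconv (cseq a) (fun k => u (S k)) n)%C).
  { intros n. rewrite (cconv_ext (fun n => cdelta n - zeta * cseq a n)%C
     (fun n => cdelta n + (- zeta) * cseq a n)%C (fun k => u (S k)) (fun k => u (S k))) by (intros; ring).
    rewrite cconv_plus_l, cconv_scal_l, cconv_delta_l. ring. }
  assert (G : (zeta / RtoC (Rpower h alpha) * RtoC (Rpower h alpha) = zeta)%C) by (field; auto).
  unfold test_solution. split; intros H n.
  - rewrite F. specialize (H n). rewrite G, E in H. rewrite H. ring.
  - specialize (H n). rewrite F in H. rewrite G, E, <- H. ring. }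
set (u := fun n => match n with O => u0 | S m => (u0 * g m)%C end).
assert (Hu : test_solution alpha h a (zeta / RtoC (Rpower h alpha)) u).
{ apply Htest. intros n. simpl.
  rewrite cconv_comm, cconv_scal_l, cconv_comm.
  rewrite (cconv_ext _ (fun k => cdelta k - zeta * cseq a k)%C g (cconv ones (cconv (cseq omega) r))).
  - rewrite (cconv_comm _ (cconv ones _)), cconv_assoc.
    rewrite (cconv_ext ones ones _ cdelta n); [|reflexivity|intros; rewrite cconv_comm; apply Har].
    rewrite cconv_comm, cconv_delta_l. unfold ones. ring.
  - reflexivity.
  - intros k _. rewrite <- cconv_assoc. apply cconv_ext; [auto|reflexivity]. }
exists u. split; [split; [reflexivity|exact Hu]|split].
- intros v Hv0 Hv.
  assert (Hrec : forall w, test_solution alpha h a (zeta / RtoC (Rpower h alpha)) w ->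
    forall n, w (S n) = cconv (cconv (cseq omega) r) (fun _ => w O) n).
  { intros w Hw n. rewrite Htest in Hw.
    transitivity (cconv (cconv (cseq omega) r)
      (cconv (fun k => cdelta k - zeta * cseq a k)%C (fun k => w (S k))) n).
    - rewrite <- cconv_assoc.
      rewrite (cconv_ext _ cdelta (fun k => w (S k)) (fun k => w (S k)));
        [symmetry; apply (cconv_delta_l (fun k => w (S k)))|intros; rewrite cconv_comm; apply Har|reflexivity].
    - apply cconv_ext; [reflexivity|auto]. }
  intros [|n]; [exact Hv0|]. rewrite (Hrec v Hv), (Hrec u Hu), Hv0. reflexivity.
- apply cnull_filterlim. intros eps He.
  destruct (cnull_mult (fun _ => u0) g (Cmod u0) (fun _ => Rle_refl _) Hgnull eps He) as [N HN].
  exists (S N). intros [|n] Hn; [lia|]. apply HN. lia.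
Qed.

Lemma stable_outside_disc h zeta : 0 < h ->
  omega O < Cmod (zeta - RtoC (omega O)) -> stability_region alpha h a zeta.
Proof.
intros Hh Hz. pose proof omega0_pos as H0.
apply (stable_criterion h zeta (Cmod (zeta - omega O) - omega O)); auto; [|lra|].
- intros E. rewrite E in Hz. replace (0 - omega O)%C with (- omega O)%C in Hz by ring.
  rewrite Cmod_opp, Cmod_R, Rabs_pos_eq in Hz; lra.
- intros z Hz1. pose proof (omega_disc z Hz1).
  pose proof (Cmod_triangle (- (genfun omega z - zeta)) (genfun omega z - omega O)).
  replace (- (genfun omega z - zeta) + (genfun omega z - omega O))%C with (zeta - omega O)%C in H1 by ring.
  rewrite Cmod_opp in H1. lra.
Qed.

End Scheme.

(** * Approximation by real kernels *)

Fixpoint kernel_comb (l : list (C * R)) (v : R) : C :=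
  match l with nil => RtoC 0 | (c, a) :: l' => (c / RtoC (1 + a * v)%R + kernel_comb l' v)%C end.

Definition admissible (l : list (C * R)) : Prop := List.Forall (fun p => -1 < snd p) l.

(** Uniform approximation on [0, 1] by combinations of [1 / (1 + a v)] with real
    [a > -1]: those are the kernels at real points, relative to one of them. *)
Definition approximable (q : R -> C) : Prop :=
  forall eps, 0 < eps -> exists l, admissible l /\
    forall v, 0 <= v <= 1 -> Cmod (q v - kernel_comb l v) <= eps.

Lemma kernel_comb_app l l' v : kernel_comb (l ++ l') v = (kernel_comb l v + kernel_comb l' v)%C.
Proof. induction l as [|[c a] l IH]; simpl; [ring|rewrite IH; ring]. Qed.

Definition scale_list (k : C) (l : list (C * R)) : list (C * R) :=
  List.map (fun p => (k * fst p, snd p)%C) l.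

Lemma kernel_comb_scale k l v : kernel_comb (scale_list k l) v = (k * kernel_comb l v)%C.
Proof. induction l as [|[c a] l IH]; simpl; [ring|]. rewrite IH. unfold Cdiv. ring. Qed.

Lemma admissible_scale k l : admissible l -> admissible (scale_list k l).
Proof. intros H. unfold admissible, scale_list. apply List.Forall_map. exact H. Qed.

Lemma approximable_limit q :
  (forall eps, 0 < eps -> exists q', approximable q' /\
     forall v, 0 <= v <= 1 -> Cmod (q v - q' v) <= eps) -> approximable q.
Proof.
intros H eps He. destruct (H (eps / 2)) as [q' [Hq' Hd]]; [lra|].
destruct (Hq' (eps / 2)) as [l [Hl Hd']]; [lra|].
exists l. split; [auto|]. intros v Hv. specialize (Hd v Hv). specialize (Hd' v Hv).
replace (q v - kernel_comb l v)%C with ((q v - q' v) + (q' v - kernel_comb l v))%C by ring.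
eapply Rle_trans; [apply Cmod_triangle|lra].
Qed.

Lemma approximable_ext q q' :
  (forall v, 0 <= v <= 1 -> q v = q' v) -> approximable q -> approximable q'.
Proof.
intros E H eps He. destruct (H eps He) as [l [Hl Hd]]. exists l; split; auto.
intros v Hv. rewrite <- E; auto.
Qed.

Lemma approximable_plus q q' :
  approximable q -> approximable q' -> approximable (fun v => q v + q' v)%C.
Proof.
intros H H' eps He.
destruct (H (eps / 2)) as [l [Hl Hd]]; [lra|]. destruct (H' (eps / 2)) as [l' [Hl' Hd']]; [lra|].
exists (l ++ l')%list. split; [apply List.Forall_app; split; auto|].
intros v Hv. specialize (Hd v Hv). specialize (Hd' v Hv). rewrite kernel_comb_app.
replace (q v + q' v - (kernel_comb l v + kernel_comb l' v))%C with ((q v - kernel_comb l v)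
  + (q' v - kernel_comb l' v))%C by ring.
eapply Rle_trans; [apply Cmod_triangle|lra].
Qed.

Lemma approximable_scal k q : approximable q -> approximable (fun v => k * q v)%C.
Proof.
intros H eps He. pose proof (Cmod_ge_0 k) as Hk.
destruct (H (eps / (Cmod k + 1))) as [l [Hl Hd]]; [apply Rdiv_lt_0_compat; lra|].
exists (scale_list k l). split; [apply admissible_scale; auto|].
intros v Hv. specialize (Hd v Hv). rewrite kernel_comb_scale.
replace (k * q v - k * kernel_comb l v)%C with (k * (q v - kernel_comb l v))%C by ring.
rewrite Cmod_mult. apply Rle_trans with (Cmod k * (eps / (Cmod k + 1))).
- apply Rmult_le_compat_l; auto.
- assert (0 < eps / (Cmod k + 1)) by (apply Rdiv_lt_0_compat; lra).
  replace eps with (eps / (Cmod k + 1) * (Cmod k + 1)) at 2 by (field; lra). nra.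
Qed.

Lemma one_plus_mul_pos a v : -1 < a -> 0 <= v <= 1 -> 0 < 1 + a * v.
Proof.
intros Ha [Hv0 [Hv1|Hv1]]; [|rewrite Hv1; lra].
assert (0 <= (1 + a) * v) by (apply Rmult_le_pos; lra). lra.
Qed.

Lemma approximable_kernel a : -1 < a -> approximable (fun v => RtoC (/ (1 + a * v))).
Proof.
intros Ha eps He. exists ((RtoC 1, a) :: nil). split; [constructor; [auto|constructor]|].
intros v Hv. simpl. pose proof (one_plus_mul_pos a v Ha Hv).
rewrite RtoC_inv by lra.
replace (_ - _)%C with (RtoC 0); [rewrite Cmod_0; lra|].
field. intros E. apply RtoC_inj in E. lra.
Qed.

(** [v ^ (k + 1) / (1 + a v) = (v ^ k - v ^ k / (1 + a v)) / a]; for [a = 0] let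
    [a] tend to 0. *)
Lemma approximable_pow_kernel k : forall a, -1 < a -> approximable (fun v => RtoC (v ^ k / (1 + a * v))).
Proof.
induction k as [|k IH].
- intros a Ha. eapply approximable_ext; [|apply (approximable_kernel a Ha)].
  intros v Hv. simpl. unfold Rdiv. rewrite Rmult_1_l. reflexivity.
- assert (Hnz : forall a, -1 < a -> a <> 0 -> approximable (fun v => RtoC (v ^ S k / (1 + a * v)))).
  { intros a Ha Hz.
    apply approximable_ext with (fun v => RtoC (/ a) * (RtoC (v ^ k / (1 + 0 * v))
        + RtoC (-1) * RtoC (v ^ k / (1 + a * v))))%C.
    - intros v Hv. pose proof (one_plus_mul_pos a v Ha Hv).
      rewrite <- RtoC_mult, <- RtoC_plus, <- RtoC_mult. apply f_equal. simpl. field. lra.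
    - apply approximable_scal, approximable_plus; [apply IH; lra|].
      apply approximable_scal, IH; auto. }
  intros a Ha. destruct (Req_dec a 0) as [->|Hz]; [|apply Hnz; auto].
  apply approximable_limit. intros eps He.
  exists (fun v => RtoC (v ^ S k / (1 + eps * v))). split; [apply Hnz; lra|].
  intros v Hv. rewrite <- RtoC_minus, Cmod_R.
  assert (Hev : 0 <= eps * v) by (apply Rmult_le_pos; lra).
  assert (Hp : 0 <= v ^ S k <= 1).
  { split; [apply pow_le; lra|]. apply Rle_trans with (1 ^ S k); [apply pow_incr; lra|rewrite pow1; lra]. }
  replace (v ^ S k / (1 + 0 * v) - v ^ S k / (1 + eps * v)) with (v ^ S k * (eps * v / (1 + eps * v)))
    by (field; lra).
  assert (Hq : 0 <= eps * v / (1 + eps * v) <= eps).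
  { split; [apply Rdiv_le_0_compat; lra|].
    apply Rle_div_l; [lra|]. nra. }
  rewrite Rabs_pos_eq by (apply Rmult_le_pos; lra). nra.
Qed.

(** The geometric series in [mu * v] converges uniformly on [0, 1], and powers of
    [v] are approximable. *)
Lemma approximable_complex_kernel mu : Cmod mu < 1 -> approximable (fun v => / (1 + mu * RtoC v))%C.
Proof.
intros Hmu. apply approximable_limit. intros eps He. pose proof (Cmod_ge_0 mu).
destruct (pow_null (Cmod mu) ltac:(lra) (eps * (1 - Cmod mu))) as [M HM].
{ apply Rmult_lt_0_compat; lra. }
specialize (HM M ltac:(lia)). rewrite Cmod_R, Rabs_pos_eq in HM by (apply pow_le; auto).
exists (fun v => csum (fun m => (- mu) ^ m * RtoC (v ^ m)%R)%C M). split.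
- clear HM. induction M as [|M IH]; simpl.
  + eapply approximable_ext; [|apply (approximable_scal (RtoC 0) _ (approximable_kernel 0 ltac:(lra)))].
    intros. simpl. ring.
  + apply approximable_plus; [exact IH|]. apply approximable_scal.
    eapply approximable_ext; [|apply (approximable_pow_kernel M 0); lra].
    intros v Hv. simpl. apply f_equal. field.
- intros v Hv. pose proof (kernel_partial (- mu) v M Hv) as HK. rewrite Cmod_opp in HK.
  replace (1 + mu * v)%C with (1 - v * - mu)%C by ring.
  eapply Rle_trans; [apply HK; auto|].
  apply Rle_div_l; [lra|]. lra.
Qed.

(** * Complex limits at 0 *)

Lemma lt_Rmin4 s a b c d :
  s < Rmin (Rmin a b) (Rmin c d) -> s < a /\ s < b /\ s < c /\ s < d.
Proof.
intros H. pose proof (Rmin_l (Rmin a b) (Rmin c d)). pose proof (Rmin_r (Rmin a b) (Rmin c d)).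
pose proof (Rmin_l a b). pose proof (Rmin_r a b). pose proof (Rmin_l c d). pose proof (Rmin_r c d). lra.
Qed.

Definition clim0 (g : R -> C) (l : C) : Prop :=
  forall eps, 0 < eps -> exists s0, 0 < s0 /\ forall s, 0 < s < s0 -> Cmod (g s - l) < eps.

Lemma clim0_unique g l l' : clim0 g l -> clim0 g l' -> l = l'.
Proof.
intros H H'. apply cnull_const_eq. intros eps He. exists O. intros _ _.
destruct (H (eps / 2)) as [s0 [H0 K0]]; [lra|]. destruct (H' (eps / 2)) as [s1 [H1 K1]]; [lra|].
set (s := Rmin s0 s1 / 2).
assert (Hs : 0 < s < s0 /\ 0 < s < s1).
{ unfold s. pose proof (Rmin_l s0 s1). pose proof (Rmin_r s0 s1).
  assert (0 < Rmin s0 s1) by (apply Rmin_case; auto). lra. }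
specialize (K0 s (proj1 Hs)). specialize (K1 s (proj2 Hs)).
replace (l - l')%C with (- (g s - l) + (g s - l'))%C by ring.
eapply Rle_lt_trans; [apply Cmod_triangle|]. rewrite Cmod_opp. lra.
Qed.

Lemma clim0_plus g g' l l' : clim0 g l -> clim0 g' l' -> clim0 (fun s => g s + g' s)%C (l + l')%C.
Proof.
intros H H' eps He.
destruct (H (eps / 2)) as [s0 [H0 K0]]; [lra|]. destruct (H' (eps / 2)) as [s1 [H1 K1]]; [lra|].
exists (Rmin s0 s1). split; [apply Rmin_case; auto|]. intros s [Hs0 Hs1].
pose proof (Rmin_l s0 s1). pose proof (Rmin_r s0 s1).
specialize (K0 s ltac:(lra)). specialize (K1 s ltac:(lra)).
replace (g s + g' s - (l + l'))%C with ((g s - l) + (g' s - l'))%C by ring.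
eapply Rle_lt_trans; [apply Cmod_triangle|]. lra.
Qed.

Lemma clim0_scal k g l : clim0 g l -> clim0 (fun s => k * g s)%C (k * l)%C.
Proof.
intros H eps He. pose proof (Cmod_ge_0 k) as Hk.
destruct (H (eps / (Cmod k + 1))) as [s0 [H0 K0]]; [apply Rdiv_lt_0_compat; lra|].
exists s0. split; auto. intros s Hs. specialize (K0 s Hs).
replace (k * g s - k * l)%C with (k * (g s - l))%C by ring. rewrite Cmod_mult.
assert (0 < eps / (Cmod k + 1)) by (apply Rdiv_lt_0_compat; lra).
assert (E : eps = eps / (Cmod k + 1) * (Cmod k + 1)) by (field; lra).
pose proof (Cmod_ge_0 (g s - l)). nra.
Qed.

Lemma clim0_ext g g' l : (exists s0, 0 < s0 /\ forall s, 0 < s < s0 -> g s = g' s) -> clim0 g l -> clim0 g' l.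
Proof.
intros [s1 [H1 E]] H eps He. destruct (H eps He) as [s0 [H0 K0]].
exists (Rmin s0 s1). split; [apply Rmin_case; auto|]. intros s [Hs0 Hs1].
pose proof (Rmin_l s0 s1). pose proof (Rmin_r s0 s1). rewrite <- E by lra. apply K0; lra.
Qed.

Lemma clim0_dilate g l k : 0 < k -> clim0 g l -> clim0 (fun s => g (k * s)) l.
Proof.
intros Hk H eps He. destruct (H eps He) as [s0 [H0 K0]].
exists (s0 / k). split; [apply Rdiv_lt_0_compat; auto|]. intros s [Hs0 Hs1].
apply K0. split; [apply Rmult_lt_0_compat; auto|].
replace s0 with (k * (s0 / k)) by (field; lra). apply Rmult_lt_compat_l; auto.
Qed.

Lemma clim0_bound g l M :
  (exists s0, 0 < s0 /\ forall s, 0 < s < s0 -> Cmod (g s) <= M) -> clim0 g l -> Cmod l <= M.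
Proof.
intros [s1 [H1 B]] H. apply le_epsilon. intros eps He. destruct (H eps He) as [s0 [H0 K0]].
set (s := Rmin s0 s1 / 2).
assert (Hs : 0 < s < s0 /\ 0 < s < s1).
{ unfold s. pose proof (Rmin_l s0 s1). pose proof (Rmin_r s0 s1).
  assert (0 < Rmin s0 s1) by (apply Rmin_case; auto). lra. }
specialize (K0 s (proj1 Hs)). specialize (B s (proj2 Hs)).
replace l with (- (g s - l) + g s)%C by ring.
eapply Rle_trans; [apply Cmod_triangle|]. rewrite Cmod_opp. lra.
Qed.

Lemma clim0_cauchy g :
  (forall eps, 0 < eps -> exists L s0, 0 < s0 /\ forall s, 0 < s < s0 -> Cmod (g s - L) <= eps) ->
  exists l, clim0 g l.
Proof.
intros H.
set (F := filtermap g (at_right 0)).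
assert (HC : forall eps : posreal, exists x : C, F (ball x eps)).
{ intros eps. destruct (H (eps / 2)) as [L [s0 [H0 K]]]; [pose proof (cond_pos eps); lra|].
  exists L. exists (mkposreal s0 H0). intros s Hb Hs. change (Rabs (s - 0) < s0) in Hb.
  rewrite Rminus_0_r, Rabs_pos_eq in Hb by lra.
  apply C_NormedModule_mixin_compat1. change (minus (g s) L) with (g s - L)%C.
  apply Rle_lt_trans with (1 := K s (conj Hs Hb)). pose proof (cond_pos eps). lra. }
exists (C_complete_lim F). intros eps He.
assert (He2 : 0 < eps / 2) by lra.
assert (HP : ProperFilter F) by (apply filtermap_proper_filter; typeclasses eauto).
destruct (C_complete_ax1 F HP HC (mkposreal _ He2)) as [d Hd].
exists d. split; [apply cond_pos|]. intros s Hs.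
set (l := C_complete_lim F) in *.
assert (Hb : ball l (mkposreal _ He2) (g s)).
{ apply Hd; [|lra]. change (Rabs (s - 0) < d). rewrite Rminus_0_r, Rabs_pos_eq; lra. }
apply C_NormedModule_mixin_compat2 in Hb.
change (minus (g s) l) with (g s - l)%C in Hb. simpl in Hb.
apply Rlt_le_trans with (1 := Hb).
assert (sqrt 2 <= 2).
{ rewrite <- (sqrt_pow2 2) at 2 by lra. apply sqrt_le_1; lra. }
nra.
Qed.

Lemma Cmod_sq z : Cmod z * Cmod z = Re z * Re z + Im z * Im z.
Proof. pose proof (Cmod2_alt z). simpl in H. lra. Qed.

Lemma Cmod_lt_of_sq z r : 0 <= r -> Re z * Re z + Im z * Im z < r * r -> Cmod z < r.
Proof. intros Hr H. pose proof (Cmod_sq z). pose proof (Cmod_ge_0 z). nra. Qed.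

Lemma Cmod_ge_of_sq z r : 0 <= r -> r * r <= Re z * Re z + Im z * Im z -> r <= Cmod z.
Proof. intros Hr H. pose proof (Cmod_sq z). pose proof (Cmod_ge_0 z). nra. Qed.

(** * Kernel bounds in the right half plane *)

Lemma half_plane_denominator (x : R) w : 0 <= x -> 0 <= Re w -> (x + Cmod w) / 2 <= Cmod (RtoC x + w)%C.
Proof.
intros Hx Hw. pose proof (Cmod_ge_0 w). pose proof (Cmod_sq w).
apply Cmod_ge_of_sq; [lra|].
rewrite re_plus, im_plus, re_RtoC, im_RtoC.
assert (0 <= x * Re w) by (apply Rmult_le_pos; auto).
assert (0 <= (x - Cmod w) * (x - Cmod w)) by apply Rle_0_sqr. nra.
Qed.

Lemma kernel_denominator t tau : (1 - RtoC t * (1 - tau) = RtoC (1 - t) + RtoC t * tau)%C.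
Proof. rewrite RtoC_minus. ring. Qed.

Lemma real_denominator t s : 1 - t * (1 - s) = (1 - t) + t * s.
Proof. ring. Qed.

Lemma mix_pos t s : 0 <= t <= 1 -> 0 < s -> 0 < 1 - t + t * s.
Proof.
intros [H0 H1] Hs. destruct (Rle_lt_or_eq_dec t 1 H1) as [H|H].
- assert (0 <= t * s) by (apply Rmult_le_pos; lra). lra.
- rewrite H. lra.
Qed.

Lemma mix_ratio_bounds t s : 0 <= t <= 1 -> 0 < s -> 0 <= t * s / (1 - t + t * s) <= 1.
Proof.
intros Ht Hs. pose proof (mix_pos t s Ht Hs) as Hp.
assert (0 <= t * s) by (apply Rmult_le_pos; lra). split; [apply Rdiv_le_0_compat; auto|].
apply Rle_div_l; [auto|]. lra.
Qed.

Lemma half_plane_nz (x : R) w : 0 <= x -> 0 <= Re w -> 0 < x + Cmod w -> (RtoC x + w <> 0)%C.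
Proof.
intros Hx Hw H E. pose proof (half_plane_denominator x w Hx Hw) as Hd.
rewrite E, Cmod_0 in Hd. lra.
Qed.

Lemma kernel_bound t tau : 0 <= t <= 1 -> 0 <= Re tau -> tau <> RtoC 0 ->
  Cmod (kernel t (1 - tau)) <= 2 / (1 - t + t * Cmod tau).
Proof.
intros Ht Hre Hnz. assert (Hs : 0 < Cmod tau) by (apply Cmod_gt_0; auto).
pose proof (mix_pos t (Cmod tau) Ht Hs) as Hp.
assert (Htw : Cmod (RtoC t * tau) = t * Cmod tau) by (rewrite Cmod_mult, Cmod_R, Rabs_pos_eq; lra).
assert (Hrw : 0 <= Re (RtoC t * tau)) by (rewrite re_scal_l; apply Rmult_le_pos; lra).
pose proof (half_plane_denominator (1 - t) (RtoC t * tau) ltac:(lra) Hrw) as Hd. rewrite Htw in Hd.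
unfold kernel. rewrite kernel_denominator, Cmod_inv.
- replace (2 / (1 - t + t * Cmod tau)) with (/ ((1 - t + t * Cmod tau) / 2)) by (field; lra).
  apply Rinv_le_contravar; lra.
- apply half_plane_nz; auto; [lra|rewrite Htw; auto].
Qed.

(** The bound is relative to the kernel at the real point [1 - Cmod tau], which is
    what [positivity_principle] requires; likewise in [kernel_cauchy_riemann]. *)
Lemma kernel_lipschitz t tau tau' : 0 <= t <= 1 -> 0 <= Re tau -> 0 <= Re tau' ->
  Cmod tau' = Cmod tau -> tau <> RtoC 0 ->
  Cmod (kernel t (1 - tau) - kernel t (1 - tau'))
    <= 4 * (Cmod (tau' - tau) / Cmod tau) / (1 - t + t * Cmod tau).
Proof.
intros Ht Hre Hre' Hm Hnz. assert (Hs : 0 < Cmod tau) by (apply Cmod_gt_0; auto).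
assert (Hnz' : tau' <> RtoC 0) by (apply Cmod_gt_0; rewrite Hm; auto).
set (s := Cmod tau) in *. pose proof (mix_pos t s Ht Hs) as Hp.
pose proof (kernel_bound t tau Ht Hre Hnz) as B1. fold s in B1.
pose proof (kernel_bound t tau' Ht Hre' Hnz') as B2. rewrite Hm in B2.
assert (Hnzd : forall u, 0 <= Re u -> Cmod u = s -> (RtoC (1 - t) + RtoC t * u <> 0)%C).
{ intros u Hu Hus. apply half_plane_nz; [lra|rewrite re_scal_l; apply Rmult_le_pos; lra|].
  rewrite Cmod_mult, Cmod_R, Rabs_pos_eq, Hus by lra. exact Hp. }
replace (kernel t (1 - tau) - kernel t (1 - tau'))%C
 with (RtoC t * (tau' - tau) * (kernel t (1 - tau) * kernel t (1 - tau')))%C.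
2:{ unfold kernel. rewrite !kernel_denominator. field. split; apply Hnzd; auto. }
rewrite !Cmod_mult, Cmod_R, Rabs_pos_eq by lra.
set (D := 1 - t + t * s) in *.
set (k1 := Cmod (kernel t (1 - tau))) in *. set (k2 := Cmod (kernel t (1 - tau'))) in *.
set (d := Cmod (tau' - tau)).
assert (Hd : 0 <= d) by apply Cmod_ge_0.
apply Rle_trans with (t * d * (2 / D * (2 / D))).
- apply Rmult_le_compat_l; [apply Rmult_le_pos; lra|].
  apply Rmult_le_compat; auto; apply Cmod_ge_0.
- replace (t * d * (2 / D * (2 / D))) with (4 * (d / s) / D * (t * s / D)) by (field; lra).
  rewrite <- (Rmult_1_r (4 * (d / s) / D)) at 2. apply Rmult_le_compat_l.
  + apply Rdiv_le_0_compat; [|auto]. apply Rmult_le_pos; [lra|]. apply Rdiv_le_0_compat; auto.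
  + apply Rle_div_l; [auto|].
    unfold D; lra.
Qed.

Lemma Re_cis t : Re (cis t) = cos t. Proof. reflexivity. Qed.
Lemma Im_cis t : Im (cis t) = sin t. Proof. reflexivity. Qed.

Lemma cos_ge_quadratic x : 1 - x ^ 2 / 2 <= cos x.
Proof.
assert (H : forall y, 0 <= y -> 1 - y ^ 2 / 2 <= cos y).
{ intros y Hy. replace (cos y) with (1 - 2 * sin (y / 2) * sin (y / 2))
    by (rewrite <- cos_2a_sin; f_equal; field).
  assert (Hs : Rabs (sin (y / 2)) <= y / 2).
  { apply Rabs_le. destruct (Req_dec y 0) as [->|Hn].
    - replace (0 / 2) with 0 by field. rewrite sin_0. lra.
    - destruct (Rle_lt_dec (y / 2) PI) as [Hp|Hp].
      + pose proof (sin_lt_x (y / 2) ltac:(lra)). pose proof (sin_ge_0 (y / 2) ltac:(lra) Hp). lra.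
      + pose proof (SIN_bound (y / 2)). pose proof PI2_1. lra. }
  apply Rabs_le_between in Hs. nra. }
destruct (Rle_lt_dec 0 x) as [Hx|Hx]; [auto|].
rewrite <- cos_neg. replace (x ^ 2) with ((- x) ^ 2) by ring. apply H. lra.
Qed.

Lemma sin_ge_quadratic x : 0 <= x <= 1 -> x - x ^ 2 / 2 <= sin x.
Proof.
intros Hx. destruct (pre_sin_bound x 0) as [H _]; [lra|lra|].
unfold sin_approx, sin_term in H. simpl in H. nra.
Qed.

Lemma cis_expansion eta : 0 <= eta <= 1 -> Cmod (cis eta - 1 - Ci * RtoC eta) <= eta ^ 2.
Proof.
intros He. eapply Rle_trans; [apply Cmod_le_Re_Im|].
replace (Re (cis eta - 1 - Ci * eta)) with (cos eta - 1)
  by (unfold cis, Ci, RtoC, Re, Cminus, Cplus, Copp, Cmult; simpl; ring).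
replace (Im (cis eta - 1 - Ci * eta)) with (sin eta - eta)
  by (unfold cis, Ci, RtoC, Im, Cminus, Cplus, Copp, Cmult; simpl; ring).
pose proof (cos_ge_quadratic eta). pose proof (COS_bound eta). pose proof (sin_ge_quadratic eta He).
assert (sin eta <= eta).
{ destruct (Req_dec eta 0) as [->|Hn]; [rewrite sin_0; lra|]. left; apply sin_lt_x; lra. }
rewrite (Rabs_left1 (cos eta - 1)), (Rabs_left1 (sin eta - eta)) by lra. lra.
Qed.

Lemma cis_minus_one eta : 0 <= eta <= 1 -> Cmod (cis eta - 1) <= 2 * eta.
Proof.
intros He. pose proof (cis_expansion eta He).
replace (cis eta - 1)%C with ((cis eta - 1 - Ci * eta) + Ci * eta)%C by ring.
eapply Rle_trans; [apply Cmod_triangle|]. rewrite (Cmod_mult Ci), Cmod_Ci, Cmod_R, Rabs_pos_eq by lra. nra.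
Qed.

Lemma Cmod_scaled_cis s phi : 0 <= s -> Cmod (RtoC s * cis phi) = s.
Proof. intros Hs. rewrite Cmod_mult, Cmod_cis, Cmod_R, Rabs_pos_eq; lra. Qed.

(** Discrete Cauchy-Riemann equation: the rotation by [eta] and the contraction
    by [1 - eta] move [tau = s * cis phi] by [i * eta * tau] and [- eta * tau] to
    first order, so the increments of the kernel are in the ratio [- i] to first
    order. *)
Lemma kernel_cauchy_riemann t s phi eta :
  0 <= t <= 1 -> 0 < s -> 0 <= phi -> 0 < eta <= / 2 -> phi + eta < PI / 2 ->
  Cmod (kernel t (1 - RtoC s * cis (phi + eta)) - kernel t (1 - RtoC s * cis phi)
     + Ci * (kernel t (1 - RtoC (s * (1 - eta)) * cis phi) - kernel t (1 - RtoC s * cis phi)))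
   <= 52 * eta ^ 2 / (1 - t + t * s).
Proof.
intros Ht Hs Hphi Heta Hlt. pose proof (mix_pos t s Ht Hs) as Hp.
set (x := 1 - t). set (w := (RtoC (t * s) * cis phi)%C). set (e := cis eta).
assert (Hts : 0 <= t * s) by (apply Rmult_le_pos; lra).
assert (Hc0 : 0 <= cos phi) by (apply cos_ge_0; lra).
assert (Hc1 : 0 <= cos (phi + eta)) by (apply cos_ge_0; lra).
assert (Hw : Cmod w = t * s) by (apply Cmod_scaled_cis; auto).
assert (Hwe : (w * e)%C = (RtoC (t * s) * cis (phi + eta))%C) by (unfold w, e; rewrite cis_plus; ring).
assert (Hwem : Cmod (w * e) = t * s) by (rewrite Hwe; apply Cmod_scaled_cis; auto).
assert (Hx : 0 <= x) by (unfold x; lra).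
assert (R0 : 0 <= Re w) by (unfold w; rewrite re_scal_l, Re_cis; apply Rmult_le_pos; auto).
assert (R1 : 0 <= Re (w * e)) by (rewrite Hwe, re_scal_l, Re_cis; apply Rmult_le_pos; auto).
assert (R2 : 0 <= Re (w * RtoC (1 - eta))) by (rewrite re_scal_r; apply Rmult_le_pos; lra).
assert (Hw2 : Cmod (w * RtoC (1 - eta)) = t * s * (1 - eta))
  by (rewrite Cmod_mult, Hw, Cmod_R, Rabs_pos_eq; lra).
set (D := (RtoC x + w)%C). set (D1 := (RtoC x + w * e)%C). set (D2 := (RtoC x + w * RtoC (1 - eta))%C).
pose proof (half_plane_denominator x w Hx R0) as B0. fold D in B0. rewrite Hw in B0.
pose proof (half_plane_denominator x _ Hx R1) as B1. fold D1 in B1. rewrite Hwem in B1.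
pose proof (half_plane_denominator x _ Hx R2) as B2. fold D2 in B2. rewrite Hw2 in B2.
assert (Hxs : 0 < x + t * s) by (unfold x; lra).
assert (Hhalf : (x + t * s) / 4 <= Cmod D2) by nra.
assert (N0 : D <> RtoC 0) by (apply Cmod_gt_0; lra).
assert (N1 : D1 <> RtoC 0) by (apply Cmod_gt_0; lra).
assert (N2 : D2 <> RtoC 0) by (apply Cmod_gt_0; lra).
assert (K0 : kernel t (1 - RtoC s * cis phi) = (/ D)%C).
{ unfold kernel. rewrite kernel_denominator. f_equal. unfold D, w, x. rewrite RtoC_mult. ring. }
assert (K1 : kernel t (1 - RtoC s * cis (phi + eta)) = (/ D1)%C).
{ unfold kernel. rewrite kernel_denominator. f_equal. unfold D1. rewrite Hwe, RtoC_mult. unfold x. ring. }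
assert (K2 : kernel t (1 - RtoC (s * (1 - eta)) * cis phi) = (/ D2)%C).
{ unfold kernel. rewrite kernel_denominator. f_equal. unfold D2, w, x. rewrite !RtoC_mult. ring. }
rewrite K0, K1, K2.
replace (/ D1 - / D + Ci * (/ D2 - / D))%C
 with (w / D * (- (e - 1 - Ci * RtoC eta) / D1 + Ci * RtoC eta * (e - 1 + RtoC eta) * (w / D2) / D1))%C.
2:{ assert (E2 : (RtoC x + w * (1 - RtoC eta) = D2)%C) by (unfold D2; rewrite RtoC_minus; reflexivity).
    assert (N2' : (RtoC x + w * (1 - RtoC eta) <> 0)%C) by (rewrite E2; auto).
    rewrite <- E2. unfold D, D1. field. repeat split; auto. }
assert (H1 : Cmod (w / D) <= 2).
{ rewrite Cmod_div, Hw by auto. apply Rle_div_l; [lra|]. lra. }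
assert (H2 : Cmod (w / D2) <= 4).
{ rewrite Cmod_div, Hw by auto. apply Rle_div_l; [lra|]. lra. }
assert (H3 : Cmod (/ D1) <= 2 / (x + t * s)).
{ rewrite Cmod_inv by auto. replace (2 / (x + t * s)) with (/ ((x + t * s) / 2)) by (field; lra).
  apply Rinv_le_contravar; lra. }
pose proof (cis_expansion eta ltac:(lra)) as H4. fold e in H4.
assert (H5 : Cmod (e - 1 + RtoC eta) <= 3 * eta).
{ eapply Rle_trans; [apply Cmod_triangle|]. rewrite Cmod_R, Rabs_pos_eq by lra.
  pose proof (cis_minus_one eta ltac:(lra)). fold e in H. lra. }
assert (H6 : Cmod (- (e - 1 - Ci * RtoC eta) / D1 + Ci * RtoC eta * (e - 1 + RtoC eta) * (w / D2) / D1)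
   <= 13 * eta ^ 2 * (2 / (x + t * s))).
{ replace (- (e - 1 - Ci * RtoC eta) / D1 + Ci * RtoC eta * (e - 1 + RtoC eta) * (w / D2) / D1)%C
   with ((- (e - 1 - Ci * RtoC eta) + Ci * RtoC eta * ((e - 1 + RtoC eta) * (w / D2))) * / D1)%C
   by (field; auto).
  rewrite Cmod_mult. apply Rmult_le_compat; try apply Cmod_ge_0; auto.
  eapply Rle_trans; [apply Cmod_triangle|].
  rewrite Cmod_opp, !Cmod_mult, Cmod_Ci, Cmod_R, Rabs_pos_eq by lra.
  assert (Cmod (e - 1 + eta) * Cmod (w / D2) <= 3 * eta * 4)
    by (apply Rmult_le_compat; auto; apply Cmod_ge_0).
  nra. }
rewrite Cmod_mult.
replace (52 * eta ^ 2 / (x + t * s)) with (2 * (13 * eta ^ 2 * (2 / (x + t * s)))) by (field; lra).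
apply Rmult_le_compat; auto; apply Cmod_ge_0.
Qed.

(** * The generating function near its singularity *)

Section Asymptotics.
Variables (alpha : R) (a : nat -> R).
Hypothesis alpha_range : 0 < alpha < 1.
Hypothesis a_cons : consistent alpha a.
Hypothesis a_cm : completely_monotone a.

(** The rescaled function whose limit as [s] tends to 0 is the profile of
    [genfun a] at its singularity 1, in the direction [lam]. *)
Definition scaled_genfun (lam : C) (s : R) : C := (RtoC (Rpower s alpha) * genfun a (1 - RtoC s * lam))%C.

Lemma disc_right_half lam : 0 < Re lam ->
  exists s0, 0 < s0 /\ forall s, 0 < s < s0 -> Cmod (1 - RtoC s * lam) < 1.
Proof.
intros H. assert (Hm : 0 < Cmod lam).
{ apply Cmod_gt_0. intros E. rewrite E in H. simpl in H. lra. }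
exists (2 * Re lam / (Cmod lam * Cmod lam)).
assert (Hm2 : 0 < Cmod lam * Cmod lam) by (apply Rmult_lt_0_compat; auto).
split; [apply Rdiv_lt_0_compat; lra|]. intros s [Hs0 Hs1].
apply Cmod_lt_of_sq; [lra|].
replace (Re (1 - RtoC s * lam)) with (1 - s * Re lam) by (destruct lam; simpl; ring).
replace (Im (1 - RtoC s * lam)) with (- (s * Im lam)) by (destruct lam; simpl; ring).
assert (Hx : s * (Cmod lam * Cmod lam) < 2 * Re lam).
{ replace (2 * Re lam) with (2 * Re lam / (Cmod lam * Cmod lam) * (Cmod lam * Cmod lam)) by (field; lra).
  apply Rmult_lt_compat_r; auto. }
rewrite Cmod_sq in Hx. nra.
Qed.

(** Dilations of the direction are absorbed by [s]; in the limit the profile is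
    homogeneous of degree [- alpha]. *)
Lemma scaled_genfun_scale lam k s : 0 < k -> 0 < s ->
  scaled_genfun (RtoC k * lam) s = (RtoC (Rpower k (- alpha)) * scaled_genfun lam (k * s))%C.
Proof.
intros Hk Hs. unfold scaled_genfun. rewrite <- Rpower_mult_distr by auto.
replace (RtoC s * (RtoC k * lam))%C with (RtoC (k * s) * lam)%C by (rewrite RtoC_mult; ring).
rewrite Cmult_assoc, <- RtoC_mult, <- Rmult_assoc, <- Rpower_plus, Rplus_opp_l, Rpower_O, Rmult_1_l by auto.
reflexivity.
Qed.

Lemma scaled_genfun_one_limit : clim0 (scaled_genfun 1) 1.
Proof.
intros eps He. destruct (consistent_real_asymptotics alpha a alpha_range a_cons eps He) as [s0 [H0 K]].
exists s0. split; auto. intros s Hs. specialize (K s Hs). unfold scaled_genfun.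
replace (1 - RtoC s * 1)%C with (RtoC (1 - s)) by (rewrite RtoC_minus; ring).
rewrite genfun_real, <- RtoC_mult, <- RtoC_minus, Cmod_R. exact K.
Qed.

Lemma scaled_genfun_scaled_limit lam k l : 0 < k -> clim0 (scaled_genfun lam) l ->
  clim0 (scaled_genfun (RtoC k * lam)) (RtoC (Rpower k (- alpha)) * l).
Proof.
intros Hk H. apply clim0_ext with (fun s => RtoC (Rpower k (- alpha)) * scaled_genfun lam (k * s))%C.
- exists 1. split; [lra|]. intros s Hs. symmetry. apply scaled_genfun_scale; lra.
- apply clim0_scal, clim0_dilate; auto.
Qed.

Lemma scaled_genfun_one_bound : exists s0, 0 < s0 <= 1 /\ forall s, 0 < s < s0 ->
  0 <= Rpower s alpha * PSeries a (1 - s) <= 2.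
Proof.
destruct (consistent_real_asymptotics alpha a alpha_range a_cons 1 Rlt_0_1) as [s0 [H0 K]].
exists (Rmin s0 1). pose proof (Rmin_l s0 1). pose proof (Rmin_r s0 1).
split; [split; [apply Rmin_case; lra|auto]|]. intros s [Hs0 Hs1].
specialize (K s ltac:(lra)). apply Rabs_lt_between in K.
split; [|lra]. apply Rmult_le_pos; [left; apply Rpower_pos|apply PSeries_cm_nonneg; auto; lra].
Qed.

(** Coefficients are negated so that adding one more point in front produces the
    difference between a kernel and its approximation. *)
Fixpoint neg_points (l : list (C * R)) (s : R) : list (C * C) :=
  match l with
  | nil => nil
  | (c, b) :: l' => ((- c)%C, (1 - RtoC s * RtoC (1 + b))%C) :: neg_points l' s
  end.

Lemma neg_points_disc l : admissible l -> exists s0, 0 < s0 /\ forall s, 0 < s < s0 -> in_disc (neg_points l s).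
Proof.
induction l as [|[c b] l IH]; intros Hl.
- exists 1. split; [lra|]. intros; constructor.
- inversion Hl; subst. simpl in H1. destruct (IH H2) as [s1 [K1 K2]].
  destruct (disc_right_half (RtoC (1 + b))) as [s2 [K3 K4]]; [rewrite re_RtoC; lra|].
  exists (Rmin s1 s2). split; [apply Rmin_case; auto|]. intros s [Hs0 Hs1].
  pose proof (Rmin_l s1 s2). pose proof (Rmin_r s1 s2).
  constructor; [apply K4; lra|apply K2; lra].
Qed.

(** With [v = t s / (1 - t + t s)], which lies in [0, 1], the kernel at
    [1 - s (1 + b)] is [1 / (1 + b v)] times the kernel at [1 - s]. *)
Lemma neg_points_kernel l t s : admissible l -> 0 <= t <= 1 -> 0 < s ->
  point_comb (kernel t) (neg_points l s)
   = (- (RtoC (/ (1 - t + t * s)) * kernel_comb l (t * s / (1 - t + t * s))))%C.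
Proof.
intros Hl Ht Hs. pose proof (mix_pos t s Ht Hs) as Hp. set (D := 1 - t + t * s) in *.
set (v := t * s / D).
assert (Hv : 0 <= v <= 1) by (apply mix_ratio_bounds; auto).
induction l as [|[c b] l IH]; simpl; [ring|].
inversion Hl; subst. simpl in H1. rewrite IH by auto.
pose proof (one_plus_mul_pos b v H1 Hv) as Hb.
assert (E : kernel t (1 - RtoC s * RtoC (1 + b)) = (RtoC (/ D) * / RtoC (1 + b * v))%C).
{ unfold kernel. replace (1 - RtoC t * (1 - RtoC s * RtoC (1 + b)))%C with (RtoC (D * (1 + b * v))).
  - rewrite RtoC_mult. rewrite RtoC_inv by lra. field. split; intros X; apply RtoC_inj in X; lra.
  - replace (D * (1 + b * v)) with (1 - t * (1 - s * (1 + b))) by (unfold v, D in *; field; lra).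
    rewrite !RtoC_minus, !RtoC_mult, RtoC_minus, RtoC_mult. reflexivity. }
rewrite E. unfold Cdiv. ring.
Qed.

Lemma neg_points_limit l : admissible l ->
  exists L, clim0 (fun s => RtoC (Rpower s alpha) * point_comb (genfun a) (neg_points l s))%C L.
Proof.
induction l as [|[c b] l IH]; intros Hl.
- exists (RtoC 0). simpl. intros eps He. exists 1. split; [lra|]. intros s Hs.
  replace (RtoC (Rpower s alpha) * 0 - 0)%C with (RtoC 0) by ring. rewrite Cmod_0; auto.
- inversion Hl; subst. simpl in H1. destruct (IH H2) as [L HL].
  exists (- c * (RtoC (Rpower (1 + b) (- alpha)) * 1) + L)%C.
  apply clim0_ext with (fun s => (- c) * scaled_genfun (RtoC (1 + b) * 1) s
      + RtoC (Rpower s alpha) * point_comb (genfun a) (neg_points l s))%C.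
  + exists 1. split; [lra|]. intros s _. simpl. unfold scaled_genfun. rewrite Cmult_1_r. ring.
  + apply clim0_plus; auto. apply clim0_scal, scaled_genfun_scaled_limit; [lra|]. apply scaled_genfun_one_limit.
Qed.

Lemma positivity_at s l eps : 0 < s <= 1 -> 0 <= eps -> in_disc l ->
  (forall t, 0 <= t <= 1 -> Cmod (point_comb (kernel t) l) <= eps / (1 - t + t * s)) ->
  Cmod (point_comb (genfun a) l) <= eps * PSeries a (1 - s).
Proof.
intros Hs He Hl H. apply positivity_principle; auto; [lra|].
intros t Ht. rewrite real_denominator. auto.
Qed.

Lemma scaled_positivity_at s l eps : 0 < s <= 1 -> 0 <= eps -> in_disc l ->
  0 <= Rpower s alpha * PSeries a (1 - s) <= 2 ->
  (forall t, 0 <= t <= 1 -> Cmod (point_comb (kernel t) l) <= eps / (1 - t + t * s)) ->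
  Cmod (RtoC (Rpower s alpha) * point_comb (genfun a) l) <= 2 * eps.
Proof.
intros Hs He Hl Hb H. pose proof (Rpower_pos s alpha) as Hp.
rewrite Cmod_mult, Cmod_R, Rabs_pos_eq by lra.
apply Rle_trans with (Rpower s alpha * (eps * PSeries a (1 - s))).
- apply Rmult_le_compat_l; [lra|]. apply positivity_at; auto.
- nra.
Qed.

(** Only real directions are covered by consistency.  The complex kernel is, up to
    [eps / 4] times the real one, a fixed combination of real kernels; by
    positivity the same holds for [genfun a], so [scaled_genfun lam] is eventually
    within [eps] of a convergent function. *)
Lemma scaled_genfun_limit_near_one lam : Cmod (lam - 1) < 1 -> exists l, clim0 (scaled_genfun lam) l.
Proof.
intros Hlam. set (mu := (lam - 1)%C) in *.
assert (Hre : 0 < Re lam).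
{ pose proof (re_le_Cmod mu) as H. apply Rabs_le_between in H.
  replace (Re mu) with (Re lam - 1) in H by (unfold mu; destruct lam; simpl; ring). lra. }
apply clim0_cauchy. intros eps He.
destruct (approximable_complex_kernel mu Hlam (eps / 4)) as [l [Hl Happ]]; [lra|].
destruct (neg_points_limit l Hl) as [L HL].
destruct (HL (eps / 2)) as [s1 [K1 K1']]; [lra|].
destruct (neg_points_disc l Hl) as [s2 [K2 K2']].
destruct (disc_right_half lam Hre) as [s3 [K3 K3']].
destruct scaled_genfun_one_bound as [s4 [K4 K4']].
exists (- L)%C, (Rmin (Rmin s1 s2) (Rmin s3 s4)).
split; [repeat apply Rmin_case; lra|]. intros s [Hs0 Hs1].
pose proof (lt_Rmin4 _ _ _ _ _ Hs1) as Hs.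
specialize (K1' s ltac:(lra)). specialize (K2' s ltac:(lra)).
specialize (K3' s ltac:(lra)). specialize (K4' s ltac:(lra)).
assert (HB : Cmod (RtoC (Rpower s alpha) * point_comb (genfun a) ((RtoC 1, (1 - RtoC s * lam)%C)
  :: neg_points l s)) <= 2 * (eps / 4)).
{ apply scaled_positivity_at; auto; try lra; [constructor; auto|].
  intros t Ht. pose proof (mix_pos t s Ht Hs0) as Hp.
  simpl. rewrite neg_points_kernel by (auto; lra).
  set (D := 1 - t + t * s) in *. set (v := t * s / D).
  assert (Hv : 0 <= v <= 1) by (apply mix_ratio_bounds; auto).
  assert (HDn : RtoC D <> RtoC 0) by (intros X; apply RtoC_inj in X; lra).
  assert (Hmv : (1 + mu * RtoC v <> 0)%C).
  { apply Cmod_gt_0. pose proof (one_minus_Cmod (- (mu * RtoC v))) as X.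
    rewrite Cmod_opp, Cmod_mult, Cmod_R, Rabs_pos_eq in X by lra.
    replace (1 - - (mu * RtoC v))%C with (1 + mu * RtoC v)%C in X by ring.
    pose proof (Cmod_ge_0 mu). nra. }
  assert (E : kernel t (1 - RtoC s * lam) = (RtoC (/ D) * / (1 + mu * RtoC v))%C).
  { unfold kernel. replace (1 - RtoC t * (1 - RtoC s * lam))%C with (RtoC D * (1 + mu * RtoC v))%C.
    - rewrite RtoC_inv by lra. field. auto.
    - transitivity (RtoC D + mu * RtoC (D * v))%C; [rewrite RtoC_mult; ring|].
      replace (D * v) with (t * s) by (unfold v; field; lra).
      unfold D, mu. rewrite RtoC_plus, RtoC_minus, RtoC_mult. ring. }
  rewrite E.
  replace (1 * (RtoC (/ D) * / (1 + mu * RtoC v)) + - (RtoC (/ D) * kernel_comb l v))%C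
    with (RtoC (/ D) * (/ (1 + mu * RtoC v) - kernel_comb l v))%C by ring.
  rewrite Cmod_mult, Cmod_R, Rabs_pos_eq by (apply Rlt_le, Rinv_0_lt_compat; auto).
  unfold Rdiv. rewrite (Rmult_comm (eps * / 4)).
  apply Rmult_le_compat_l; [apply Rlt_le, Rinv_0_lt_compat; auto|]. apply (Happ v Hv). }
simpl in HB.
replace (scaled_genfun lam s - - L)%C
 with ((RtoC (Rpower s alpha) * (1 * genfun a (1 - RtoC s * lam) + point_comb (genfun a) (neg_points l s)))
    + - (RtoC (Rpower s alpha) * point_comb (genfun a) (neg_points l s) - L))%C
      by (unfold scaled_genfun; ring).
eapply Rle_trans; [apply Cmod_triangle|]. rewrite Cmod_opp. lra.
Qed.

(** Homogeneity: every [lam] in the right half plane is a positive multiple of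
    some point at distance less than 1 from 1. *)
Lemma scaled_genfun_limit lam : 0 < Re lam -> exists l, clim0 (scaled_genfun lam) l.
Proof.
intros H. (* The disc of centre and radius R0 contains lam. *)
set (R0 := (Cmod lam * Cmod lam) / Re lam).
assert (Hm : 0 < Cmod lam).
{ apply Cmod_gt_0. intros E. rewrite E in H. simpl in H. lra. }
assert (HR : 0 < R0) by (apply Rdiv_lt_0_compat; auto; apply Rmult_lt_0_compat; auto).
destruct (scaled_genfun_limit_near_one (RtoC (/ R0) * lam)) as [l Hl].
- apply Cmod_lt_of_sq; [lra|].
  replace (Re (RtoC (/ R0) * lam - 1)) with (/ R0 * Re lam - 1) by (destruct lam; simpl; ring).
  replace (Im (RtoC (/ R0) * lam - 1)) with (/ R0 * Im lam) by (destruct lam; simpl; ring).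
  replace ((/ R0 * Re lam - 1) * (/ R0 * Re lam - 1) + / R0 * Im lam * (/ R0 * Im lam))
   with (/ R0 * / R0 * (Re lam * Re lam + Im lam * Im lam) - 2 * / R0 * Re lam + 1) by ring.
  rewrite <- Cmod_sq.
  replace (Cmod lam * Cmod lam) with (R0 * Re lam) at 1 by (unfold R0; field; lra).
  replace (/ R0 * / R0 * (R0 * Re lam) - 2 * / R0 * Re lam + 1) with (1 - / R0 * Re lam) by (field; lra).
  assert (0 < / R0 * Re lam) by (apply Rmult_lt_0_compat; [apply Rinv_0_lt_compat; auto|auto]). lra.
- exists (RtoC (Rpower R0 (- alpha)) * l)%C.
  replace lam with (RtoC R0 * (RtoC (/ R0) * lam))%C.
  + apply scaled_genfun_scaled_limit; auto.
  + rewrite Cmult_assoc, <- RtoC_mult, Rinv_r by lra. ring.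
Qed.

Lemma limit_bound phi l : 0 <= phi < PI / 2 -> clim0 (scaled_genfun (cis phi)) l -> Cmod l <= 4.
Proof.
intros Hphi. apply clim0_bound.
assert (Hc : 0 < cos phi) by (apply cos_gt_0; lra).
destruct (disc_right_half (cis phi) Hc) as [s3 [K3 K3']].
destruct scaled_genfun_one_bound as [s4 [K4 K4']].
exists (Rmin s3 s4). split; [apply Rmin_case; lra|]. intros s [Hs0 Hs1].
pose proof (Rmin_l s3 s4). pose proof (Rmin_r s3 s4).
specialize (K3' s ltac:(lra)). specialize (K4' s ltac:(lra)).
pose proof (scaled_positivity_at s ((RtoC 1, (1 - RtoC s * cis phi)%C) :: nil) 2) as HP.
simpl in HP. unfold scaled_genfun.
replace (genfun a (1 - RtoC s * cis phi)) with (1 * genfun a (1 - RtoC s * cis phi) + 0)%C by ring.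
replace 4 with (2 * 2) by ring. apply HP; auto; try lra.
- constructor; [auto|constructor].
- intros t Ht. replace (1 * kernel t (1 - RtoC s * cis phi) + 0)%C
  with (kernel t (1 - RtoC s * cis phi)) by ring.
  pose proof (kernel_bound t (RtoC s * cis phi) Ht) as HK. rewrite Cmod_scaled_cis in HK by lra.
  apply HK.
  + rewrite re_scal_l, Re_cis. apply Rmult_le_pos; lra.
  + apply Cmod_gt_0. rewrite Cmod_scaled_cis; lra.
Qed.

Lemma Rpower_expansion eta : 0 < eta <= / 4 ->
  Rabs (Rpower (1 - eta) (- alpha) - 1 - alpha * eta) <= 4 * eta ^ 2.
Proof.
intros He. destruct (ln_one_minus_bounds eta ltac:(lra)) as [L1 L2].
set (y := - alpha * ln (1 - eta)).
change (Rpower (1 - eta) (- alpha)) with (exp y).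
set (L := - ln (1 - eta)) in *.
assert (Hy : y = alpha * L) by (unfold y, L; ring).
assert (HL : L <= eta + 4 / 3 * eta ^ 2).
{ apply Rle_trans with (1 := L2). apply Rle_div_l; [lra|]. nra. }
assert (Hy1 : alpha * eta <= y) by (rewrite Hy; apply Rmult_le_compat_l; lra).
assert (Hy2 : y <= alpha * eta + 4 / 3 * eta ^ 2) by (rewrite Hy; nra).
assert (Hy3 : 0 <= y <= 4 / 3 * eta).
{ split; [nra|]. rewrite Hy. assert (L <= 4 / 3 * eta) by nra. nra. }
pose proof (exp_ineq1_le y) as E1.
assert (E2 : exp y <= / (1 - y)).
{ rewrite <- (Ropp_involutive y) at 1. rewrite exp_Ropp. apply Rinv_le_contravar; [lra|].
  pose proof (exp_ineq1_le (- y)). lra. }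
assert (E3 : / (1 - y) <= 1 + y + 3 / 2 * y ^ 2).
{ apply Rmult_le_reg_r with (1 - y); [lra|]. rewrite Rinv_l by lra.
  assert (0 <= y ^ 2 * (/ 2 - 3 / 2 * y)); [|lra]. apply Rmult_le_pos; [apply pow2_ge_0|lra]. }
assert (Hysq : y ^ 2 <= 16 / 9 * eta ^ 2).
{ replace (16 / 9 * eta ^ 2) with ((4 / 3 * eta) ^ 2) by field. apply pow_incr; lra. }
rewrite Rabs_pos_eq by lra. lra.
Qed.

(** The contracted direction has the limit [(1 - eta) ^ - alpha * l] by
    homogeneity, so the discrete Cauchy-Riemann equation determines the rotated
    limit up to order [eta ^ 2]. *)
Lemma rotation_step phi eta l l' :
  0 <= phi -> 0 < eta <= / 4 -> phi + eta < PI / 2 ->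
  clim0 (scaled_genfun (cis phi)) l -> clim0 (scaled_genfun (cis (phi + eta))) l' ->
  Cmod (l' - cis (- (alpha * eta)) * l) <= 130 * eta ^ 2.
Proof.
intros Hphi He Hlt Hl Hl'.
set (p := Rpower (1 - eta) (- alpha)).
pose proof (scaled_genfun_scaled_limit (cis phi) (1 - eta) l ltac:(lra) Hl) as Hl2. fold p in Hl2.
assert (HCR : Cmod (l' + (- (1)) * l + Ci * (RtoC p * l + (- (1)) * l)) <= 2 * (52 * eta ^ 2)).
{ apply (clim0_bound (fun s => scaled_genfun (cis (phi + eta)) s + (- (1)) * scaled_genfun (cis phi) s
     + Ci * (scaled_genfun (RtoC (1 - eta) * cis phi) s + (- (1)) * scaled_genfun (cis phi) s))%C).
  2:{ repeat (apply clim0_plus || apply clim0_scal); auto. }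
  assert (Hc : 0 < cos phi) by (apply cos_gt_0; lra).
  assert (Hc' : 0 < cos (phi + eta)) by (apply cos_gt_0; lra).
  destruct (disc_right_half (cis phi) Hc) as [s1 [K1 K1']].
  destruct (disc_right_half (cis (phi + eta)) Hc') as [s2 [K2 K2']].
  destruct (disc_right_half (RtoC (1 - eta) * cis phi)) as [s3 [K3 K3']].
  { rewrite re_scal_l, Re_cis. apply Rmult_lt_0_compat; lra. }
  destruct scaled_genfun_one_bound as [s4 [K4 K4']].
  exists (Rmin (Rmin s1 s2) (Rmin s3 s4)).
  split; [repeat apply Rmin_case; lra|]. intros s [Hs0 Hs1].
  pose proof (lt_Rmin4 _ _ _ _ _ Hs1) as Hs.
  specialize (K1' s ltac:(lra)). specialize (K2' s ltac:(lra)).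
specialize (K3' s ltac:(lra)). specialize (K4' s ltac:(lra)).
  assert (Esh : (RtoC s * (RtoC (1 - eta) * cis phi))%C = (RtoC (s * (1 - eta)) * cis phi)%C)
    by (rewrite RtoC_mult; ring).
  set (pts := (RtoC 1, (1 - RtoC s * cis (phi + eta))%C) :: ((- (1))%C, (1 - RtoC s * cis phi)%C)
     :: (Ci, (1 - RtoC (s * (1 - eta)) * cis phi)%C) :: ((- Ci)%C, (1 - RtoC s * cis phi)%C) :: nil).
  replace (scaled_genfun (cis (phi + eta)) s + (- (1)) * scaled_genfun (cis phi) s
     + Ci * (scaled_genfun (RtoC (1 - eta) * cis phi) s + (- (1)) * scaled_genfun (cis phi) s))%C
   with (RtoC (Rpower s alpha) * point_comb (genfun a) pts)%C.
  2:{ unfold pts, scaled_genfun. simpl. rewrite Esh. ring. }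
  apply scaled_positivity_at; auto; try lra; [nra| |].
  - rewrite Esh in K3'. unfold pts. repeat (constructor; [assumption|]). constructor.
  - intros t Ht.
    pose proof (kernel_cauchy_riemann t s phi eta Ht Hs0 Hphi ltac:(lra) Hlt) as HK.
    unfold pts. simpl.
    match goal with |- Cmod ?u <= _ => match type of HK with Cmod ?v <= _ => replace u with v end end;
     [exact HK|]. ring. }
pose proof (limit_bound phi l ltac:(lra) Hl) as Hlb.
assert (Hae : 0 < alpha * eta <= eta) by nra.
pose proof (cis_expansion (alpha * eta) ltac:(lra)) as Hcis.
pose proof (Rpower_expansion eta He) as Hpe. fold p in Hpe.
replace (l' - cis (- (alpha * eta)) * l)%C
 with ((l' + (- (1)) * l + Ci * (RtoC p * l + (- (1)) * l))
   + (- (Ci * RtoC (p - 1 - alpha * eta)) + - Cconj (cis (alpha * eta) - 1 - Ci * RtoC (alpha * eta))) * l)%C.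
2:{ rewrite !Cminus_conj, Cmult_conj, cis_conj.
    replace (Cconj 1) with (RtoC 1) by (symmetry; apply Cconj_RtoC).
    replace (Cconj Ci) with (- Ci)%C by (unfold Cconj, Ci, Copp; simpl; f_equal; ring).
    replace (Cconj (RtoC (alpha * eta))) with (RtoC (alpha * eta)) by (symmetry; apply Cconj_RtoC).
    rewrite !RtoC_minus. ring. }
eapply Rle_trans; [apply Cmod_triangle|].
rewrite (Cmod_mult _ l).
assert (HX : Cmod (- (Ci * RtoC (p - 1 - alpha * eta))
  + - Cconj (cis (alpha * eta) - 1 - Ci * RtoC (alpha * eta))) <= 5 * eta ^ 2).
{ eapply Rle_trans; [apply Cmod_triangle|].
  rewrite !Cmod_opp, Cmod_conj, Cmod_mult, Cmod_Ci, Cmod_R.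
  assert ((alpha * eta) ^ 2 <= eta ^ 2) by (apply pow_incr; lra). lra. }
pose proof (Cmod_ge_0 l). pose proof (pow2_ge_0 eta).
assert (Cmod (- (Ci * RtoC (p - 1 - alpha * eta))
  + - Cconj (cis (alpha * eta) - 1 - Ci * RtoC (alpha * eta))) * Cmod l
   <= 5 * eta ^ 2 * 4) by (apply Rmult_le_compat; auto; apply Cmod_ge_0).
lra.
Qed.

Lemma rotation_steps eta m l :
  0 < eta <= / 4 -> INR m * eta < PI / 2 -> clim0 (scaled_genfun (cis (INR m * eta))) l ->
  Cmod (l - cis (- (alpha * (INR m * eta)))) <= INR m * (130 * eta ^ 2).
Proof.
intros He. revert l. induction m as [|m IH]; intros l Hm Hl.
- simpl in *. rewrite Rmult_0_l, cis_0 in Hl.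
  rewrite (clim0_unique _ _ _ Hl scaled_genfun_one_limit).
  rewrite Rmult_0_l, Rmult_0_r, Ropp_0, cis_0.
  replace (1 - 1)%C with (RtoC 0) by ring. rewrite Cmod_0. lra.
- rewrite S_INR in *. pose proof (pos_INR m).
  assert (Hm0 : 0 <= INR m * eta) by (apply Rmult_le_pos; lra).
  assert (Hm' : INR m * eta < PI / 2) by lra.
  destruct (scaled_genfun_limit (cis (INR m * eta))) as [l0 Hl0].
  { rewrite Re_cis. apply cos_gt_0; lra. }
  specialize (IH l0 Hm' Hl0).
  replace ((INR m + 1) * eta) with (INR m * eta + eta) in * by ring.
  pose proof (rotation_step (INR m * eta) eta l0 l Hm0 He Hm Hl0 Hl) as Hst.
  replace (l - cis (- (alpha * (INR m * eta + eta))))%C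
   with ((l - cis (- (alpha * eta)) * l0) + cis (- (alpha * eta)) * (l0 - cis (- (alpha * (INR m * eta)))))%C.
  2:{ replace (- (alpha * (INR m * eta + eta))) with (- (alpha * eta) + - (alpha * (INR m * eta))) by ring.
      rewrite cis_plus. ring. }
  eapply Rle_trans; [apply Cmod_triangle|]. rewrite Cmod_mult, Cmod_cis. lra.
Qed.

(** [N] rotations by [phi / N] accumulate an error of order [1 / N] only. *)
Lemma scaled_genfun_cis_limit phi : 0
  <= phi < PI / 2 -> clim0 (scaled_genfun (cis phi)) (cis (- (alpha * phi))).
Proof.
intros Hphi. destruct (scaled_genfun_limit (cis phi)) as [l Hl].
{ rewrite Re_cis. apply cos_gt_0; lra. }
replace (cis (- (alpha * phi))) with l; [auto|].
destruct (Req_dec phi 0) as [E|E].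
- rewrite E in *. rewrite cis_0 in Hl. rewrite (clim0_unique _ _ _ Hl scaled_genfun_one_limit).
  rewrite Rmult_0_r, Ropp_0, cis_0. reflexivity.
- apply cnull_const_eq. intros eps Heps. exists O. intros _ _.
  destruct (INR_unbounded (4 * phi + 130 * phi ^ 2 / eps)) as [N HN].
  assert (HN0 : 0 <= 130 * phi ^ 2 / eps) by (apply Rdiv_le_0_compat; nra).
  assert (HNp : 0 < INR N) by lra.
  set (eta := phi / INR N).
  assert (HNe : INR N * eta = phi) by (unfold eta; field; lra).
  assert (Heta : 0 < eta <= / 4).
  { split; [apply Rdiv_lt_0_compat; lra|]. apply Rmult_le_reg_l with (INR N); [auto|]. rewrite HNe. lra. }
  pose proof (rotation_steps eta N l Heta) as Hr. rewrite HNe in Hr. specialize (Hr ltac:(lra) Hl).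
  apply Rle_lt_trans with (1 := Hr).
  replace (INR N * (130 * eta ^ 2)) with (130 * phi ^ 2 / INR N) by (unfold eta; field; lra).
  apply Rlt_div_l; [auto|].
  apply Rmult_lt_reg_r with (/ eps); [apply Rinv_0_lt_compat; auto|].
  replace (eps * INR N * / eps) with (INR N) by (field; lra).
  unfold Rdiv in HN. lra.
Qed.

Lemma scaled_genfun_grid eta N eps : 0 < eta -> 0 < eps -> exists s0, 0 < s0 /\
  forall m s, (m < N)%nat -> INR m * eta < PI / 2 -> 0 < s < s0 ->
    Cmod (scaled_genfun (cis (INR m * eta)) s - cis (- (alpha * (INR m * eta)))) < eps.
Proof.
intros He Heps. induction N as [|N [s0 [H0 K0]]].
- exists 1. split; [lra|]. intros m s Hm; lia.
- destruct (Rlt_dec (INR N * eta) (PI / 2)) as [Hlt|Hge].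
  + assert (HN : 0 <= INR N * eta) by (apply Rmult_le_pos; [apply pos_INR|lra]).
    destruct (scaled_genfun_cis_limit (INR N * eta) (conj HN Hlt) eps Heps) as [s1 [H1 K1]].
    exists (Rmin s0 s1). split; [apply Rmin_case; auto|]. intros m s Hm Hma [Hs0 Hs1].
    pose proof (Rmin_l s0 s1). pose proof (Rmin_r s0 s1).
    destruct (Nat.eq_dec m N) as [->|Hn]; [apply K1; lra|apply K0; [lia|auto|lra]].
  + exists s0. split; auto. intros m s Hm Hma Hs.
    destruct (Nat.eq_dec m N) as [->|Hn]; [lra|apply K0; [lia|auto|lra]].
Qed.

(** Directions between two grid points are handled by the Lipschitz bound on the
    kernel.  The grid point is taken below [phi], because turning towards the
    real axis does not leave the disc; this reaches up to tangential
    approach. *)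
Lemma scaled_genfun_uniform eps : 0 < eps -> exists s0, 0 < s0 /\
  forall s phi, 0 < s < s0 -> 0 <= phi < PI / 2 -> Cmod (1 - RtoC s * cis phi) < 1 ->
    Cmod (scaled_genfun (cis phi) s - cis (- (alpha * phi))) <= eps.
Proof.
intros Heps. pose proof PI_RGT_0 as HPI.
set (eta := Rmin (/ 2) (eps / 40)).
assert (Heta : 0 < eta /\ eta <= / 2 /\ eta <= eps / 40).
{ unfold eta. repeat split; [apply Rmin_case; lra|apply Rmin_l|apply Rmin_r]. }
destruct (INR_unbounded (PI / 2 / eta)) as [N HN].
destruct (scaled_genfun_grid eta N (eps / 4)) as [s1 [H1 K1]]; [lra|lra|].
destruct scaled_genfun_one_bound as [s4 [K4 K4']].
exists (Rmin s1 s4). split; [apply Rmin_case; lra|]. intros s phi [Hs0 Hs1] Hphi Hdisc.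
pose proof (Rmin_l s1 s4). pose proof (Rmin_r s1 s4). specialize (K4' s ltac:(lra)).
destruct (nfloor_ex (phi / eta)) as [m [Hm1 Hm2]]; [apply Rdiv_le_0_compat; lra|].
set (psi := INR m * eta).
assert (Hpsi : psi <= phi < psi + eta).
{ unfold psi. replace phi with (phi / eta * eta) by (field; lra). split.
  - apply Rmult_le_compat_r; lra.
  - replace (INR m * eta + eta) with ((INR m + 1) * eta) by ring. apply Rmult_lt_compat_r; lra. }
assert (Hpsi0 : 0 <= psi) by (apply Rmult_le_pos; [apply pos_INR|lra]).
assert (HmN : (m < N)%nat).
{ apply INR_lt. apply Rle_lt_trans with (phi / eta); [auto|]. apply Rlt_trans with (2 := HN).
  unfold Rdiv at 1 2. apply Rmult_lt_compat_r; [apply Rinv_0_lt_compat|]; lra. }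
specialize (K1 m s HmN ltac:(fold psi; lra) ltac:(lra)). fold psi in K1.
assert (Hcos : cos phi <= cos psi) by (apply cos_decr_1; lra).
assert (Hcp : 0 <= cos phi) by (apply cos_ge_0; lra).
assert (Hdisc' : Cmod (1 - RtoC s * cis psi) < 1).
{ assert (E : forall x, Cmod (1 - RtoC s * cis x) * Cmod (1 - RtoC s * cis x) = 1 - 2 * s * cos x + s * s).
  { intros x. rewrite Cmod_sq.
    replace (Re (1 - RtoC s * cis x)) with (1 - s * cos x) by (simpl; ring).
    replace (Im (1 - RtoC s * cis x)) with (- (s * sin x)) by (simpl; ring).
    pose proof (sin2_cos2 x). unfold Rsqr in H2. nra. }
  pose proof (E phi). pose proof (E psi). pose proof (Cmod_ge_0 (1 - RtoC s * cis phi)).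
  pose proof (Cmod_ge_0 (1 - RtoC s * cis psi)).
  assert (s * cos phi <= s * cos psi) by (apply Rmult_le_compat_l; lra). nra. }
set (del := phi - psi).
assert (Hrot : Cmod (cis phi - cis psi) <= 2 * eta).
{ replace phi with (psi + del) by (unfold del; ring). rewrite cis_plus.
  replace (cis psi * cis del - cis psi)%C with (cis psi * (cis del - 1))%C by ring.
  rewrite Cmod_mult, Cmod_cis, Rmult_1_l.
  eapply Rle_trans; [apply cis_minus_one; unfold del; lra|]. unfold del; lra. }
assert (Hlip : Cmod (scaled_genfun (cis phi) s - scaled_genfun (cis psi) s) <= 2 * (8 * eta)).
{ pose proof (scaled_positivity_at s ((RtoC 1, (1 - RtoC s * cis phi)%C)
     :: ((- (1))%C, (1 - RtoC s * cis psi)%C) :: nil) (8 * eta)) as HP.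
  replace (scaled_genfun (cis phi) s - scaled_genfun (cis psi) s)%C with (RtoC (Rpower s alpha) *
     point_comb (genfun a) ((RtoC 1, (1 - RtoC s * cis phi)%C)
       :: ((- (1))%C, (1 - RtoC s * cis psi)%C) :: nil))%C.
  2:{ unfold scaled_genfun; simpl. ring. }
  apply HP; auto; try lra.
  - repeat (constructor; [assumption|]). constructor.
  - intros t Ht. simpl.
    replace (1 * kernel t (1 - RtoC s * cis phi) + (- (1) * kernel t (1 - RtoC s * cis psi) + 0))%C
     with (kernel t (1 - RtoC s * cis phi) - kernel t (1 - RtoC s * cis psi))%C by ring.
    pose proof (kernel_lipschitz t (RtoC s * cis phi) (RtoC s * cis psi) Ht) as HK.
    rewrite !Cmod_scaled_cis in HK by lra.
    eapply Rle_trans; [apply HK; auto|].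
    + rewrite re_scal_l, Re_cis. apply Rmult_le_pos; lra.
    + rewrite re_scal_l, Re_cis. apply Rmult_le_pos; lra.
    + apply Cmod_gt_0. rewrite Cmod_scaled_cis; lra.
    + unfold Rdiv. apply Rmult_le_compat_r; [apply Rlt_le, Rinv_0_lt_compat, mix_pos; lra|].
      replace (RtoC s * cis psi - RtoC s * cis phi)%C with (- (RtoC s * (cis phi - cis psi)))%C by ring.
      rewrite Cmod_opp, Cmod_mult, Cmod_R, Rabs_pos_eq by lra.
      replace (s * Cmod (cis phi - cis psi) * / s) with (Cmod (cis phi - cis psi)) by (field; lra). lra. }
assert (Hrot2 : Cmod (cis (- (alpha * psi)) - cis (- (alpha * phi))) <= 2 * eta).
{ replace (- (alpha * psi)) with (- (alpha * phi) + alpha * del) by (unfold del; ring). rewrite cis_plus.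
  replace (cis (- (alpha * phi)) * cis (alpha * del) - cis (- (alpha * phi)))%C
    with (cis (- (alpha * phi)) * (cis (alpha * del) - 1))%C by ring.
  rewrite Cmod_mult, Cmod_cis, Rmult_1_l.
  assert (0 <= del <= eta) by (unfold del; lra).
  eapply Rle_trans; [apply cis_minus_one; nra|]. nra. }
replace (scaled_genfun (cis phi) s - cis (- (alpha * phi)))%C
 with ((scaled_genfun (cis phi) s - scaled_genfun (cis psi) s)
   + ((scaled_genfun (cis psi) s - cis (- (alpha * psi)))
   + (cis (- (alpha * psi)) - cis (- (alpha * phi)))))%C by ring.
eapply Rle_trans; [apply Cmod_triangle|].
eapply Rle_trans; [apply Rplus_le_compat_l, Cmod_triangle|]. lra.
Qed.

End Asymptotics.

(** * Values of the generating function of omega near 0 *)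

Lemma polar_abs_arg z : z <> RtoC 0 ->
  0 <= Rabs (Carg z) <= PI /\ Re z = Cmod z * cos (Rabs (Carg z)) /\
  Rabs (Im z) = Cmod z * sin (Rabs (Carg z)).
Proof.
intros Hz. destruct (Carg_spec z Hz) as [Hb [Hr Hi]].
assert (Hm : 0 < Cmod z) by (apply Cmod_gt_0; auto).
assert (Hab : 0 <= Rabs (Carg z) <= PI) by (split; [apply Rabs_pos|apply Rabs_le; lra]).
split; [auto|].
assert (Hc : cos (Rabs (Carg z)) = cos (Carg z)).
{ unfold Rabs; destruct (Rcase_abs (Carg z)); [apply cos_neg|reflexivity]. }
rewrite Hc. split; [auto|].
assert (Hs : 0 <= sin (Rabs (Carg z))) by (apply sin_ge_0; lra).
rewrite Hi, Rabs_mult, (Rabs_pos_eq (Cmod z)) by lra. f_equal.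
destruct (Rle_lt_dec 0 (Carg z)) as [H|H].
- rewrite (Rabs_pos_eq (Carg z)) in * by auto. apply Rabs_pos_eq; auto.
- rewrite (Rabs_left (Carg z)) in * by auto. rewrite sin_neg in *. apply Rabs_left1. lra.
Qed.

Lemma genfun_conj a z : genfun a (Cconj z) = Cconj (genfun a z).
Proof.
assert (E : forall n, (cseq a n * Cconj z ^ n)%C = Cconj (cseq a n * z ^ n)).
{ intros n. rewrite Cmult_conj, Cpow_conj. f_equal. symmetry. apply Cconj_RtoC. }
apply injective_projections.
- change (Series (fun n => Re (cseq a n * Cconj z ^ n)%C) = Series (fun n => Re (cseq a n * z ^ n)%C)).
  apply Series_ext. intros n. rewrite E. apply re_conj.
- change (Series (fun n => Im (cseq a n * Cconj z ^ n)%C) = - Series (fun n => Im (cseq a n * z ^ n)%C)).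
  rewrite <- Series_opp. apply Series_ext. intros n. rewrite E. apply im_conj.
Qed.

Lemma Re_pos_of_disc z : Cmod z < 1 -> 0 < Re (1 - z).
Proof.
intros Hz. pose proof (re_le_Cmod z) as H. apply Rabs_le_between in H.
replace (Re (1 - z)) with (1 - Re z) by (destruct z; simpl; ring). lra.
Qed.

Section Final.
Variables (alpha : R) (omega a : nat -> R).
Hypothesis alpha_range : 0 < alpha < 1.
Hypothesis omega_a : is_conv_inverse omega a.
Hypothesis a_cm : CM_preserving alpha a.

(** Near 1 the argument of [genfun a (1 - s * cis phi)] is [- alpha * phi] up to a
    small error, and [phi < PI / 2] in the disc. *)
Lemma genfun_sector_upper gamma : alpha * PI / 2 < gamma < PI / 2 ->
  exists s0, 0 < s0 /\ forall z, Cmod z < 1 -> Cmod (1 - z) < s0 -> 0 <= Im (1 - z) ->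
    Rabs (Im (genfun a z)) * cos gamma <= Re (genfun a z) * sin gamma.
Proof.
intros Hg. pose proof PI_RGT_0 as HPI.
set (e := sin (gamma - alpha * PI / 2)).
assert (Hap : 0 < alpha * PI / 2) by (assert (0 < alpha * PI) by (apply Rmult_lt_0_compat; lra); lra).
assert (He : 0 < e) by (apply sin_gt_0; lra).
destruct (scaled_genfun_uniform alpha a alpha_range (proj1 a_cm) (proj2 a_cm) (e / 2)) as [s0 [H0 K]]; [lra|].
exists s0. split; auto. intros z Hz Hs Him.
pose proof (Re_pos_of_disc z Hz) as Hre.
set (tau := (1 - z)%C) in *.
assert (Hnz : tau <> RtoC 0) by (intros E; rewrite E in Hre; simpl in Hre; lra).
assert (Hm : 0 < Cmod tau) by (apply Cmod_gt_0; auto).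
destruct (polar_abs_arg tau Hnz) as [Hb [Hr Hi]]. set (phi := Rabs (Carg tau)) in *.
rewrite Rabs_pos_eq in Hi by auto.
assert (Htau : tau = (RtoC (Cmod tau) * cis phi)%C).
{ apply injective_projections.
  - change (Re tau = Re (RtoC (Cmod tau) * cis phi)). rewrite re_scal_l. exact Hr.
  - change (Im tau = Im (RtoC (Cmod tau) * cis phi)). rewrite Hi. simpl. ring. }
assert (Hphi : phi < PI / 2).
{ apply Rnot_le_lt. intros Hle. assert (cos phi <= 0) by (apply cos_le_0; lra). nra. }
assert (Hzt : (1 - RtoC (Cmod tau) * cis phi)%C = z) by (rewrite <- Htau; unfold tau; ring).
specialize (K (Cmod tau) phi ltac:(lra) ltac:(lra)). rewrite Hzt in K. specialize (K Hz).
unfold scaled_genfun in K. rewrite Hzt in K.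
set (p := Rpower (Cmod tau) alpha) in *. assert (Hp : 0 < p) by apply Rpower_pos.
set (err := (RtoC p * genfun a z - cis (- (alpha * phi)))%C) in *.
assert (HA : (RtoC p * genfun a z)%C = (cis (- (alpha * phi)) + err)%C) by (unfold err; ring).
assert (HR : p * Re (genfun a z) = cos (alpha * phi) + Re err).
{ rewrite <- re_scal_l, HA, re_plus, Re_cis, cos_neg. reflexivity. }
assert (HI : p * Im (genfun a z) = - sin (alpha * phi) + Im err).
{ replace (p * Im (genfun a z)) with (Im (RtoC p * genfun a z)) by (simpl; ring).
  rewrite HA, im_plus, Im_cis, sin_neg. reflexivity. }
pose proof (re_le_Cmod err) as B1. pose proof (im_le_Cmod err) as B2.
assert (Hq : 0 <= alpha * phi <= alpha * PI / 2).
{ split; [apply Rmult_le_pos; lra|]. replace (alpha * PI / 2) with (alpha * (PI / 2)) by field.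
  apply Rmult_le_compat_l; lra. }
assert (Hsin : 0 <= sin (alpha * phi)) by (apply sin_ge_0; lra).
assert (Hcg : 0 < cos gamma) by (apply cos_gt_0; lra).
assert (Hsg : 0 < sin gamma) by (apply sin_gt_0; lra).
assert (HsI : p * Rabs (Im (genfun a z)) <= sin (alpha * phi) + e / 2).
{ rewrite <- (Rabs_pos_eq p) by lra. rewrite <- Rabs_mult, HI.
  eapply Rle_trans; [apply Rabs_triang|]. rewrite Rabs_Ropp, (Rabs_pos_eq (sin _)) by auto. lra. }
assert (HeS : e <= sin (gamma - alpha * phi)) by (apply sin_incr_1; lra).
rewrite sin_minus in HeS.
apply Rabs_le_between in B1.
pose proof (COS_bound gamma). pose proof (SIN_bound gamma).
apply Rmult_le_reg_l with p; [auto|].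
assert (p * Rabs (Im (genfun a z)) * cos gamma <= (sin (alpha * phi) + e / 2) * cos gamma)
  by (apply Rmult_le_compat_r; lra).
assert ((cos (alpha * phi) - e / 2) * sin gamma <= (p * Re (genfun a z)) * sin gamma)
  by (apply Rmult_le_compat_r; lra).
nra.
Qed.

Lemma genfun_sector gamma : alpha * PI / 2 < gamma < PI / 2 ->
  exists s0, 0 < s0 /\ forall z, Cmod z < 1 -> Cmod (1 - z) < s0 ->
    Rabs (Im (genfun a z)) * cos gamma <= Re (genfun a z) * sin gamma.
Proof.
intros Hg. destruct (genfun_sector_upper gamma Hg) as [s0 [H0 K]].
exists s0. split; auto. intros z Hz Hs.
destruct (Rle_lt_dec 0 (Im (1 - z))) as [Hi|Hi]; [auto|].
specialize (K (Cconj z)). rewrite Cmod_conj in K.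
replace (1 - Cconj z)%C with (Cconj (1 - z)) in K.
2:{ rewrite Cminus_conj. f_equal. apply Cconj_RtoC. }
rewrite Cmod_conj, im_conj in K. specialize (K Hz Hs ltac:(lra)).
rewrite genfun_conj, re_conj, im_conj, Rabs_Ropp in K. exact K.
Qed.

(** Positivity against the kernel at 0, which is constantly 1. *)
Lemma genfun_upper_bound z : Cmod z < 1 -> Cmod (genfun a z) * Cmod (1 - z) <= 4 * a O.
Proof.
intros Hz. pose proof (Re_pos_of_disc z Hz) as Hre. set (tau := (1 - z)%C) in *.
assert (Hnz : tau <> RtoC 0) by (intros E; rewrite E in Hre; simpl in Hre; lra).
assert (Hm : 0 < Cmod tau) by (apply Cmod_gt_0; auto).
assert (Hm2 : Cmod tau < 2).
{ unfold tau, Cminus. eapply Rle_lt_trans; [apply Cmod_triangle|]. rewrite Cmod_1, Cmod_opp. lra. }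
pose proof (positivity_principle a ((RtoC 1, z) :: nil) 0 (4 / Cmod tau) (proj2 a_cm)) as HP.
simpl in HP.
replace (1 * genfun a z + 0)%C with (genfun a z) in HP by ring.
rewrite PSeries_0 in HP.
apply Rmult_le_reg_r with (/ Cmod tau); [apply Rinv_0_lt_compat; auto|].
rewrite Rmult_assoc, Rinv_r, Rmult_1_r by lra.
replace (4 * a O * / Cmod tau) with (4 / Cmod tau * a O) by (field; lra).
apply HP; [constructor; [auto|constructor]|lra|apply Rdiv_le_0_compat; lra|].
intros t Ht. replace (1 * kernel t z + 0)%C with (kernel t (1 - tau))
  by (unfold tau; replace (1 - (1 - z))%C with z by ring; ring).
eapply Rle_trans; [apply kernel_bound; auto; lra|].
pose proof (mix_pos t (Cmod tau) Ht Hm) as Hp.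
rewrite Rmult_0_r, Rminus_0_r, Rdiv_1_r.
apply Rmult_le_reg_r with (1 - t + t * Cmod tau); [auto|].
unfold Rdiv. rewrite Rmult_assoc, Rinv_l, Rmult_1_r by lra.
replace (4 * / Cmod tau * (1 - t + t * Cmod tau)) with (4 * ((1 - t) * / Cmod tau + t)) by (field; lra).
assert (/ 2 <= / Cmod tau) by (apply Rinv_le_contravar; lra). nra.
Qed.

(** The distance is measured along the normal to the nearer edge of the sector
    [|arg| <= gamma'].  The second term of the minimum is for [zeta] so far round
    that the angle to this edge exceeds a right angle. *)
Lemma sector_distance w zeta gamma' gamma :
  0 < gamma' < gamma -> gamma < PI / 2 ->
  Rabs (Im w) * cos gamma' <= Re w * sin gamma' ->
  zeta <> RtoC 0 -> gamma <= Rabs (Carg zeta) ->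
  Cmod zeta * Rmin (sin (gamma - gamma')) (sin gamma') <= Cmod (w - zeta).
Proof.
intros Hg' Hg Hw Hz Harg. pose proof PI_RGT_0 as HPI.
destruct (polar_abs_arg zeta Hz) as [Hb [Hr Hi]]. set (chi := Rabs (Carg zeta)) in *.
assert (Hm : 0 < Cmod zeta) by (apply Cmod_gt_0; auto).
assert (Hsin : Rmin (sin (gamma - gamma')) (sin gamma') <= sin (chi - gamma')).
{ destruct (Rle_lt_dec (chi - gamma') (PI / 2)) as [H|H].
  - apply Rle_trans with (1 := Rmin_l _ _). apply sin_incr_1; lra.
  - apply Rle_trans with (1 := Rmin_r _ _).
    rewrite <- (sin_PI_x (chi - gamma')). apply sin_incr_1; lra. }
assert (Hcg : 0 < cos gamma') by (apply cos_gt_0; lra).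
(* The right-hand side is the component of zeta - w normal to the edge, after
   reflecting both points into the upper half plane. *)
assert (Hmain : Cmod zeta * sin (chi - gamma') <=
   (Rabs (Im zeta) - Rabs (Im w)) * cos gamma' - (Re zeta - Re w) * sin gamma').
{ rewrite Hr, Hi, sin_minus. lra. }
assert (Hproj : (Rabs (Im zeta) - Rabs (Im w)) * cos gamma' - (Re zeta - Re w) * sin gamma'
    <= Cmod (w - zeta)).
{ apply Rle_trans with (Rabs (Im (w - zeta)) * cos gamma' + Re (w - zeta) * sin gamma').
  - replace (Re (w - zeta)) with (Re w - Re zeta) by reflexivity.
    replace (Im (w - zeta)) with (Im w - Im zeta) by reflexivity.
    assert (Rabs (Im zeta) - Rabs (Im w) <= Rabs (Im w - Im zeta)).
    { rewrite Rabs_minus_sym. apply Rabs_triang_inv. } nra.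
  - set (d := (w - zeta)%C). pose proof (Cmod_sq d) as Hd. pose proof (Cmod_ge_0 d).
    pose proof (sin2_cos2 gamma') as Hsc. unfold Rsqr in Hsc.
    assert (Hi2 : Rabs (Im d) * Rabs (Im d) = Im d * Im d).
    { rewrite <- Rabs_mult. apply Rabs_pos_eq. apply Rle_0_sqr. }
    set (y := Rabs (Im d)) in *. set (X := y * cos gamma' + Re d * sin gamma').
    assert (X * X <= Cmod d * Cmod d).
    { rewrite Hd, <- Hi2. unfold X.
      assert (0 <= (y * sin gamma' - Re d * cos gamma') * (y * sin gamma' - Re d * cos gamma')) by apply Rle_0_sqr.
      assert (E : (Re d * Re d + y * y) = (Re d * Re d + y * y) * (sin gamma' * sin gamma'
        + cos gamma' * cos gamma'))
        by (rewrite Hsc; ring).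
      rewrite E. lra. }
    nra. }
apply Rle_trans with (Cmod zeta * sin (chi - gamma')); [apply Rmult_le_compat_l; lra|lra].
Qed.

(** If [genfun omega z] is small then [genfun a z] is large, so [z] is near 1 and
    [genfun omega z] lies in a sector of half-angle less than [gamma]; if it is
    not small it is far from [zeta] anyway. *)
Lemma stable_near_zero h gamma : 0 < h -> alpha * PI / 2 < gamma < PI / 2 ->
  exists d, 0 < d /\ forall zeta, zeta <> RtoC 0 -> Cmod zeta <= d -> gamma <= Rabs (Carg zeta) ->
    stability_region alpha h a zeta.
Proof.
intros Hh Hg. pose proof PI_RGT_0 as HPI.
assert (Hap : 0 < alpha * PI / 2) by (assert (0 < alpha * PI) by (apply Rmult_lt_0_compat; lra); lra).
set (gamma' := (alpha * PI / 2 + gamma) / 2).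
assert (Hg' : alpha * PI / 2 < gamma' < gamma) by (unfold gamma'; lra).
destruct (genfun_sector gamma' ltac:(lra)) as [s0 [H0 K]].
pose proof (a0_pos alpha omega a omega_a a_cm) as Ha0.
exists (s0 / (8 * a O)). split; [apply Rdiv_lt_0_compat; lra|].
intros zeta Hz Hd Harg.
assert (Hm : 0 < Cmod zeta) by (apply Cmod_gt_0; auto).
set (c := Rmin (sin (gamma - gamma')) (sin gamma')).
assert (Hc : 0 < c) by (unfold c; apply Rmin_case; apply sin_gt_0; lra).
assert (Hc1 : c <= 1) by (unfold c; apply Rle_trans with (1 := Rmin_l _ _); apply SIN_bound).
apply (stable_criterion alpha omega a alpha_range omega_a a_cm h zeta (Cmod zeta * c)); auto.
{ apply Rmult_lt_0_compat; auto. }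
intros z Hz1.
pose proof (omega_genfun_inverse alpha omega a alpha_range omega_a a_cm z Hz1) as HWA. fold (genfun a z) in HWA.
set (w := genfun omega z) in *.
destruct (Rle_lt_dec (2 * Cmod zeta) (Cmod w)) as [Hbig|Hsmall].
- apply Rle_trans with (Cmod zeta); [nra|].
  pose proof (Cmod_triangle (w - zeta) zeta). replace (w - zeta + zeta)%C with w in H by ring. lra.
- apply sector_distance; auto; [lra|lra|].
  assert (Hnear : Cmod (1 - z) < s0).
  { pose proof (genfun_upper_bound z Hz1) as HB.
    assert (HM : Cmod w * Cmod (genfun a z) = 1) by (rewrite <- Cmod_mult, HWA; apply Cmod_1).
    assert (HA0 : 0 < Cmod (genfun a z)).
    { destruct (Cmod_ge_0 (genfun a z)) as [X|X]; [auto|]. rewrite <- X in HM. lra. }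
    assert (Hw2 : Cmod w < s0 / (4 * a O)).
    { apply Rlt_le_trans with (1 := Hsmall). apply Rle_trans with (2 * (s0 / (8 * a O))); [lra|].
      apply Req_le. field. lra. }
    assert (HwA : 1 < s0 / (4 * a O) * Cmod (genfun a z)) by (rewrite <- HM; apply Rmult_lt_compat_r; auto).
    apply Rmult_lt_reg_l with (Cmod (genfun a z)); [auto|].
    apply Rle_lt_trans with (1 := HB).
    apply Rmult_lt_compat_l with (r := 4 * a O) in HwA; [|lra].
    replace (4 * a O * (s0 / (4 * a O) * Cmod (genfun a z))) with (Cmod (genfun a z) * s0) in HwA
      by (field; lra). lra. }
  specialize (K z Hz1 Hnear). set (Az := genfun a z) in *.
  assert (HAz : Az <> RtoC 0).
  { intros E. rewrite E, Cmult_0_r in HWA. apply RtoC_inj in HWA. lra. }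
  assert (HAm : 0 < Cmod Az) by (apply Cmod_gt_0; auto).
  set (q := Cmod w * Cmod w).
  assert (Hw : w = (RtoC q * Cconj Az)%C).
  { unfold q. rewrite RtoC_mult.
    replace (RtoC (Cmod w) * RtoC (Cmod w))%C with (w * Cconj w)%C.
    - replace (w * Cconj w * Cconj Az)%C with (w * Cconj (w * Az))%C by (rewrite Cmult_conj; ring).
      rewrite HWA. replace (Cconj 1) with (RtoC 1) by (symmetry; apply Cconj_RtoC). ring.
    - rewrite <- Cmod2_conj, <- RtoC_mult. simpl. f_equal. ring. }
  assert (Hq : 0 <= q) by (apply Rle_0_sqr).
  assert (HRe : Re w = q * Re Az) by (rewrite Hw, re_scal_l, re_conj; reflexivity).
  assert (HIm : Im w = - (q * Im Az)).
  { rewrite Hw. rewrite im_mult, im_conj, im_RtoC, re_RtoC. ring. }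
  rewrite HRe, HIm, Rabs_Ropp, Rabs_mult, (Rabs_pos_eq q) by auto. nra.
Qed.

End Final.

(** * Continuous majorants of a modulus *)

(** [m] is the infimum of the functions [eps + K * x / d] over the pairs with
    [P eps d].  As such it increases while [m x / x] decreases, which makes it
    continuous, and it vanishes at 0.  A pair with [d < x] contributes more than
    [K].  The summand [x] makes some pair lie below the gauge although the
    infimum need not be attained. *)
Lemma continuous_gauge (P : R -> R -> Prop) (K : R) :
  0 < K -> (forall eps, 0 < eps -> exists d, 0 < d /\ P eps d) ->
  exists e : R -> R,
    (forall x, 0 <= x -> 0 <= e x) /\ e 0 = 0 /\
    (forall x, 0 <= x -> filterlim e (within (fun y => 0 <= y) (locally x)) (locally (e x))) /\
    (forall x, 0 < x -> exists eps d, 0 < eps /\ 0 < d /\ P eps d /\ eps + K * x / d <= e x).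
Proof.
intros HK HP.
set (E := fun x y => exists eps d, 0 < eps /\ 0 < d /\ P eps d /\ y = - (eps + K * x / d)).
assert (Hbound : forall x, 0 <= x -> bound (E x)).
{ intros x Hx. exists 0. intros y (eps & d & He & Hd & _ & ->).
  assert (0 <= K * x / d) by (apply Rdiv_le_0_compat; [apply Rmult_le_pos|]; lra). lra. }
assert (Hne : forall x, exists y, E x y).
{ intros x. destruct (HP 1 Rlt_0_1) as [d [Hd Hp]]. exists (- (1
  + K * x / d)), 1, d. repeat split; auto; lra. }
set (m := fun x => match Rle_dec 0 x with
   | left H => - proj1_sig (completeness (E x) (Hbound x H) (Hne x)) | right _ => 0 end).
assert (Hlow : forall x eps d, 0 <= x -> 0 < eps -> 0 < d -> P eps d -> m x <= eps + K * x / d).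
{ intros x eps d Hx He Hd Hp. unfold m. destruct (Rle_dec 0 x) as [H|H]; [|lra].
  destruct (completeness (E x) (Hbound x H) (Hne x)) as [s [Hs1 Hs2]]. simpl.
  assert (- (eps + K * x / d) <= s) by (apply Hs1; exists eps, d; auto). lra. }
assert (Hgt : forall x y, 0 <= x -> m x < y -> exists eps d, 0 < eps /\ 0 < d /\ P eps d /\ eps
  + K * x / d < y).
{ intros x y Hx Hy. apply Classical_Prop.NNPP. intros Hn.
  unfold m in Hy. destruct (Rle_dec 0 x) as [H|H]; [|lra].
  destruct (completeness (E x) (Hbound x H) (Hne x)) as [s [Hs1 Hs2]]. simpl in Hy.
  assert (s <= - y); [|lra]. apply Hs2. intros z (eps & d & He & Hd & Hp & ->).
  destruct (Rle_lt_dec y (eps + K * x / d)) as [Hc|Hc]; [lra|].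
  exfalso. apply Hn. exists eps, d. auto. }
assert (Hm0 : forall x, 0 <= x -> 0 <= m x).
{ intros x Hx. apply Rnot_lt_le. intros Hlt. destruct (Hgt x 0 Hx Hlt) as (eps & d & He & Hd & _ & Hc).
  assert (0 <= K * x / d) by (apply Rdiv_le_0_compat; [apply Rmult_le_pos|]; lra). lra. }
exists (fun x => m x + x). repeat split.
- intros x Hx. specialize (Hm0 x Hx). lra.
- assert (m 0 <= 0); [|specialize (Hm0 0 (Rle_refl _)); lra].
  apply le_epsilon. intros eps He. destruct (HP eps He) as [d [Hd Hp]].
  pose proof (Hlow 0 eps d (Rle_refl _) He Hd Hp). rewrite Rmult_0_r in H. unfold Rdiv in H. lra.
- intros x Hx. apply filterlim_locally. intros [eta Heta].
  (* An almost minimizing pair at x bounds m from above near x; monotonicity and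
     the decrease of m x / x bound it from below. *)
  assert (Hinc : forall x y, 0 <= x <= y -> m x <= m y).
  { intros u v [Hu Huv]. apply le_epsilon. intros ep Hep.
    destruct (Hgt v (m v + ep) ltac:(lra) ltac:(lra)) as (eps & d & He & Hd & Hp & Hc).
    pose proof (Hlow u eps d Hu He Hd Hp).
    assert (K * u / d <= K * v / d).
    { unfold Rdiv. apply Rmult_le_compat_r; [apply Rlt_le, Rinv_0_lt_compat; auto|].
      apply Rmult_le_compat_l; lra. } lra. }
  assert (Hscale : forall u v, 0 < u <= v -> u * m v <= v * m u).
  { intros u v [Hu Huv]. 
    assert (HX : m v <= v / u * m u).
    { apply le_epsilon. intros ep Hep.
      assert (Hr : 1 <= v / u).
      { apply Rmult_le_reg_r with u; [auto|]. unfold Rdiv. rewrite Rmult_assoc, Rinv_l; lra. }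
      destruct (Hgt u (m u + ep / (v / u)) ltac:(lra)) as (eps & d & He & Hd & Hp & Hc).
      { assert (0 < ep / (v / u)) by (apply Rdiv_lt_0_compat; lra). lra. }
      pose proof (Hlow v eps d ltac:(lra) He Hd Hp) as H1.
      apply Rmult_lt_compat_l with (r := v / u) in Hc; [|lra].
      replace (v / u * (m u + ep / (v / u))) with (v / u * m u + ep) in Hc by (field; lra).
      replace (v / u * (eps + K * u / d)) with (v / u * eps + K * v / d) in Hc by (field; lra).
      assert (eps <= v / u * eps) by nra. lra. }
    apply Rmult_le_compat_l with (r := u) in HX; [|lra].
    replace (u * (v / u * m u)) with (v * m u) in HX by (field; lra). auto. }
  destruct (Hgt x (m x + eta / 4) Hx ltac:(lra)) as (eps & d & He & Hd & Hp & Hc).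
  assert (Hup : forall y, 0 <= y -> K * Rabs (y - x) / d < eta / 4 -> m y < m x + eta / 2).
  { intros y Hy Hyx. pose proof (Hlow y eps d Hy He Hd Hp).
    assert (K * y / d <= K * x / d + K * Rabs (y - x) / d).
    { replace (K * x / d + K * Rabs (y - x) / d) with (K * (x + Rabs (y - x)) / d) by (field; lra).
      unfold Rdiv. apply Rmult_le_compat_r; [apply Rlt_le, Rinv_0_lt_compat; auto|].
      apply Rmult_le_compat_l; [lra|]. pose proof (Rle_abs (y - x)). lra. }
    lra. }
  set (r1 := eta * d / (4 * K)).
  assert (Hr1 : 0 < r1) by (apply Rdiv_lt_0_compat; [apply Rmult_lt_0_compat|]; lra).
  assert (Hr1' : forall y, Rabs (y - x) < r1 -> K * Rabs (y - x) / d < eta / 4).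
  { intros y Hy. replace (eta / 4) with (K * r1 / d) by (unfold r1; field; lra).
    unfold Rdiv. apply Rmult_lt_compat_r; [apply Rinv_0_lt_compat; auto|]. apply Rmult_lt_compat_l; auto. }
  assert (Hlo : exists r2, 0 < r2 /\ forall y, 0 <= y -> Rabs (y - x) < r2 -> m x - eta / 2 < m y).
  { destruct (Req_dec x 0) as [->|Hx0].
    - exists 1. split; [lra|]. intros y Hy _. pose proof (Hinc 0 y ltac:(lra)). lra.
    - set (r2 := x * (eta / (4 * (m x + eta)))).
      pose proof (Hm0 x Hx) as Hmx.
      assert (Hfr : 0 < eta / (4 * (m x + eta)) <= / 4).
      { split; [apply Rdiv_lt_0_compat; lra|].
        apply Rle_div_l; [lra|]. lra. }
      exists r2. split; [apply Rmult_lt_0_compat; lra|]. intros y Hy Hyx.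
      destruct (Rle_lt_dec x y) as [Hxy|Hxy]; [pose proof (Hinc x y ltac:(lra)); lra|].
      apply Rabs_lt_between in Hyx.
      assert (Hy0 : 0 < y) by (unfold r2 in Hyx; nra).
      pose proof (Hscale y x ltac:(lra)) as Hs.
      assert (Hq : x * (m x - m y) <= r2 * m x) by nra.
      assert (Hq2 : r2 * m x <= x * (eta / 4)).
      { unfold r2. rewrite Rmult_assoc. apply Rmult_le_compat_l; [lra|].
        replace (eta / (4 * (m x + eta)) * m x) with (eta / 4 * (m x / (m x + eta))) by (field; lra).
        rewrite <- (Rmult_1_r (eta / 4)) at 2. apply Rmult_le_compat_l; [lra|].
        apply Rle_div_l; [lra|]. lra. }
      assert (m x - m y <= eta / 4) by (apply Rmult_le_reg_l with x; lra). lra. }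
  destruct Hlo as [r2 [Hr2 Hlo]].
  assert (Hr : 0 < Rmin (Rmin r1 r2) (eta / 2)) by (repeat apply Rmin_case; lra).
  exists (mkposreal _ Hr). intros y Hb Hy. change (Rabs (y - x) < Rmin (Rmin r1 r2) (eta / 2)) in Hb.
  pose proof (Rmin_l (Rmin r1 r2) (eta / 2)). pose proof (Rmin_r (Rmin r1 r2) (eta / 2)).
  pose proof (Rmin_l r1 r2). pose proof (Rmin_r r1 r2).
  specialize (Hup y Hy (Hr1' y ltac:(lra))). specialize (Hlo y Hy ltac:(lra)).
  change (Rabs (m y + y - (m x + x)) < eta).
  assert (Hyx : Rabs (y - x) < eta / 2) by lra. apply Rabs_lt_between in Hyx.
  apply Rabs_lt_between. lra.
- intros x Hx. destruct (Hgt x (m x + x) ltac:(lra) ltac:(lra)) as (eps & d & He & Hd & Hp & Hc).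
  exists eps, d. repeat split; auto. lra.
Qed.

(** * The stability region *)

(** The condition says that [zeta] lies outside the closed disc of radius
    [omega 0] centred at [omega 0]. *)
Lemma stable_quadratic alpha h omega a zeta :
  0 < alpha < 1 -> 0 < h -> is_conv_inverse omega a -> CM_preserving alpha a ->
  2 * omega O * Re zeta < Cmod zeta * Cmod zeta -> stability_region alpha h a zeta.
Proof.
intros Ha Hh Hw Hcm Hz. apply (stable_outside_disc alpha omega a); auto.
pose proof (omega0_pos alpha omega a Ha Hw Hcm) as H0.
pose proof (Cmod_sq (zeta - RtoC (omega O))) as Hs. rewrite Cmod_sq in Hz.
replace (Re (zeta - RtoC (omega O))) with (Re zeta - omega O) in Hs by reflexivity.
replace (Im (zeta - RtoC (omega O))) with (Im zeta - 0) in Hs by reflexivity. rewrite Rminus_0_r in Hs.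
pose proof (Cmod_ge_0 (zeta - RtoC (omega O))). nra.
Qed.

Lemma Rmin_nonexpansive p x y : Rabs (Rmin p x - Rmin p y) <= Rabs (x - y).
Proof.
unfold Rmin. destruct (Rle_dec p x), (Rle_dec p y); unfold Rabs;
repeat destruct Rcase_abs; lra.
Qed.

Theorem theorem3p1 :
  forall (alpha h : R) (omega a : nat -> R),
    0 < alpha < 1 ->
    0 < h ->
    omega O <> 0 ->
    is_conv_inverse omega a ->
    CM_preserving alpha a ->
    ((exists M : R, forall zeta : C,
        ~ stability_region alpha h a zeta -> Cmod zeta <= M) /\
     (forall zeta : C, ~ stability_region alpha h a zeta -> 0 <= Re zeta)) /\
    (exists theta0 : R,
        0 < theta0 < PI / 2 /\
        forall zeta : C,
          sector (PI - theta0) zeta -> stability_region alpha h a zeta) /\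
    (exists (delta0 : R) (beta : R -> R),
        0 < delta0 /\
        continuous_on (fun delta => 0 <= delta <= delta0) beta /\
        (forall delta : R, 0 <= delta <= delta0 -> 0 <= beta delta <= PI) /\
        filterlim beta (at_right 0) (locally (alpha * PI / 2)) /\
        forall (delta : R) (zeta : C),
          0 < delta <= delta0 ->
          zeta <> RtoC 0 -> Cmod zeta <= delta ->
          beta delta <= Rabs (Carg zeta) ->
          stability_region alpha h a zeta) /\
    (forall zeta : C,
        Re zeta <= 0 -> zeta <> RtoC 0 -> stability_region alpha h a zeta).
Proof.
intros alpha h omega a Halpha Hh _ Hinv Hcm.
pose proof PI_RGT_0 as HPI.
pose proof (omega0_pos alpha omega a Halpha Hinv Hcm) as Hw0.
assert (Hap : 0 < alpha * PI / 2 < PI / 2) by (split; nra).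
assert (Hquad : forall zeta, 2 * omega O * Re zeta < Cmod zeta * Cmod zeta ->
   stability_region alpha h a zeta) by (intros; apply (stable_quadratic alpha h omega a); auto).
assert (Hhalf : forall zeta : C, Re zeta <= 0 -> zeta <> RtoC 0 -> stability_region alpha h a zeta).
{ intros zeta Hre Hz. apply Hquad. assert (Hm : 0 < Cmod zeta) by (apply Cmod_gt_0; auto). nra. }
split; [split|split; [|split; [|exact Hhalf]]].
- exists (2 * omega O). intros zeta Hn. apply Rnot_lt_le. intros Hlt. apply Hn, Hquad.
  pose proof (re_le_Cmod zeta) as H. apply Rabs_le_between in H. nra.
- intros zeta Hn. apply Rnot_lt_le. intros Hlt. apply Hn, Hhalf; [lra|].
  intros E. rewrite E in Hlt. simpl in Hlt. lra.
- set (gamma := (alpha * PI / 2 + PI / 2) / 2).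
  assert (Hg : alpha * PI / 2 < gamma < PI / 2) by (unfold gamma; lra).
  destruct (stable_near_zero alpha omega a Halpha Hinv Hcm h gamma Hh Hg) as [d [Hd Hst]].
  set (x := Rmin (d / (4 * omega O)) 1).
  assert (Hx : 0 < x) by (apply Rmin_case; [apply Rdiv_lt_0_compat|]; lra).
  assert (Hxd : 4 * omega O * x <= d).
  { apply Rle_trans with (4 * omega O * (d / (4 * omega O))); [|apply Req_le; field; lra].
    apply Rmult_le_compat_l; [lra|apply Rmin_l]. }
  set (theta := Rmax gamma (PI / 2 - x)).
  assert (Ht : gamma <= theta /\ PI / 2 - x <= theta /\ theta < PI / 2).
  { unfold theta. repeat split; [apply Rmax_l|apply Rmax_r|apply Rmax_case; lra]. }
  exists theta. split; [lra|]. intros zeta [Hnz Hsec].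
  assert (Hm : 0 < Cmod zeta) by (apply Cmod_gt_0; auto).
  assert (Hnz' : Copp zeta <> RtoC 0) by (apply Cmod_gt_0; rewrite Cmod_opp; auto).
  destruct (polar_abs_arg _ Hnz') as [Hb1 [Hr1 _]]. destruct (polar_abs_arg _ Hnz) as [Hb [Hr _]].
  rewrite Cmod_opp in Hr1. replace (Re (- zeta)) with (- Re zeta) in Hr1 by reflexivity.
  assert (Hc1 : cos (PI - theta) < cos (Rabs (Carg (Copp zeta)))) by (apply cos_decreasing_1; lra).
  rewrite Rtrigo_facts.cos_pi_minus in Hc1.
  assert (Hre : Re zeta < Cmod zeta * cos theta) by nra.
  destruct (Rle_lt_dec (Cmod zeta) d) as [Hle|Hgt].
  + apply Hst; auto. apply Rnot_lt_le. intros Hlt.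
    assert (cos theta < cos (Rabs (Carg zeta))) by (apply cos_decreasing_1; lra). nra.
  + apply Hquad.
    assert (Hcos : cos theta < x).
    { apply Rle_lt_trans with (cos (PI / 2 - Rmin x (PI / 2))).
      - apply cos_decr_1; try lra.
        + pose proof (Rmin_r x (PI / 2)); lra.
        + pose proof (Rmin_case x (PI / 2) (fun y => 0 < y) Hx ltac:(lra)); lra.
        + unfold Rmin; destruct (Rle_dec x (PI / 2)); lra.
      - rewrite cos_shift. apply Rlt_le_trans with (Rmin x (PI / 2)); [|apply Rmin_l].
        apply sin_lt_x. apply Rmin_case; lra. }
    assert (Re zeta < Cmod zeta * x) by nra. nra.
- set (P := fun eps d => forall zeta, zeta <> RtoC 0 -> Cmod zeta <= d ->
     alpha * PI / 2 + eps <= Rabs (Carg zeta) -> stability_region alpha h a zeta).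
  assert (HP : forall eps, 0 < eps -> exists d, 0 < d /\ P eps d).
  { intros eps He. set (eps' := Rmin eps ((PI / 2 - alpha * PI / 2) / 2)).
    assert (He' : 0 < eps' /\ eps' <= eps /\ eps' <= (PI / 2 - alpha * PI / 2) / 2).
    { unfold eps'. repeat split; [apply Rmin_case; lra|apply Rmin_l|apply Rmin_r]. }
    destruct (stable_near_zero alpha omega a Halpha Hinv Hcm h (alpha * PI / 2 + eps') Hh ltac:(lra))
      as [d [Hd Hst]].
    exists d. split; auto. intros zeta Hz Hzd Harg. apply Hst; auto. lra. }
  (* Any constant at least PI will do: a pair used beyond its radius then asks for
     an argument larger than PI. *)
  destruct (continuous_gauge P 4 ltac:(lra) HP) as (e & He0 & He00 & Hec & Heb).
  set (beta := fun x => Rmin PI (alpha * PI / 2 + e x)).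
  assert (Hcont : forall x, 0 <= x -> filterlim beta (within (fun y => 0
    <= y) (locally x)) (locally (beta x))).
  { intros x Hx. apply filterlim_locally. intros eps.
    generalize (proj1 (filterlim_locally _ _) (Hec x Hx) eps). apply filter_imp.
    intros y Hy. change (Rabs (beta y - beta x) < eps).
    change (Rabs (e y - e x) < eps) in Hy.
    apply Rle_lt_trans with (2 := Hy). unfold beta. eapply Rle_trans; [apply Rmin_nonexpansive|].
    apply Req_le. f_equal. ring. }
  exists 1, beta. split; [lra|]. split; [|split; [|split]].
  + intros x Hx. apply filterlim_locally. intros eps.
    generalize (proj1 (filterlim_locally _ _) (Hcont x (proj1 Hx)) eps).
    unfold within. apply filter_imp. intros y Hy [Hy0 _]. auto.
  + intros x Hx. unfold beta. split; [|apply Rmin_l]. specialize (He0 x (proj1 Hx)).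
    apply Rmin_case; lra.
  + assert (E : beta 0 = alpha * PI / 2).
    { unfold beta. rewrite He00, Rplus_0_r. apply Rmin_right. lra. }
    rewrite <- E. apply filterlim_locally. intros eps.
    generalize (proj1 (filterlim_locally _ _) (Hcont 0 (Rle_refl 0)) eps).
    unfold at_right, within. apply filter_imp. intros y Hy Hy0. apply Hy. lra.
  + intros delta zeta Hdelta Hz Hzd Harg.
    destruct (polar_abs_arg zeta Hz) as [Hb [Hr _]].
    assert (Hm : 0 < Cmod zeta) by (apply Cmod_gt_0; auto).
    destruct (Rle_lt_dec PI (alpha * PI / 2 + e delta)) as [Hbig|Hsm].
    * unfold beta in Harg. rewrite Rmin_left in Harg by auto.
      assert (Ex : Rabs (Carg zeta) = PI) by lra. rewrite Ex, cos_PI in Hr.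
      apply Hhalf; auto. lra.
    * unfold beta in Harg. rewrite Rmin_right in Harg by lra.
      destruct (Heb delta ltac:(lra)) as (eps & d & He & Hd & HPd & Hle).
      assert (Hfr : 0 <= 4 * delta / d) by (apply Rdiv_le_0_compat; lra).
      apply HPd; auto; [|lra].
      apply Rnot_lt_le. intros Hlt.
      assert (4 < 4 * delta / d).
      { apply Rmult_lt_reg_r with d; [auto|]. unfold Rdiv. rewrite Rmult_assoc, Rinv_l by lra. lra. }
      pose proof PI_4. lra.
Qed.
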